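(* Let $g\in L^2(\mathbb{R}^m)$ and let $\Lambda$ be a countable family of points of $\mathbb{R}^{2m}$ (repetitions allowed) such that $\mathcal{G}(g,\Lambda)$ is a frame for $L^2(\mathbb{R}^m)$. Fix $O\in\mathbb{R}^{2m}$, an invertible $M\in\mathbb{R}^{2m\times2m}$, and set $\Lambda_n=\Lambda\cap MQ_n(O)$. Then the ultrafilter frame measure function of $\mathcal{G}(g,\Lambda)$ with respect to $(\Lambda,(\Lambda_n)_n)$ is $$\mu(\mathcal{G}(g,\Lambda))(p)=\frac{1}{D(\Lambda;p,M)}\quad\text{for all }p\in\mathbb{N}^*.$$
   Context: For $\lambda=(t,\omega)\in\mathbb{R}^m\times\mathbb{R}^m$ and phase $\varphi_\lambda$, $g_\lambda(x)=e^{i\varphi_\lambda}e^{2\pi i\langle\omega,x\rangle}g(x-t)$ and $\mathcal{G}(g,\Lambda)=\{g_\lambda\}_{\lambda\in\Lambda}$ (arbitrary fixed phases), indexed by $\Lambda$. $Q_n(c)=\{\lambda\in\mathbb{R}^{2m}:\|\lambda-c\|_\infty\le n/2\}$; $\Lambda_n$ is the set of indices whose points lie in $MQ_n(O)$, counted with multiplicity. $\mathbb{N}^*$ is the set of free ultrafilters on $\mathbb{N}$ and $p\text{-}\lim$ the limit of a bounded sequence along $p$ ($p\text{-}\lim\mathbf{x}=c$ iff $\{n:|x_n-c|<\varepsilon\}\in p$ for all $\varepsilon>0$). $D(\Lambda;p,M)=p\text{-}\lim_n\frac{|\Lambda_n|}{\mathrm{vol}(MQ_n(O))}$. With $\tilde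 g_\lambda$ the canonical dual frame, $\mu(\mathcal{G}(g,\Lambda))(p)=p\text{-}\lim_n\frac{1}{|\Lambda_n|}\sum_{\lambda\in\Lambda_n}\langle g_\lambda,\tilde g_\lambda\rangle$. *)

(* Defs.v *)
(* mathcomp-analysis over an abstract R : realType,
   complex numbers R[i] from mathcomp-real-closed (with the topology that
   MathComp-Analysis puts on every numClosedFieldType). *)
From HB Require Import structures.
From mathcomp Require Import all_boot all_order all_algebra.
From mathcomp Require Import all_classical all_reals all_analysis.
From mathcomp Require Import complex.
Set Implicit Arguments. Unset Strict Implicit. Unset Printing Implicit Defensive.
Import Order.TTheory GRing.Theory Num.Theory.
Import numFieldTopology.Exports numFieldNormedType.Exports.
Local Open Scope classical_set_scope.
Local Open Scope ring_scope.
Local Open Scope complex_scope.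

Section Defs.
Variable R : realType.

(* complex numbers, seen as a numClosedFieldType (hence with their usual
   metric topology, used for limits) *)
Notation CC := (R[i] : numClosedFieldType).

(** * Analysis on R^m, points are row vectors 'rV[R]_m *)

(* Euclidean scalar product <w, x> on R^m *)
Definition dotR (m : nat) (w x : 'rV[R]_m) : R := \sum_(i < m) w 0 i * x 0 i.

(* e^{i theta} *)
Definition expi (t : R) : R[i] := cos t +i* sin t.

(* Borel sigma-algebra of R^m (generated by the open sets of the usual
   topology of 'rV[R]_m) and Borel measurability of complex functions *)
Definition borel_rV (m : nat) : set_system 'rV[R]_m :=
  smallest (sigma_algebra setT) open.
Definition measurable_rV (m : nat) (f : 'rV[R]_m -> CC) : Prop :=
  forall U : set CC, open U -> borel_rV (f @^-1` U).

(* Lebesgue integral on R^m, computed as the iterated integral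
   over the m coordinates (Fubini-Tonelli), each coordinate integrated
   against the Lebesgue measure on R.
   - iint_e : for [0,+oo]-valued integrands (Tonelli)
   - iint_r : for real integrable integrands (Fubini) *)
Fixpoint iint_e (m : nat) : ('rV[R]_m -> \bar R) -> \bar R :=
  match m with
  | 0 => fun F => F 0
  | k.+1 => fun F =>
      (\int[@lebesgue_measure R]_x iint_e (fun v : 'rV[R]_k => F (row_mx (x%:M) v)))%E
  end.

Fixpoint iint_r (m : nat) : ('rV[R]_m -> R) -> R :=
  match m with
  | 0 => fun F => F 0
  | k.+1 => fun F =>
      Rintegral (@lebesgue_measure R) setT
        (fun x => iint_r (fun v : 'rV[R]_k => F (row_mx (x%:M) v)))
  end.

(* integral of a complex integrable function on R^m *)
Definition cint (m : nat) (f : 'rV[R]_m -> R[i]) : R[i] :=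
  iint_r (fun x => complex.Re (f x)) +i* iint_r (fun x => complex.Im (f x)).

(* squared modulus of a complex number *)
Definition sqmod (z : R[i]) : R := complex.Re z ^+ 2 + complex.Im z ^+ 2.

(* L^2(R^m) : inner product, squared norm, membership *)
Definition ip (m : nat) (f h : 'rV[R]_m -> R[i]) : R[i] :=
  cint (fun x => f x * (h x)^*).
Definition l2norm2 (m : nat) (f : 'rV[R]_m -> R[i]) : \bar R :=
  iint_e (fun x => (sqmod (f x))%:E).
Definition inL2 (m : nat) (f : 'rV[R]_m -> R[i]) : Prop :=
  measurable_rV f /\ (l2norm2 f < +oo)%E.

(** * Frames indexed by a countable (infinite) index set nat *)
Definition is_frame (m : nat) (G : nat -> 'rV[R]_m -> R[i]) : Prop :=
  exists A B : R, 0 < A /\ 0 < B /\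
    forall f, inL2 f ->
      (A%:E * l2norm2 f <= \sum_(0 <= k <oo) (sqmod (ip f (G k)))%:E)%E /\
      (\sum_(0 <= k <oo) (sqmod (ip f (G k)))%:E <= B%:E * l2norm2 f)%E.

(* "S h = u" where S f = sum_k <f, G k> G k is the frame operator
   (defined weakly: <S h, f> = sum_k <h, G k> <G k, f> for every f in L^2) *)
Definition frame_op_eq (m : nat) (G : nat -> 'rV[R]_m -> R[i])
    (h u : 'rV[R]_m -> R[i]) : Prop :=
  forall f, inL2 f ->
    ((fun N => \sum_(k < N) (ip h (G k) * ip (G k) f : CC)) @ \oo --> (ip u f : CC)).

(* canonical dual frame: dual k = S^{-1} (G k) *)
Definition candual (m : nat) (G : nat -> 'rV[R]_m -> R[i]) (k : nat) :
    'rV[R]_m -> R[i] :=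
  xget (fun _ => 0 : R[i]) (fun h => inL2 h /\ frame_op_eq G h (G k)).

(** * Gabor systems *)
(* lam k = (t, w) in R^m x R^m, stored as a row vector of size m + m
   (t = left block, w = right block); phi k is the phase *)
Definition gabor (m : nat) (g : 'rV[R]_m -> R[i]) (lam : nat -> 'rV[R]_(m + m))
    (phi : nat -> R) (k : nat) : 'rV[R]_m -> R[i] :=
  fun x => expi (phi k) * expi (2 * pi * dotR (rsubmx (lam k)) x)
           * g (x - lsubmx (lam k)).

(** * Densities *)
(* Q_n(c) : sup-norm ball of side n centred at c *)
Definition Qcube (d : nat) (c : 'rV[R]_d) (n : nat) : set 'rV[R]_d :=
  [set v | forall i : 'I_d, `|v 0 i - c 0 i| <= n%:R / 2].
(* M Q_n(O), M acting on (column) vectors *)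
Definition MQ (d : nat) (M : 'M[R]_d) (O : 'rV[R]_d) (n : nat) : set 'rV[R]_d :=
  [set (M *m v^T)^T | v in Qcube O n].
(* Lebesgue measure on R^d *)
Definition vol (d : nat) (S : set 'rV[R]_d) : \bar R := iint_e (fun v => (\1_S v)%:E).

(* Lambda_n : indices whose point lies in M Q_n(O) *)
Definition Lam_n (d : nat) (lam : nat -> 'rV[R]_d) (M : 'M[R]_d) (O : 'rV[R]_d)
    (n : nat) : set nat := [set k | MQ M O n (lam k)].
(* |Lambda_n| (counted with multiplicity) *)
Definition cardL (d : nat) (lam : nat -> 'rV[R]_d) M O n : R :=
  \sum_(k \in Lam_n lam M O n) (1 : R).

(* D(Lambda; p, M) *)
Definition density (d : nat) (lam : nat -> 'rV[R]_d) (M : 'M[R]_d) (O : 'rV[R]_d)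
    (p : set_system nat) : R :=
  lim ((cardL lam M O n / fine (vol (MQ M O n))) @[n --> p]).

(* ultrafilter frame measure function mu(G(g, Lambda))(p) *)
Definition frame_measure (m : nat) (g : 'rV[R]_m -> R[i])
    (lam : nat -> 'rV[R]_(m + m)) (phi : nat -> R) (M : 'M[R]_(m + m))
    (O : 'rV[R]_(m + m)) (p : set_system nat) : R[i] :=
  let G := gabor g lam phi in
  lim ((((cardL lam M O n)^-1)%:C *
          \sum_(k \in Lam_n lam M O n) ip (G k) (candual G k) : CC) @[n --> p]).

(* free (non-principal) ultrafilters on nat *)
Definition free_ultrafilter (p : set_system nat) : Prop :=
  UltraFilter p /\ (forall A : set nat, finite_set A -> ~ p A).

End Defs.

(* Main.v *)
(* Let H_z, z = (t, w), be the indicator of the unit cube translated by t and modulated by w.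
   By Moyal's identity the integral of |<f, H_z>|^2 over phase space is |f|^2, so polarisation
   gives <g_k, g~_k> = \int a_k(z) dz for a_k(z) = Re (<H_z, g~_k> <g_k, H_z>), whereas the
   reconstruction formula for H_z gives \sum_k a_k(z) = |H_z|^2 = 1 at every point z. By
   covariance |<g_k, H_z>|^2 = F(z - lam_k) for the integrable function F(w) = |<g, H_w>|^2, so
   that a_k is concentrated near lam_k. Hence the sum over Lambda_n of \int a_k differs from the
   integral of \sum_k a_k over MQ_n(O), namely vol(MQ_n(O)), by a boundary term of smaller order:
   (1 / vol(MQ_n(O))) \sum_{Lambda_n} <g_k, g~_k> -> 1. Dividing by |Lambda_n| / vol(MQ_n(O)),
   which stays bounded and, because <g_k, g~_k> <= |g|^2 / A, bounded away from 0, gives the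
   reciprocal of the density along every free ultrafilter. *)
From HB Require Import structures.
From mathcomp Require Import all_boot all_order all_algebra.
From mathcomp Require Import all_classical all_reals all_analysis.
From mathcomp Require Import measurable_realfun complex ring lra.
Require Import Defs.
Set Implicit Arguments. Unset Strict Implicit. Unset Printing Implicit Defensive.
Import Order.TTheory GRing.Theory Num.Theory.
Import numFieldTopology.Exports numFieldNormedType.Exports.
Local Open Scope classical_set_scope.
Local Open Scope ring_scope.
Local Open Scope complex_scope.

(** Nothing is known about the localisation of the dual frame. With [al k z] standing for |<H_z,
    g~_k>|^2, only the sum over k at each z (at most 1/A) and the integral over z for each k (at
    most |g|^2 / A^2) are controlled. All concentration comes from a_k(z)^2 <= [al k z] F(z -
    lam_k), where F is integrable but has no rate of decay. So the boundary error is split at a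
    radius r. Pairs closer than r on opposite sides of the boundary force z into a ring of small
    volume. For distant pairs, AM-GM with a weight s puts a small factor on the dual and a large one
    on the tail of F; s, r and n are chosen in this order. The tail term uses a bound of |Lambda_n|
    by the volume, uniform over translates of the points, which follows from the upper frame bound
    and the positive mass of F. Cube indicators serve as windows because Moyal's identity then
    reduces, by tensor products, to the completeness of exponentials on a unit interval. The volume
    of M Q_n(O) enters only through its homogeneity in n, so the determinant of M is never
    computed. *)

Lemma quadratic_ge0_discr (R : realType) (a b c : R) :
  (forall s, 0 <= a + 2 * s * b + s ^+ 2 * c) -> b ^+ 2 <= a * c.
Proof.
move=> h.
have a0 : 0 <= a by have := h 0; rewrite mulr0 mul0r expr0n mul0r !addr0.
have c0 : 0 <= c.
  rewrite leNgt; apply/negP => c0.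
  (* If [c] were negative, this [s] would be at least 1 and give [2 * b + s * c <= -1 - a]; the
     quadratic, which is [a + s * (2 * b + s * c)], would then be at most -1. *)
  set s := (1 + 2 * `|b| + a) / - c + 1.
  have := h s; apply/negP; rewrite -ltNge.
  have cN : - c != 0 by rewrite oppr_eq0 lt_eqF.
  have s1 : 1 <= s.
    by rewrite lerDr divr_ge0 //; have := normr_ge0 b; lra.
  have sc : s * c = - (1 + 2 * `|b| + a) + c by rewrite /s; field; rewrite lt_eqF.
  have bn : b <= `|b| by exact: ler_norm.
  have X1 : 2 * b + s * c <= -1 - a by rewrite sc; clear -bn c0; move: (`|b|) bn => n bn; lra.
  have sX : 0 <= (s - 1) * (- (2 * b + s * c)) by apply: mulr_ge0; lra.
  have -> : a + 2 * s * b + s ^+ 2 * c =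
    a + (2 * b + s * c) - (s - 1) * - (2 * b + s * c) by ring.
  by lra.
have [c00|cN0] := eqVneq c 0.
  subst c; have [->|bN] := eqVneq b 0; first by rewrite expr0n mulr0.
  have := h (- (a + 1) / (2 * b)).
  have -> : 2 * (- (a + 1) / (2 * b)) * b = - (a + 1) by field.
  by move=> H; lra.
have cp : 0 < c by rewrite lt_def cN0.
have := h (- b / c).
have -> : a + 2 * (- b / c) * b + (- b / c) ^+ 2 * c = a - b ^+ 2 / c by field.
by rewrite subr_ge0 ler_pdivrMr.
Qed.

(** * Riesz representation for a semidefinite real form *)

Section Riesz.
(** [comb u s v] stands for u + s v and [D] for membership: vectors will be plain functions that are
    square-integrable under a predicate. The form may vanish on nonzero vectors, such as functions
    that are null almost everywhere. It is instantiated twice, by the energy of frame coefficients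
    and by the real part of the inner product. *)
Context (R : realType) (V : Type) (comb : V -> R -> V -> V) (D : set V)
  (b : V -> V -> R) (l : V -> R) (C : R).
Hypothesis Dcomb : forall u s v, D u -> D v -> D (comb u s v).
Hypothesis bC : forall u v, D u -> D v -> b u v = b v u.
Hypothesis bl : forall u s v w, D u -> D v -> D w ->
  b (comb u s v) w = b u w + s * b v w.
Hypothesis b_ge0 : forall u, D u -> 0 <= b u u.

Let br u s v w : D u -> D v -> D w -> b w (comb u s v) = b w u + s * b w v.
Proof.
by move=> Du Dv Dw; rewrite bC ?bl// ?(bC Du)// ?(bC Dv)//; exact: Dcomb.
Qed.

Let bcomb u s v : D u -> D v ->
  b (comb u s v) (comb u s v) = b u u + 2 * s * b u v + s ^+ 2 * b v v.
Proof.
move=> Du Dv; have Dc := Dcomb s Du Dv.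
by rewrite bl// !br// (bC Dv Du); ring.
Qed.

Lemma form_cauchy_schwarz u v : D u -> D v -> b u v ^+ 2 <= b u u * b v v.
Proof.
move=> Du Dv; apply: quadratic_ge0_discr => s.
by rewrite -bcomb//; exact/b_ge0/Dcomb.
Qed.

Hypothesis D_ex : exists u, D u.
Hypothesis D_complete : forall u : nat -> V, (forall n, D (u n)) ->
  (forall e, 0 < e -> exists N, forall i j, (N <= i)%N -> (N <= j)%N ->
     b (comb (u i) (-1) (u j)) (comb (u i) (-1) (u j)) <= e) ->
  exists2 v, D v & forall e, 0 < e -> exists N, forall i, (N <= i)%N ->
     b (comb (u i) (-1) v) (comb (u i) (-1) v) <= e.
Hypothesis C_ge0 : 0 <= C.
Hypothesis ll : forall u s v, D u -> D v -> l (comb u s v) = l u + s * l v.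
Hypothesis l_le : forall v, D v -> l v ^+ 2 <= C * b v v.

(* The representative minimises [J u = b u u - 2 l u]. *)
Theorem riesz_representation : exists2 u, D u & forall v, D v -> b u v = l v.
Proof.
have [u0 Du0] := D_ex.
pose J u := b u u - 2 * l u.
(* Twice [l u] is at most twice the square root of [C * b u u], hence at most [C + b u u]. *)
have Jlb u : D u -> - C <= J u.
  move=> Du; rewrite /J; have := l_le Du; have := b_ge0 Du.
  move: (b u u) (l u) => x y x0 yx.
  have : (2 * y) ^+ 2 <= (C + x) ^+ 2.
    by rewrite exprMn; have := sqr_ge0 (C - x); rewrite !expr2 in yx *; lra.
  have := addr_ge0 C_ge0 x0 => z0 h.
  suff : 2 * y <= C + x by lra.
  by apply: le_trans (ler_norm _) _; rewrite -ler_sqr ?nnegrE// real_normK ?num_real.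
pose I := inf [set J u | u in D].
have hI : has_inf [set J u | u in D].
  split; first by exists (J u0), u0.
  by exists (- C) => _ [u Du <-]; exact: Jlb.
have JI u : D u -> I <= J u by move=> Du; apply: ge_inf; [exact: hI.2 | exists u].
have /choice[u_ Hu] : forall n : nat, exists u, D u /\ J u < I + n.+1%:R^-1.
  move=> n; have [|_ [u Du <-] H] := @inf_adherent _ _ (n.+1%:R^-1) _ hI.
    by rewrite invr_gt0.
  by exists u.
have Du n : D (u_ n) := (Hu n).1.
have inv_small e : 0 < e -> exists N, forall i : nat, (N <= i)%N -> (i.+1%:R^-1 : R) < e.
  move=> e0; have [N HN] := ltr_add_invr e0.
  exists N => i Ni; rewrite add0r in HN; apply: le_lt_trans HN.
  by rewrite lef_pV2 ?posrE// ler_nat.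
(* Parallelogram law: at the midpoint of [u_ i] and [u_ j], [J] is still at least the infimum, yet
   it lies below the mean of the two values by a quarter of the squared distance. *)
have cauchy i j : b (comb (u_ i) (-1) (u_ j)) (comb (u_ i) (-1) (u_ j)) <=
    2 * (i.+1%:R^-1 + j.+1%:R^-1).
  set w := comb (u_ j) (-1) (u_ i).
  have Dw : D w by exact: Dcomb.
  have := JI _ (Dcomb (2^-1) (Du i) Dw).
  have := (Hu i).2; have := (Hu j).2.
  rewrite /J (bcomb _ (Du i) Dw) (ll _ (Du i) Dw) /w.
  rewrite (bcomb _ (Du j) (Du i)) (bcomb _ (Du i) (Du j)) (ll _ (Du j) (Du i)).
  rewrite (br (-1) (Du j) (Du i) (Du i)) (bC (Du j) (Du i)).
  set x := i.+1%:R^-1; set y := j.+1%:R^-1 => *; lra.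
have [v Dv Hv] : exists2 v, D v & forall e, 0 < e -> exists N, forall i, (N <= i)%N ->
     b (comb (u_ i) (-1) v) (comb (u_ i) (-1) v) <= e.
  apply: D_complete => // e e0.
  have [|N HN] := inv_small (e / 4); first by rewrite divr_gt0.
  exists N => i j Ni Nj; apply: le_trans (cauchy i j) _.
  have := HN _ Ni; have := HN _ Nj; set x := i.+1%:R^-1; set y := j.+1%:R^-1 => *; lra.
exists v => // w Dw.
(* First variation: a move by [s] times [w] cannot bring [J] below its infimum, from which
   [J (u_ n)] is less than 1/(n+1) away. *)
have euler n s : 0 <= 2 * s * (b (u_ n) w - l w) + s ^+ 2 * b w w + n.+1%:R^-1.
  have := JI _ (Dcomb s (Du n) Dw); have := (Hu n).2.
  by rewrite /J bcomb// ll//; set x := n.+1%:R^-1 => *; lra.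
set dlt := b v w - l w.
have conv e : 0 < e -> exists2 n : nat, n.+1%:R^-1 < e & `|b (u_ n) w - b v w| <= e.
  move=> e0; have bw0 := b_ge0 Dw.
  have [N1 H1] := inv_small _ e0.
  have [|N2 H2] := Hv (e ^+ 2 / (b w w + 1)); first by rewrite divr_gt0 ?exprn_gt0//; lra.
  exists (maxn N1 N2); first by apply: H1; rewrite leq_maxl.
  set n := maxn _ _; have := form_cauchy_schwarz (Dcomb (-1) (Du n) Dv) Dw.
  rewrite bl// mulN1r => /le_trans H.
  have /H : b (comb (u_ n) (-1) v) (comb (u_ n) (-1) v) * b w w <= e ^+ 2.
    apply: (@le_trans _ _ (e ^+ 2 / (b w w + 1) * b w w)).
      by rewrite ler_wpM2r// H2// leq_maxr.
    rewrite -mulrA ler_piMr ?sqr_ge0// mulrC ler_pdivrMr; lra.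
  by move=> h; rewrite -ler_sqr ?nnegrE ?normr_ge0 ?(ltW e0)// real_normK ?num_real.
have key s : 0 <= s ^+ 2 * b w w + 2 * s * dlt.
  apply/ler_addgt0Pr => e e0; rewrite /dlt.
  (* The tolerance d satisfies d + 2 |s| d = e/2, so it pays for the defect of minimality and for
     the pairing multiplied by [2 * s]. *)
  have [|n n1 n2] := conv (e / 2 / (1 + 2 * `|s|)).
    by rewrite !divr_gt0// ltr_pwDl// mulr_ge0.
  set d := e / 2 / (1 + 2 * `|s|) in n1 n2.
  have dE : d + 2 * (`|s| * d) = e / 2.
    by rewrite /d; field; rewrite gt_eqF// ltr_pwDl// mulr_ge0.
  have := euler n s.
  have : s * (b (u_ n) w - b v w) <= `|s| * d.
    by rewrite (le_trans (ler_norm _))// normrM ler_wpM2l.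
  move: (n.+1%:R^-1) n1 (b (u_ n) w) (b v w) (`|s| * d) dE => t n1 x y z *; lra.
(* A nonnegative quadratic in [s] without constant term has no linear term. *)
have : (dlt) ^+ 2 <= 0 * b w w.
  by apply: quadratic_ge0_discr => s; rewrite add0r addrC.
by rewrite mul0r => d0; apply/eqP; rewrite -subr_eq0 -sqrf_eq0 eq_le d0 sqr_ge0.
Qed.
End Riesz.

(** * Complex numbers through their real and imaginary parts *)

Notation re := complex.Re.
Notation im := complex.Im.

Section Complex.
Context (R : realType).
Implicit Types z w : R[i].

Lemma re_add z w : re (z + w) = re z + re w. Proof. by case: z; case: w. Qed.
Lemma im_add z w : im (z + w) = im z + im w. Proof. by case: z; case: w. Qed.
Lemma re_opp z : re (- z) = - re z. Proof. by case: z. Qed.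
Lemma im_opp z : im (- z) = - im z. Proof. by case: z. Qed.
Lemma re_mul z w : re (z * w) = re z * re w - im z * im w.
Proof. by case: z; case: w. Qed.
Lemma im_mul z w : im (z * w) = re z * im w + im z * re w.
Proof. by case: z; case: w. Qed.
Lemma re_conj z : re z^* = re z. Proof. by case: z. Qed.
Lemma im_conj z : im z^* = - im z. Proof. by case: z. Qed.
Lemma re_real (a : R) : re a%:C = a. Proof. by []. Qed.
Lemma im_real (a : R) : im a%:C = 0. Proof. by []. Qed.

Definition reim := (re_add, im_add, re_opp, im_opp, re_mul, im_mul,
  re_conj, im_conj, re_real, im_real).

Lemma complexP z w : re z = re w -> im z = im w -> z = w.
Proof. by case: z; case: w => ? ? ? ? /= -> ->. Qed.

Lemma sqmod_ge0 z : 0 <= sqmod z.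
Proof. by rewrite addr_ge0 ?sqr_ge0. Qed.

Lemma sqmod0 : sqmod (0 : R[i]) = 0.
Proof. by rewrite /sqmod expr0n addr0. Qed.

Lemma sqmodM z w : sqmod (z * w) = sqmod z * sqmod w.
Proof. by rewrite /sqmod !reim; ring. Qed.

Lemma sqmodC z : sqmod z^* = sqmod z.
Proof. by rewrite /sqmod !reim sqrrN. Qed.

Lemma mul_conj z : z * z^* = (sqmod z)%:C.
Proof. by apply: complexP; rewrite /sqmod !reim; ring. Qed.

Lemma sqmod_eq0 z : sqmod z = 0 -> z = 0.
Proof.
move=> /eqP; rewrite paddr_eq0 ?sqr_ge0// !sqrf_eq0 => /andP[/eqP a /eqP b].
exact: complexP.
Qed.

Lemma sqmodD_le z w : sqmod (z + w) <= 2 * (sqmod z + sqmod w).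
Proof.
rewrite /sqmod !reim.
have := sqr_ge0 (re z - re w); have := sqr_ge0 (im z - im w); rewrite !expr2; lra.
Qed.

Lemma re_conj_mul_le z w : `|re (z * w^*)| <= sqmod z + sqmod w.
Proof.
rewrite /sqmod !reim ler_norml.
have := sqr_ge0 (re z - re w); have := sqr_ge0 (im z - im w).
have := sqr_ge0 (re z + re w); have := sqr_ge0 (im z + im w).
have := sqr_ge0 (re w); have := sqr_ge0 (im w).
have := sqr_ge0 (re z); have := sqr_ge0 (im z).
by rewrite !expr2 => *; apply/andP; split; lra.
Qed.

(** Multiplication by -i turns the imaginary part into the real part and preserves the modulus. *)
Lemma im_conj_mul_le z w : `|im (z * w^*)| <= sqmod z + sqmod w.
Proof.
have -> : im (z * w^*) = re ((0 +i* -1) * z * w^*).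
  by case: (z) (w) => a b [c e]; rewrite /=; ring.
have -> : sqmod z = sqmod ((0 +i* -1) * z) by case: (z) => a b; rewrite /sqmod /=; ring.
exact: re_conj_mul_le.
Qed.

(** Trades a modulus for its square with a free weight; with weight 2^-j it bounds a series of
    moduli by a weighted series of squares. *)
Lemma re_le_sqmod z s : 0 < s -> `|re z| <= s + s^-1 * sqmod z.
Proof.
move=> s0; rewrite -(ler_pM2l s0) mulrDr mulVKf ?gt_eqF//.
have : `|re z| ^+ 2 <= sqmod z by rewrite real_normK ?num_real// lerDl sqr_ge0.
move: `|re z| => x; have := sqr_ge0 (s - x); have := sqr_ge0 (s + x).
by have := sqr_ge0 x; rewrite !expr2 => *; lra.
Qed.

Lemma im_le_sqmod z s : 0 < s -> `|im z| <= s + s^-1 * sqmod z.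
Proof.
move=> s0; have -> : im z = re ((0 +i* -1) * z) by case: (z) => a b; rewrite /=; ring.
have -> : sqmod z = sqmod ((0 +i* -1) * z) by case: (z) => a b; rewrite /sqmod /=; ring.
exact: re_le_sqmod.
Qed.

End Complex.

(** * Square-integrable complex functions *)

Section L2.
Context d (X : measurableType d) (R : realType) (mu : {measure set X -> \bar R}).
Implicit Types f h u v : X -> R[i].

Definition cmeas f :=
  measurable_fun setT (fun x => re (f x)) /\ measurable_fun setT (fun x => im (f x)).

Definition L2 f := cmeas f /\ (\int[mu]_x (sqmod (f x))%:E < +oo)%E.

Definition cintegrable f :=
  mu.-integrable setT (EFin \o (fun x => re (f x))) /\
  mu.-integrable setT (EFin \o (fun x => im (f x))).

(** Both parts are real integrals with a default value, so [cI] and [cip] are total; their algebraic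
    laws carry integrability or [L2] hypotheses. *)
Definition cI f : R[i] :=
  (\int[mu]_x re (f x)) +i* (\int[mu]_x im (f x)).

Definition cip f h := cI (fun x => f x * (h x)^*).

(** This is the squared norm; estimates are stated with squares throughout. *)
Definition nrm f : R := re (cip f f).

Lemma cmeas_cst (c : R[i]) : cmeas (fun=> c).
Proof. by split; exact: measurable_cst. Qed.

Lemma cmeasD f h : cmeas f -> cmeas h -> cmeas (fun x => f x + h x).
Proof.
move=> [f1 f2] [h1 h2]; split.
  by under eq_fun do rewrite re_add; exact: measurable_funD.
by under eq_fun do rewrite im_add; exact: measurable_funD.
Qed.

Lemma cmeasM f h : cmeas f -> cmeas h -> cmeas (fun x => f x * h x).
Proof.
move=> [f1 f2] [h1 h2]; split.
  by under eq_fun do rewrite re_mul; apply: measurable_funB; exact: measurable_funM.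
by under eq_fun do rewrite im_mul; apply: measurable_funD; exact: measurable_funM.
Qed.

Lemma cmeas_conj f : cmeas f -> cmeas (fun x => (f x)^*).
Proof.
move=> [f1 f2]; split; first by under eq_fun do rewrite re_conj.
by under eq_fun do rewrite im_conj; exact: measurableT_comp.
Qed.

Lemma cmeas_comb f h (c : R[i]) : cmeas f -> cmeas h -> cmeas (fun x => f x + c * h x).
Proof. by move=> mf mh; apply: cmeasD => //; apply: cmeasM => //; exact: cmeas_cst. Qed.

Lemma cmeas_sqmod f : cmeas f -> measurable_fun setT (fun x => sqmod (f x)).
Proof. by move=> [f1 f2]; apply: measurable_funD; exact: measurable_funX. Qed.

Lemma cmeas_esqmod f : cmeas f -> measurable_fun setT (fun x => (sqmod (f x))%:E).
Proof. by move=> mf; apply/measurable_EFinP; exact: cmeas_sqmod. Qed.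

Lemma L2_cmeas f : L2 f -> cmeas f. Proof. by case. Qed.

Lemma int_sqmodM c f : cmeas f ->
  (\int[mu]_x (sqmod (c * f x))%:E = (sqmod c)%:E * \int[mu]_x (sqmod (f x))%:E)%E.
Proof.
move=> mf; under eq_integral do rewrite sqmodM EFinM.
rewrite ge0_integralZl_EFin ?sqmod_ge0//.
- by move=> x _; rewrite lee_fin sqmod_ge0.
- exact: cmeas_esqmod.
Qed.

Lemma L2M c f : L2 f -> L2 (fun x => c * f x).
Proof.
move=> [mf lf]; split; first by apply: cmeasM => //; exact: cmeas_cst.
by rewrite int_sqmodM// lte_mul_pinfty ?lee_fin ?sqmod_ge0.
Qed.

Lemma L2D f h : L2 f -> L2 h -> L2 (fun x => f x + h x).
Proof.
move=> [mf lf] [mh lh]; split; first exact: cmeasD.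
apply: (@le_lt_trans _ _ (\int[mu]_x (2%:E * ((sqmod (f x))%:E + (sqmod (h x))%:E)))%E).
  apply: ge0_le_integral => //.
  - by move=> x _; rewrite lee_fin sqmod_ge0.
  - exact/cmeas_esqmod/cmeasD.
  - by apply: measurable_funeM; apply: emeasurable_funD; exact: cmeas_esqmod.
  - by move=> x _; rewrite -EFinD -EFinM lee_fin sqmodD_le.
rewrite ge0_integralZl_EFin//; last 2 first.
- by move=> x _; rewrite -EFinD lee_fin addr_ge0 ?sqmod_ge0.
- by apply: emeasurable_funD; exact: cmeas_esqmod.
rewrite ge0_integralD//; last 4 first.
- by move=> x _; rewrite lee_fin sqmod_ge0.
- exact: cmeas_esqmod.
- by move=> x _; rewrite lee_fin sqmod_ge0.
- exact: cmeas_esqmod.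
by rewrite lte_mul_pinfty// lte_add_pinfty.
Qed.

Lemma L2_comb f h c : L2 f -> L2 h -> L2 (fun x => f x + c * h x).
Proof. by move=> ? ?; apply: L2D => //; exact: L2M. Qed.

Lemma L2_0 : L2 (fun=> 0).
Proof.
split; first exact: cmeas_cst.
by under eq_integral do rewrite sqmod0; rewrite integral0.
Qed.

Lemma sqmod_dominated_integrable (phi : X -> R) f h : measurable_fun setT phi ->
  (forall x, `|phi x| <= sqmod (f x) + sqmod (h x)) ->
  L2 f -> L2 h -> mu.-integrable setT (EFin \o phi).
Proof.
move=> mphi le [mf lf] [mh lh]; apply/integrableP; split; first exact/measurable_EFinP.
apply: (@le_lt_trans _ _ (\int[mu]_x ((sqmod (f x))%:E + (sqmod (h x))%:E))%E).
  apply: ge0_le_integral => //.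
  - by apply: measurableT_comp => //; exact/measurable_EFinP.
  - by apply: emeasurable_funD; exact: cmeas_esqmod.
  - by move=> x _; rewrite -EFinD lee_fin le.
rewrite ge0_integralD//; last 4 first.
- by move=> x _; rewrite lee_fin sqmod_ge0.
- exact: cmeas_esqmod.
- by move=> x _; rewrite lee_fin sqmod_ge0.
- exact: cmeas_esqmod.
by rewrite lte_add_pinfty.
Qed.

Lemma L2_cintegrable f h : L2 f -> L2 h -> cintegrable (fun x => f x * (h x)^*).
Proof.
move=> lf lh; have [m1 m2] := cmeasM (L2_cmeas lf) (cmeas_conj (L2_cmeas lh)).
split; apply: (sqmod_dominated_integrable _ _ lf lh) => // x.
  exact: re_conj_mul_le.
exact: im_conj_mul_le.
Qed.

Lemma eq_cI f h : f =1 h -> cI f = cI h.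
Proof. by move=> e; rewrite /cI; congr (_ +i* _); apply: eq_Rintegral => x _; rewrite e. Qed.

Lemma cI_comb f h c : cintegrable f -> cintegrable h ->
  cI (fun x => f x + c * h x) = cI f + c * cI h.
Proof.
move=> [f1 f2] [h1 h2].
have Z r g : mu.-integrable setT (EFin \o g) ->
  mu.-integrable setT (EFin \o (fun x : X => r * g x)).
  exact: (@integrableZl _ _ _ _ _ measurableT r).
apply: complexP; rewrite /= !reim /=.
  under eq_Rintegral do rewrite !reim.
  rewrite RintegralD// ?RintegralB// ?RintegralZl//; try exact: Z.
  exact: (integrableB measurableT (Z _ _ h1) (Z _ _ h2)).
under eq_Rintegral do rewrite !reim.
rewrite RintegralD// ?RintegralD// ?RintegralZl//; try exact: Z.
exact: (integrableD measurableT (Z _ _ h2) (Z _ _ h1)).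
Qed.

Lemma cip_comb u v w c : L2 u -> L2 v -> L2 w ->
  cip (fun x => u x + c * v x) w = cip u w + c * cip v w.
Proof.
move=> lu lv lw; rewrite -cI_comb; try exact: L2_cintegrable.
by apply: eq_cI => x; rewrite mulrDl mulrA.
Qed.

Lemma cIC f : cintegrable f -> cI (fun x => (f x)^*) = (cI f)^*.
Proof.
move=> [_ f2]; apply: complexP; rewrite !reim /=.
  by apply: eq_Rintegral => x _; rewrite re_conj.
under eq_Rintegral do rewrite im_conj -mulN1r.
by rewrite RintegralZl// mulN1r.
Qed.

Lemma cipC u v : L2 u -> L2 v -> cip v u = (cip u v)^*.
Proof.
move=> lu lv; rewrite -cIC; last exact: L2_cintegrable.
by apply: eq_cI => x; rewrite rmorphM /= conjcK mulrC.
Qed.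

Lemma cipZ u v c : L2 u -> L2 v -> cip (fun x => c * u x) v = c * cip u v.
Proof.
move=> lu lv; have := cip_comb c L2_0 lu lv.
have -> : cip (fun=> 0) v = 0.
  rewrite /cip (@eq_cI _ (fun=> 0)); last by move=> x; rewrite mul0r.
  by rewrite /cI/= !Rintegral_cst// !mul0r.
by rewrite add0r => <-; apply: eq_cI => x; rewrite add0r.
Qed.

Lemma cip_combr u v w c : L2 u -> L2 v -> L2 w ->
  cip w (fun x => u x + c * v x) = cip w u + c^* * cip w v.
Proof.
move=> lu lv lw; rewrite (cipC (L2_comb c lu lv) lw) cip_comb// rmorphD rmorphM.
by rewrite (cipC lu lw) (cipC lv lw).
Qed.

Lemma cipZr u v c : L2 u -> L2 v -> cip u (fun x => c * v x) = c^* * cip u v.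
Proof. by move=> lu lv; rewrite (cipC (L2M c lv) lu) cipZ// rmorphM (cipC lv lu). Qed.

Lemma nrmE f : L2 f -> (nrm f)%:E = (\int[mu]_x (sqmod (f x))%:E)%E.
Proof.
move=> lf; rewrite /nrm /cip /= /Rintegral.
under eq_integral do rewrite mul_conj re_real.
rewrite fineK// ge0_fin_numE; first exact: lf.2.
by apply: integral_ge0 => x _; rewrite lee_fin sqmod_ge0.
Qed.

Lemma nrm_ge0 f : L2 f -> 0 <= nrm f.
Proof.
move=> lf; rewrite -lee_fin nrmE//.
by apply: integral_ge0 => x _; rewrite lee_fin sqmod_ge0.
Qed.

Lemma cip_self f : L2 f -> cip f f = (nrm f)%:C.
Proof.
move=> lf; apply: complexP; rewrite !reim//=.
rewrite (@eq_Rintegral _ _ _ _ _ (fun=> 0)); first by rewrite Rintegral_cst// mul0r.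
by move=> x _; rewrite mul_conj im_real.
Qed.

Lemma nrm_comb u v c : L2 u -> L2 v ->
  nrm (fun x => u x + c * v x) = nrm u + 2 * re (c^* * cip u v) + sqmod c * nrm v.
Proof.
move=> lu lv; have lw := L2_comb c lu lv.
rewrite -[LHS]re_real -cip_self// cip_comb// !cip_combr// (cipC lu lv) !cip_self//.
clear lw; move: (nrm u) (nrm v) (cip u v) => x y [a b]; case: c => e g.
by rewrite /sqmod /=; ring.
Qed.

(** Perturbing [u] by [s] times [c * v], with [c] the inner product itself, makes the cross term 2 s
    |c|^2 real, so the real discriminant applies; the outcome is divided by |c|^2. *)
Lemma cip_cauchy_schwarz u v : L2 u -> L2 v -> sqmod (cip u v) <= nrm u * nrm v.
Proof.
move=> lu lv; set c := cip u v.
have : 0 <= nrm v by exact: nrm_ge0.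
have : sqmod c ^+ 2 <= nrm u * (sqmod c * nrm v).
  apply: quadratic_ge0_discr => s.
  have := nrm_ge0 (L2_comb (s%:C * c) lu lv); rewrite nrm_comb// -/c; move: (nrm u) (nrm v) => x y; case: c => a b.
  rewrite /sqmod /= => H; apply: le_trans H _.
  by rewrite le_eqVlt; apply/orP; left; apply/eqP; ring.
have [c0|cN] := eqVneq (sqmod c) 0.
  by rewrite c0 => _ vg; rewrite mulr_ge0// nrm_ge0.
have cp : 0 < sqmod c by rewrite lt_def cN sqmod_ge0.
by rewrite expr2 mulrCA ler_pM2l.
Qed.

End L2.

(** * Completeness of the space of square-integrable functions *)

Lemma limn_einf_le_bound (R : realType) (u : (\bar R)^nat) (l : \bar R) :
  (forall n, (u n <= l)%E) -> (limn_einf u <= l)%E.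
Proof.
move=> ul; rewrite limn_einf_lim; apply: lime_le; first exact: is_cvg_einfs.
by apply: nearW => n; apply: ge_ereal_inf; exists (u n) => //; exists n => /=.
Qed.

Lemma cvg_series_of_weighted_squares (R : realType) (v : R^nat) (a : R^nat) :
  (forall j, `|a j| <= 2^-1 ^+ j + 2 ^+ j * v j) -> (forall j, 0 <= v j) ->
  (\sum_(0 <= j <oo) (2 ^+ j * v j)%:E < +oo)%E -> cvgn (series a).
Proof.
move=> av v0 fin; apply: normed_cvg.
have cw : cvgn (series (fun j => 2 ^+ j * v j)).
  by apply: nnseries_is_cvg => // j; rewrite mulr_ge0// exprn_ge0.
have cg : cvgn (series (fun j => 2^-1 ^+ j : R)).
  have := @is_cvg_geometric_series R 1 2^-1.
  rewrite (_ : geometric 1 2^-1 = (fun j => 2^-1 ^+ j)); last first.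
    by apply/funext => j; rewrite /= mul1r.
  apply; rewrite ger0_norm ?invr_ge0// invf_lt1//; lra.
apply: (@series_le_cvg _ _ (fun j => 2^-1 ^+ j + 2 ^+ j * v j)) => //.
- by move=> j; rewrite /= normr_ge0.
- by move=> j; rewrite addr_ge0// ?exprn_ge0 ?invr_ge0// mulr_ge0// exprn_ge0.
exact: (is_cvg_seriesD cg cw).
Qed.

Section Complete.
Context d (X : measurableType d) (R : realType) (mu : {measure set X -> \bar R}).
Local Notation csub u v := (fun x => u x + (-1)%:C * v x).

Let L2sub (f h : X -> R[i]) : L2 mu f -> L2 mu h -> L2 mu (csub f h).
Proof. exact: L2_comb. Qed.

(** Riesz-Fischer: a rapidly converging subsequence converges almost everywhere, and Fatou's lemma
    carries the Cauchy estimate to its limit. *)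
Lemma L2_complete (u : nat -> X -> R[i]) : (forall n, L2 mu (u n)) ->
  (forall e, 0 < e -> exists N, forall i j, (N <= i)%N -> (N <= j)%N ->
     nrm mu (csub (u i) (u j)) <= e) ->
  exists2 v, L2 mu v & forall e, 0 < e -> exists N, forall i, (N <= i)%N ->
     nrm mu (csub (u i) v) <= e.
Proof.
move=> Lu cauchy.
have /choice[T HT] : forall j : nat, exists N, forall i k, (N <= i)%N -> (N <= k)%N ->
    nrm mu (csub (u i) (u k)) <= 4^-1 ^+ j.
  by move=> j; apply: cauchy; rewrite exprn_gt0// invr_gt0.
(* Adding [j] and all earlier thresholds makes [s] nondecreasing, with [T j <= s j] and
   [j <= s j]. *)
pose s j : nat := (j + \sum_(i < j.+1) T i)%N.
have Ts j : (T j <= s j)%N by rewrite /s big_ord_recr/= addnA leq_addl.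
have sS j : (s j <= s j.+1)%N by rewrite /s [in leqRHS]big_ord_recr/= leq_add// leq_addr.
have smono : {homo s : i j / (i <= j)%N} by apply: homo_leq => //; exact: leq_trans.
pose dl j := csub (u (s j.+1)) (u (s j)).
have Ldl j : L2 mu (dl j) by exact: L2sub.
have ndl j : (\int[mu]_x (sqmod (dl j x))%:E <= (4^-1 ^+ j)%:E)%E.
  by rewrite -nrmE// lee_fin HT// (leq_trans (Ts j)).
(* Weights 2^j against integrals of size 4^-j leave a total of at most 2, so [S] is finite almost
   everywhere; where it is finite, the parts of [dl j] are bounded by 2^-j + 2^j |dl j|^2 and hence
   summable. *)
pose S x := (\sum_(0 <= j <oo) (2 ^+ j * sqmod (dl j x))%:E)%E.
have mS j : measurable_fun setT (fun x => (2 ^+ j * sqmod (dl j x))%:E).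
  by apply/measurable_EFinP/measurable_funM => //; exact/cmeas_sqmod/L2_cmeas.
have S0 j x : (0 <= (2 ^+ j * sqmod (dl j x))%:E)%E.
  by rewrite lee_fin mulr_ge0 ?exprn_ge0 ?sqmod_ge0.
have Sint : (\int[mu]_x S x < +oo)%E.
  rewrite integral_nneseries//.
  apply: (@le_lt_trans _ _ (\sum_(0 <= j <oo) (2^-1 ^+ j)%:E)%E).
    apply: lee_nneseries => [j _ _|j _]; first by apply: integral_ge0 => x _; exact: S0.
    under eq_integral do rewrite EFinM.
    rewrite ge0_integralZl_EFin ?exprn_ge0//; last 2 first.
    - by move=> x _; rewrite lee_fin sqmod_ge0.
    - exact/cmeas_esqmod/L2_cmeas.
    apply: le_trans (lee_wpmul2l _ (ndl j)) _; first by rewrite lee_fin exprn_ge0.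
    by rewrite -EFinM lee_fin -exprMn (_ : 2 / 4 = 2^-1)//; lra.
  apply: (@le_lt_trans _ _ 2%:E); last exact: ltry.
  apply: lime_le; first by apply: is_cvg_nneseries => *; rewrite lee_fin exprn_ge0.
  apply: nearW => n; rewrite sumEFin lee_fin.
  suff -> : \sum_(0 <= j < n) (2^-1 : R) ^+ j = 2 - 2 * 2^-1 ^+ n.
    by rewrite gerBl mulr_ge0// exprn_ge0.
  elim: n => [|n IH]; first by rewrite big_nil expr0; lra.
  by rewrite big_nat_recr//= IH exprS; field.
have mSS : measurable_fun setT S by apply: ge0_emeasurable_sum.
have aeS : {ae mu, forall x, (S x < +oo)%E}.
  have : mu.-integrable setT S.
    apply/integrableP; split => //.
    rewrite (eq_integral S)// => x _; rewrite gee0_abs//.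
    by apply: nneseries_ge0 => *; exact: S0.
  move=> /(integrable_ae measurableT); apply: filterS => x /(_ I).
  by rewrite ge0_fin_numE//; apply: nneseries_ge0 => *; exact: S0.
(* Upper limits are measurable and defined everywhere, and they agree with the limits wherever [S]
   is finite. *)
pose vr x := fine (limn_esup (fun j => (re (u (s j) x))%:E)).
pose vi x := fine (limn_esup (fun j => (im (u (s j) x))%:E)).
pose v x := vr x +i* vi x.
have mv : cmeas v.
  by split; apply: (@measurableT_comp _ _ _ _ _ _ fine) => //;
    apply: measurable_fun_limn_esup => j; apply/measurable_EFinP;
    case: (L2_cmeas (Lu (s j))).
have vcvg x : (S x < +oo)%E ->
    (fun j => re (u (s j) x)) @ \oo --> re (v x) /\
    (fun j => im (u (s j) x)) @ \oo --> im (v x).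
  move=> Sx.
  have tel (p : R[i] -> R) : (forall z w, p (z + (-1)%:C * w) = p z - p w) ->
     (forall z r, 0 < r -> `|p z| <= r + r^-1 * sqmod z) ->
     cvgn (fun j => p (u (s j) x)).
    move=> pB ple.
    have : cvgn (series (fun j => p (dl j x))).
      apply: (@cvg_series_of_weighted_squares _ (fun j => sqmod (dl j x))) => // j.
        by have -> : 2 ^+ j = (2^-1 ^+ j)^-1 :> R; [rewrite exprVn invrK | apply: ple; rewrite exprn_gt0 ?invr_gt0].
      exact: sqmod_ge0.
    have -> : series (fun j => p (dl j x)) = (fun j => p (u (s j) x) - p (u (s 0) x)).
      apply/funext; elim => [|n IH]; first by rewrite /series/= big_nil subrr.
      by rewrite seriesSr IH /dl pB; ring.
    move=> /cvg_ex[l lP]; apply/cvg_ex; exists (l + p (u (s 0%N) x)).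
    rewrite (_ : (fun j => _) = (fun j => p (u (s j) x) - p (u (s 0%N) x) + p (u (s 0%N) x))).
      by apply: cvgD lP _; exact: cvg_cst.
    by apply/funext => j; rewrite subrK.
  have lim (p : nat -> R) : cvgn p -> p @ \oo --> fine (limn_esup (fun j => (p j)%:E)).
    move=> cp; rewrite is_cvg_limn_esupE; last first.
      by apply/cvg_ex; exists (limn p)%:E; apply: cvg_EFin => //; exact: nearW.
    by rewrite EFin_lim//=.
  split; apply: lim; apply: tel.
  - by move=> z w; rewrite !reim; ring.
  - exact: re_le_sqmod.
  - by move=> z w; rewrite !reim; ring.
  - exact: im_le_sqmod.
have main e N : 0 < e -> (forall i j, (N <= i)%N -> (N <= j)%N ->
     nrm mu (csub (u i) (u j)) <= e) -> forall i, (N <= i)%N ->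
     (\int[mu]_x (sqmod (csub (u i) v x))%:E <= e%:E)%E.
  move=> e0 HN i Ni.
  (* The shift by [N] keeps every index [s (j + N)] beyond [N], where the Cauchy bound holds. *)
  pose F j x := (sqmod (csub (u i) (u (s (j + N)%N)) x))%:E.
  have LF j : L2 mu (csub (u i) (u (s (j + N)%N))) by exact: L2sub.
  have mF j : measurable_fun setT (F j) by exact/cmeas_esqmod/L2_cmeas.
  apply: (@le_trans _ _ (\int[mu]_x limn_einf (F ^~ x))%E).
    apply: ae_ge0_le_integral => //.
    - by move=> x _; rewrite lee_fin sqmod_ge0.
    - by apply/cmeas_esqmod/cmeas_comb => //; exact: L2_cmeas.
    - move=> x _; rewrite limn_einf_lim; apply: lime_ge; first exact: is_cvg_einfs.
      apply: nearW => n; apply: le_ereal_inf_tmp => _ [k _ <-].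
      by rewrite lee_fin sqmod_ge0.
    - rewrite (_ : (fun x => _) = (fun x => - limn_esup (fun j => - F j x))%E)//.
      by apply: measurableT_comp => //; apply: measurable_fun_limn_esup => j; exact: measurableT_comp.
    - apply: filterS aeS => x /vcvg[cr ci] _.
      suff H : F ^~ x @ \oo --> (sqmod (csub (u i) v x))%:E.
        by rewrite is_cvg_limn_einfE; [rewrite (cvg_lim _ H) | apply/cvg_ex; eexists; exact: H].
      apply: cvg_EFin; first exact: nearW.
      have cs (a b : R) (p : R^nat) : p @ \oo --> b ->
          (fun j => (a - p (j + N)%N) ^+ 2) @ \oo --> (a - b) ^+ 2.
        move=> pb; have h : (fun j => a - p (j + N)%N) @ \oo --> a - b.
          by apply: cvgB; [exact: cvg_cst | have := pb; rewrite -(cvg_shiftn N)].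
        by rewrite expr2; under eq_fun do rewrite expr2; exact: cvgM.
      have := cvgD (cs (re (u i x)) _ _ cr) (cs (im (u i x)) _ _ ci).
      have E z w : sqmod (z + (-1)%:C * w : R[i]) = (re z - re w) ^+ 2 + (im z - im w) ^+ 2.
        by rewrite /sqmod !reim; ring.
      rewrite E; set q := (X in X @ \oo --> _) => H.
      rewrite (_ : q = (fun j => (re (u i x) - re (u (s (j + N)%N) x)) ^+ 2 +
        (im (u i x) - im (u (s (j + N)%N) x)) ^+ 2)); first exact: H.
      by apply/funext => j; rewrite /q /= E.
  apply: le_trans (fatou _ _ _ _) _ => //.
    by move=> j x _; rewrite lee_fin sqmod_ge0.
  apply: limn_einf_le_bound => j; rewrite -nrmE// lee_fin HN//.
  by rewrite /s -addnA (leq_trans _ (leq_addl _ _))// leq_addr.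
have Lv : L2 mu v.
  have [N HN] := cauchy _ ltr01.
  have L : L2 mu (csub (u N) v).
    split; first by apply: cmeas_comb => //; exact: L2_cmeas.
    by apply: le_lt_trans (main _ _ ltr01 HN _ (leqnn N)) _; rewrite ltry.
  have := L2sub (Lu N) L; congr L2; apply/funext => x.
  by rewrite rmorphN rmorph1; ring.
exists v => // e e0; have [N HN] := cauchy _ e0; exists N => i Ni.
rewrite -lee_fin nrmE; last exact: L2sub.
exact: (main _ _ e0 HN _ Ni).
Qed.
End Complete.

(** * Square-summable coefficient sequences *)

Section SquareSummable.
Context (R : realType).
Implicit Types a b : nat -> R[i].

Definition l2seq a := (\sum_(0 <= k <oo) (sqmod (a k))%:E < +oo)%E.
Definition l2term a b := fun k => re (a k * (b k)^*).
(** The real part of the inner product of l^2: a symmetric real form, as the representation theorem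
    requires. *)
Definition l2ip a b : R := limn (series (l2term a b)).
(** Convergence in R[i] as two real series; [cseriesP] identifies it with the topological notion. *)
Definition cseries_to a (l : R[i]) :=
  series (fun k => re (a k)) @ \oo --> re l /\ series (fun k => im (a k)) @ \oo --> im l.

Lemma l2_cvg_sqmod a : l2seq a -> cvgn (series (fun k => sqmod (a k))).
Proof. by move=> la; apply: nnseries_is_cvg => // k; exact: sqmod_ge0. Qed.

Lemma l2ip_cvg a b : l2seq a -> l2seq b -> series (l2term a b) @ \oo --> l2ip a b.
Proof.
move=> la lb; suff : cvgn (series (l2term a b)) by [].
apply: normed_cvg; apply: (@series_le_cvg _ _ (fun k => sqmod (a k) + sqmod (b k))).
- by move=> k /=; rewrite normr_ge0.
- by move=> k; rewrite addr_ge0// sqmod_ge0.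
- by move=> k; exact: re_conj_mul_le.
exact: (is_cvg_seriesD (l2_cvg_sqmod la) (l2_cvg_sqmod lb)).
Qed.

Lemma l2ip_comb a b c s : l2seq a -> l2seq b -> l2seq c ->
  l2ip (fun k => a k + s%:C * b k) c = l2ip a c + s * l2ip b c.
Proof.
move=> la lb lc; apply/cvg_lim => //.
have -> : series (l2term (fun k => a k + s%:C * b k) c) =
    (fun n => series (l2term a c) n + s * series (l2term b c) n).
  apply/funext => n; rewrite /series /= mulr_sumr -big_split /=.
  by apply: eq_bigr => k _; rewrite /l2term !reim; ring.
by apply: cvgD; [exact: l2ip_cvg | apply: cvgM; [exact: cvg_cst | exact: l2ip_cvg]].
Qed.

Lemma l2ipC a b : l2ip a b = l2ip b a.
Proof.
rewrite /l2ip; congr (limn (series _)); apply/funext => k.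
by rewrite /l2term !reim; ring.
Qed.

Lemma l2ip_self a : l2seq a -> (l2ip a a)%:E = (\sum_(0 <= k <oo) (sqmod (a k))%:E)%E.
Proof.
move=> la; rewrite /l2ip.
have -> : l2term a a = fun k => sqmod (a k).
  by apply/funext => k; rewrite /l2term mul_conj.
rewrite -EFin_lim; last exact: l2_cvg_sqmod.
by congr (limn _); apply/funext => n; rewrite /= sumEFin.
Qed.

Lemma l2ip_ge0 a : l2seq a -> 0 <= l2ip a a.
Proof.
move=> la; rewrite -lee_fin l2ip_self//.
by apply: nneseries_ge0 => *; rewrite lee_fin sqmod_ge0.
Qed.

Lemma cseries_unique a l l' : cseries_to a l -> cseries_to a l' -> l = l'.
Proof. by move=> [a1 a2] [b1 b2]; apply: complexP; [exact: (cvg_unique _ a1 b1) | exact: (cvg_unique _ a2 b2)]. Qed.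

Lemma cseries_conj a l : cseries_to a l -> cseries_to (fun k => (a k)^*) l^*.
Proof.
move=> [a1 a2]; rewrite /cseries_to !reim; split.
  by under eq_fun do rewrite re_conj.
have -> : series (fun k => im (a k)^*) = fun n => - series (fun k => im (a k)) n.
  by apply/funext => n; rewrite /series /= -sumrN; apply: eq_bigr => k _; rewrite im_conj.
exact: cvgN.
Qed.

End SquareSummable.

(** * Frames and canonical duals *)

Section Bessel.
Context d (X : measurableType d) (R : realType) (mu : {measure set X -> \bar R}).
Local Notation L2 := (L2 mu).
Local Notation cip := (cip mu).
Local Notation nrm := (nrm mu).
Variables (G : nat -> X -> R[i]) (B : R).
Hypothesis LG : forall k, L2 (G k).
Hypothesis bessel : forall f, L2 f ->
  (\sum_(0 <= k <oo) (sqmod (cip f (G k)))%:E <= (B * nrm f)%:E)%E.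

Definition coef f := fun k => cip f (G k).

Lemma coef_l2 f : L2 f -> l2seq (coef f).
Proof. by move=> lf; apply: le_lt_trans (bessel lf) _; rewrite ltry. Qed.

Lemma coef_comb u v c : L2 u -> L2 v ->
  coef (fun x => u x + c * v x) = fun k => coef u k + c * coef v k.
Proof. by move=> lu lv; apply/funext => k; rewrite /coef cip_comb. Qed.

Lemma l2ip_coef_le f : L2 f -> l2ip (coef f) (coef f) <= B * nrm f.
Proof. by move=> lf; rewrite -lee_fin l2ip_self ?bessel//; exact: coef_l2. Qed.

Let comb (u : X -> R[i]) (s : R) v := fun x => u x + s%:C * v x.
Let Dcomb u s v : L2 u -> L2 v -> L2 (comb u s v). Proof. exact: L2_comb. Qed.

Let re_cip_r u v f s : L2 u -> L2 v -> L2 f ->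
  re (cip f (comb u s v)) = re (cip f u) + s * re (cip f v).
Proof. by move=> lu lv lf; rewrite cip_combr// !reim; ring. Qed.

Let re_cip_le f v : L2 f -> L2 v -> re (cip f v) ^+ 2 <= nrm f * nrm v.
Proof.
by move=> lf lv; apply: le_trans (cip_cauchy_schwarz lf lv); rewrite lerDl sqr_ge0.
Qed.

(* Testing against [v] and [i v] recovers a complex identity from real parts. *)
Let iv (v : X -> R[i]) := fun x => (0 +i* 1) * v x.
Let L2iv v : L2 v -> L2 (iv v). Proof. exact: L2M. Qed.
Let re_cip_iv f v : L2 f -> L2 v -> re (cip f (iv v)) = im (cip f v).
Proof. by move=> lf lv; rewrite cipZr//; case: cip => a b /=; ring. Qed.

(** This turns the output of the representation theorem, an identity between real parts, into a
    weakly convergent complex expansion. *)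
Lemma cseries_of_l2ip (a : nat -> R[i]) f : l2seq a -> L2 f ->
  (forall v, L2 v -> l2ip a (coef v) = re (cip f v)) ->
  forall v, L2 v -> cseries_to (fun k => a k * cip (G k) v) (cip f v).
Proof.
move=> la lf H v lv; split.
  rewrite -H//; have := l2ip_cvg la (coef_l2 lv).
  rewrite (_ : l2term _ _ = fun k => re (a k * cip (G k) v))//.
  by apply/funext => k; rewrite /l2term /coef (cipC lv (LG k)).
rewrite -re_cip_iv// -H; last exact: L2iv.
have := l2ip_cvg la (coef_l2 (L2iv lv)).
rewrite (_ : l2term _ _ = fun k => im (a k * cip (G k) v))//.
apply/funext => k; rewrite /l2term /coef (cipC lv (LG k)) cipZ//.
by case: (a k) (cip v (G k)) => x y [z w] /=; ring.
Qed.

Section LowerBound.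
Variable A : R.
Hypothesis A0 : 0 < A.
Hypothesis B0 : 0 <= B.
Hypothesis lower : forall f, L2 f ->
  ((A * nrm f)%:E <= \sum_(0 <= k <oo) (sqmod (cip f (G k)))%:E)%E.

Lemma l2ip_coef_ge f : L2 f -> A * nrm f <= l2ip (coef f) (coef f).
Proof. by move=> lf; rewrite -lee_fin l2ip_self ?lower//; exact: coef_l2. Qed.

(** The form [l2ip (coef u) (coef v)] is Re <S u, v> for the frame operator S, so representing Re
    <f, v> by it solves S u = f weakly. The frame bounds make the form equivalent to the squared
    norm, from which it inherits completeness. *)
Theorem frame_operator_surjective f : L2 f -> exists2 u, L2 u &
  forall v, L2 v -> cseries_to (fun k => cip u (G k) * cip (G k) v) (cip f v).
Proof.
move=> lf; have [u lu Hu] : exists2 u, L2 u & forall v, L2 v ->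
    l2ip (coef u) (coef v) = re (cip f v).
  (* The constant [nrm f / A] comes from Cauchy-Schwarz followed by the lower frame bound. *)
  apply: (@riesz_representation _ _ comb L2 (fun u v => l2ip (coef u) (coef v))
      (fun v => re (cip f v)) (nrm f / A)).
  - exact: Dcomb.
  - by move=> u v _ _; exact: l2ipC.
  - move=> u s v w lu lv lw; rewrite /comb coef_comb// l2ip_comb//; exact: coef_l2.
  - by move=> u lu; apply/l2ip_ge0/coef_l2.
  - by exists (fun=> 0); exact: L2_0.
  - move=> u lu cu; have [|v lv Hv] := L2_complete lu.
      move=> e e0; have [|N HN] := cu (A * e); first by rewrite mulr_gt0.
      exists N => i j Ni Nj; rewrite -(ler_pM2l A0).
      apply: le_trans (HN _ _ Ni Nj).
      by apply: l2ip_coef_ge; exact: L2_comb.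
    exists v => // e e0; have [|N HN] := Hv (e / (B + 1)).
      by rewrite divr_gt0// ltr_wpDl.
    exists N => i Ni.
    apply: le_trans (l2ip_coef_le (Dcomb (-1) (lu i) lv)) _.
    apply: le_trans (ler_wpM2l B0 (HN _ Ni)) _.
    by rewrite mulrCA ler_piMr ?(ltW e0)// ler_pdivrMr ?mul1r ?lerDl ?ltr_wpDl.
  - by rewrite divr_ge0 ?nrm_ge0// ltW.
  - by move=> u s v lu lv; exact: re_cip_r.
  - move=> v lv; apply: le_trans (re_cip_le lf lv) _; rewrite -mulrA ler_wpM2l ?nrm_ge0//.
    by rewrite mulrC ler_pdivlMr// mulrC l2ip_coef_ge.
exists u => //; exact: (cseries_of_l2ip (coef_l2 lu) lf Hu).
Qed.

Section Dual.
Variable gt : nat -> X -> R[i].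
Hypothesis Lgt : forall k, L2 (gt k).
Hypothesis gtP : forall k v, L2 v ->
  cseries_to (fun j => cip (gt k) (G j) * cip (G j) v) (cip (G k) v).

(** Self-adjointness of S: with f = S u both sides are the sum of one series, read from the
    expansion of [f] against [gt k] and, conjugated, from that of [G k] against [u]. *)
Let dual_coef f u : L2 f -> L2 u ->
  (forall v, L2 v -> cseries_to (fun k => cip u (G k) * cip (G k) v) (cip f v)) ->
  forall k, cip f (gt k) = cip u (G k).
Proof.
move=> lf lu Su k; apply: cseries_unique (Su _ (Lgt k)) _.
rewrite (cipC (LG k) lu); have := cseries_conj (gtP k lu).
congr (cseries_to _ _); apply/funext => j.
rewrite (cipC lu (LG j)) (cipC (Lgt k) (LG j)).
by case: (cip u _) (cip (gt k) _) => x y [z w]; apply: complexP => /=; ring.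
Qed.

Let energy u f : L2 u -> L2 f ->
  (forall v, L2 v -> cseries_to (fun k => cip u (G k) * cip (G k) v) (cip f v)) ->
  l2ip (coef u) (coef u) = re (cip f u).
Proof.
move=> lu lf Su; have [+ _] := Su _ lu; apply: cvg_unique => //.
have := l2ip_cvg (coef_l2 lu) (coef_l2 lu).
rewrite (_ : l2term _ _ = fun k => re (cip u (G k) * cip (G k) u))//.
by apply/funext => k; rewrite /l2term /coef (cipC lu (LG k)).
Qed.

(** Put q = <S u, u>. Then A |u|^2 <= q and q^2 <= |f|^2 |u|^2, so q <= |f|^2 / A, and dividing by A
    once more bounds |u|^2. *)
Let energy_le u f : L2 u -> L2 f ->
  (forall v, L2 v -> cseries_to (fun k => cip u (G k) * cip (G k) v) (cip f v)) ->
  l2ip (coef u) (coef u) <= nrm f / A /\ nrm u <= nrm f / A ^+ 2.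
Proof.
move=> lu lf Su; have E := energy lu lf Su.
have := re_cip_le lf lu; rewrite -E.
have := l2ip_coef_ge lu; have := nrm_ge0 lu; have := nrm_ge0 lf.
move: (l2ip _ _) (nrm u) (nrm f) => q x y y0 x0 Axq q2.
have q0 : 0 <= q by apply: le_trans Axq; rewrite mulr_ge0// ltW.
have qA : q <= y / A.
  have [->|qN] := eqVneq q 0; first by rewrite divr_ge0// ltW.
  have qp : 0 < q by rewrite lt_def qN.
  rewrite ler_pdivlMr// -(ler_pM2l qp) mulrA -expr2 (le_trans (ler_wpM2r (ltW A0) q2))//.
  by rewrite -mulrA mulrC ler_wpM2r// mulrC.
split => //; rewrite expr2 invfM mulrA ler_pdivlMr// mulrC.
exact: le_trans qA.
Qed.

(** With f = S u the coefficient against [gt k] is that of [u] against [G k], and the series is the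
    expansion of <S u, f>. *)
Lemma dual_reconstruction f : L2 f ->
  series (fun k => re (cip f (gt k) * cip (G k) f)) @ \oo --> nrm f.
Proof.
move=> lf; have [u lu Su] := frame_operator_surjective lf.
by under eq_fun do rewrite (dual_coef lf lu Su); have [] := Su _ lf.
Qed.

Lemma dual_bessel f : L2 f ->
  (\sum_(0 <= k <oo) (sqmod (cip f (gt k)))%:E <= (nrm f / A)%:E)%E.
Proof.
move=> lf; have [u lu Su] := frame_operator_surjective lf.
under eq_eseriesr do rewrite (dual_coef lf lu Su).
by rewrite -l2ip_self ?lee_fin ?(energy_le lu lf Su).1//; exact: coef_l2.
Qed.

(** All elements of a Gabor system have the same norm, so this will bound the dual elements
    uniformly in [k]. *)
Lemma dual_nrm_le k : nrm (gt k) <= nrm (G k) / A ^+ 2.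
Proof. by have [] := energy_le (Lgt k) (LG k) (gtP k). Qed.

Lemma dual_pairing_le k : re (cip (G k) (gt k)) <= nrm (G k) / A.
Proof.
by have [h _] := energy_le (Lgt k) (LG k) (gtP k); rewrite -(energy (Lgt k) (LG k) (gtP k)).
Qed.

(** Testing the dual equation on [gt k] itself gives a series of squared moduli. *)
Lemma dual_pairing_real k : im (cip (G k) (gt k)) = 0.
Proof.
have [_] := gtP k (Lgt k); move/cvg_lim => <- //.
rewrite (_ : series _ = fun=> 0) ?lim_cst//.
apply/funext => n; apply: big1 => j _.
by rewrite (cipC (Lgt k) (LG j)) mul_conj.
Qed.

End Dual.
End LowerBound.
End Bessel.

(** * Parseval's identity for an orthonormal system *)

Section Parseval.
Context d (X : measurableType d) (R : realType) (mu : {measure set X -> \bar R}).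
Local Notation L2 := (L2 mu).
Local Notation cip := (cip mu).
Local Notation nrm := (nrm mu).
Variables (G : nat -> X -> R[i]).
Hypothesis LG : forall k, L2 (G k).
Hypothesis ortho : forall i j, cip (G i) (G j) = (i == j)%:R.

Lemma orthonormal_bessel f : L2 f ->
  (\sum_(0 <= k <oo) (sqmod (cip f (G k)))%:E <= (1 * nrm f)%:E)%E.
Proof.
move=> lf; apply: lime_le.
  by apply: is_cvg_nneseries => *; rewrite lee_fin sqmod_ge0.
apply: nearW => n; rewrite sumEFin lee_fin mul1r.
pose r n := fun x => f x - \sum_(0 <= k < n) cip f (G k) * G k x.
(* The middle clause serves the induction only: the coefficients of index at least [n] are those of
   [f], and the next subtraction uses one of them. *)
suff [lr _ rE] : [/\ L2 (r n), (forall k, (n <= k)%N -> cip (r n) (G k) = cip f (G k))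
    & nrm (r n) = nrm f - \sum_(0 <= k < n) sqmod (cip f (G k))].
  by rewrite -subr_ge0 -rE nrm_ge0.
elim: n => [|n [lr Hr IH]].
  have -> : r 0%N = f by apply/funext => x; rewrite /r big_nil subr0.
  by rewrite big_nil subr0.
have rS : r n.+1 = fun x => r n x + (- cip f (G n)) * G n x.
  by apply/funext => x; rewrite /r big_nat_recr//=; ring.
have lS : L2 (r n.+1) by rewrite rS; exact: L2_comb.
split=> //.
  move=> k nk; rewrite rS cip_comb// ortho Hr 1?ltnW// (ltn_eqF nk) mulr0 addr0//.
rewrite big_nat_recr//= opprD addrA -IH.
rewrite rS nrm_comb// Hr// -[nrm (G n)]re_real -cip_self// ortho eqxx.
by case: (cip f (G n)) => a b; rewrite /sqmod /=; ring.
Qed.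

(** Totality is relative to [f], which suits a window: vectors orthogonal to the system vanish only
    inside it. The representation theorem supplies the sum s of the expansion; s - f is orthogonal
    to the system, hence to [f], so <s, f> = <f, f>. *)
Theorem parseval f : L2 f ->
  (forall v, L2 v -> (forall k, cip v (G k) = 0) -> cip f v = 0) ->
  (\sum_(0 <= k <oo) (sqmod (cip f (G k)))%:E = (nrm f)%:E)%E.
Proof.
move=> lf total; have B := orthonormal_bessel.
pose cf := coef mu G; have lcf u : L2 u -> l2seq (cf u) by move=> lu; exact: (coef_l2 B lu).
pose comb (u : X -> R[i]) (s : R) v := fun x => u x + s%:C * v x.
have Dc u s v : L2 u -> L2 v -> L2 (comb u s v) by exact: L2_comb.
have q_comb u s v w : L2 u -> L2 v -> L2 w ->
    l2ip (cf (comb u s v)) (cf w) = l2ip (cf u) (cf w) + s * l2ip (cf v) (cf w).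
  by move=> lu lv lw; rewrite /comb /cf coef_comb// l2ip_comb//; exact: lcf.
have q_le u : L2 u -> l2ip (cf u) (cf u) <= nrm u.
  by move=> lu; have := l2ip_coef_le B lu; rewrite mul1r.
have l_lin u t v : L2 u -> L2 v ->
    l2ip (cf f) (cf (comb u t v)) = l2ip (cf f) (cf u) + t * l2ip (cf f) (cf v).
  by move=> lu lv; rewrite !(l2ipC (cf f)) q_comb.
have [s ls Hs] : exists2 s, L2 s & forall v, L2 v ->
    re (cip s v) = l2ip (cf f) (cf v).
  apply: (@riesz_representation _ _ comb L2 (fun u v => re (cip u v))
    (fun v => l2ip (cf f) (cf v)) (nrm f)).
  - exact: Dc.
  - by move=> u v lu lv; rewrite (cipC lv lu) re_conj.
  - by move=> u t v w lu lv lw; rewrite cip_comb// !reim mul0r subr0.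
  - by move=> u lu; exact: nrm_ge0.
  - by exists (fun=> 0); exact: L2_0.
  - by move=> u lu cu; exact: (L2_complete lu cu).
  - exact: nrm_ge0.
  - exact: l_lin.
  - move=> v lv; apply: le_trans (form_cauchy_schwarz Dc _ q_comb _ lf lv) _.
    + by move=> u w _ _; exact: l2ipC.
    + by move=> u lu; apply/l2ip_ge0/lcf.
    + by apply: ler_pM; rewrite ?q_le ?l2ip_ge0//; exact: lcf.
have Hss v : L2 v -> cseries_to (fun k => cf f k * cip (G k) v) (cip s v).
  by apply: (cseries_of_l2ip LG B (lcf _ lf) ls) => w lw; rewrite Hs.
have cs k : cip s (G k) = cip f (G k).
  apply: cseries_unique (Hss _ (LG k)) _.
  have E (p : R[i] -> R) : p 0 = 0 ->
      series (fun j => p (cf f j * cip (G j) (G k))) @ \oo --> p (cip f (G k)).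
    move=> p0; apply: cvg_near_cst; exists k.+1 => // n /= kn.
    rewrite /series /= (bigD1_seq k) ?iota_uniq ?mem_index_iota//=.
    rewrite ortho eqxx mulr1 big1 ?addr0// => j jk.
    by rewrite ortho (negbTE jk) mulr0.
  by split; exact: E.
pose r x := s x + (- 1) * f x.
have lr : L2 r by exact: L2_comb.
have rf : cip r f = 0.
  rewrite (cipC lf lr) total ?conjc0// => k.
  by rewrite cip_comb// cs mulN1r subrr.
rewrite -l2ip_self; last exact: lcf.
rewrite -Hs//; congr EFin.
have := cip_comb (-1) ls lf lf; rewrite -/r rf mulN1r => /eqP.
by rewrite eq_sym subr_eq0 => /eqP ->.
Qed.
End Parseval.

(* The library's canonical sigma-finite structure on [m1 \x m2] only fires for
   subprobabilities; the alias makes the general one usable. *)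
Definition sfprod d1 d2 (T1 : measurableType d1) (T2 : measurableType d2) (R : realType)
  (m1 : {sigma_finite_measure set T1 -> \bar R})
  (m2 : {sigma_finite_measure set T2 -> \bar R}) : set (T1 * T2) -> \bar R := (m1 \x m2)%E.

Section ProductSigmaFinite.
Context d1 d2 (T1 : measurableType d1) (T2 : measurableType d2) (R : realType)
  (m1 : {sigma_finite_measure set T1 -> \bar R})
  (m2 : {sigma_finite_measure set T2 -> \bar R}).

HB.instance Definition _ := Measure.copy (sfprod m1 m2) (m1 \x m2)%E.

Let sfprod_sigma_finite : sigma_finite [set: T1 * T2] (sfprod m1 m2).
Proof.
have /sigma_finiteP[F [FT ndF Foo]] := sigma_finiteT m1.
have /sigma_finiteP[G [GT ndG Goo]] := sigma_finiteT m2.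
exists (fun n => F n `*` G n).
  apply/esym; rewrite -subTset => -[x y] _.
  have [i _ Fi] : (\bigcup_i F i) x by rewrite -FT.
  have [j _ Gj] : (\bigcup_j G j) y by rewrite -GT.
  exists (maxn i j) => //; split => /=.
    by move: x Fi {Gj}; apply/subsetPset/ndF; rewrite leq_maxl.
  by move: y Gj; apply/subsetPset/ndG; rewrite leq_maxr.
move=> n; have [mF Fn] := Foo n; have [mG Gn] := Goo n.
split; first exact: measurableX.
by rewrite /sfprod product_measure1E// lte_mul_pinfty ?ge0_fin_numE.
Qed.

HB.instance Definition _ :=
  Measure_isSigmaFinite.Build _ _ _ (sfprod m1 m2) sfprod_sigma_finite.

End ProductSigmaFinite.

(** * Product measures and resolutions of the identity *)

Section Slices.
Context d1 d2 (T1 : measurableType d1) (T2 : measurableType d2) (R : realType)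
  (m1 : {sigma_finite_measure set T1 -> \bar R})
  (m2 : {sigma_finite_measure set T2 -> \bar R}).

(** The real integral of a slice is [fine] of a difference of two Tonelli integrals even where the
    slice is not integrable, so measurability holds on the whole space. *)
Lemma measurable_Rintegral_param (h : T1 * T2 -> R) : measurable_fun setT h ->
  measurable_fun setT (fun x => \int[m2]_y h (x, y)).
Proof.
move=> mh; apply: (@measurableT_comp _ _ _ _ _ _ fine) => //.
have mh' : measurable_fun setT (EFin \o h) by exact/measurable_EFinP.
have H1 : measurable_fun setT (fubini_F m2 (EFin \o h)^\+%E).
  by apply: measurable_fun_fubini_tonelli_F => //; exact: measurable_funepos.
have H2 : measurable_fun setT (fubini_F m2 (EFin \o h)^\-%E).
  by apply: measurable_fun_fubini_tonelli_F => //; exact: measurable_funeneg.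
have E x : (\int[m2]_y (h (x, y))%:E =
    fubini_F m2 (EFin \o h)^\+ x - fubini_F m2 (EFin \o h)^\- x)%E.
  by rewrite [LHS]integralE /fubini_F; congr (_ - _)%E;
    apply: eq_integral => y _; rewrite ?funeposE ?funenegE.
by under eq_fun do rewrite E; exact: (emeasurable_funB H1 H2).
Qed.

Lemma measurable_slice1 d (Y : measurableType d) (h : T1 * T2 -> Y) x :
  measurable_fun setT h -> measurable_fun setT (fun y => h (x, y)).
Proof. by move=> mh; apply: measurableT_comp mh _; exact: measurable_pair1. Qed.

Lemma measurable_slice2 d (Y : measurableType d) (h : T1 * T2 -> Y) y :
  measurable_fun setT h -> measurable_fun setT (fun x => h (x, y)).
Proof. by move=> mh; apply: measurableT_comp mh _; exact: measurable_pair2. Qed.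

(** Slices are integrable only almost everywhere; elsewhere [fine] gives a default value, and the
    two inner integrals are compared outside a null set. *)
Lemma Rintegral12 (h : T1 * T2 -> R) : (m1 \x m2)%E.-integrable setT (EFin \o h) ->
  \int[(m1 \x m2)%E]_z h z = \int[m1]_x \int[m2]_y h (x, y).
Proof.
move=> ih; rewrite /Rintegral -(integral12_prod_meas1 ih) /fubini_F /=.
congr fine; apply: ae_eq_integral => //.
- exact: measurable_fubini_F ih.
- apply/measurable_EFinP/measurable_Rintegral_param.
  by apply/measurable_EFinP; case/integrableP : ih.
have := ae_integrable1 ih; apply: filterS => x ix _ /=.
by rewrite fineK//; exact: integrable_fin_num.
Qed.

End Slices.

Section Swap.
Context d1 d2 (T1 : measurableType d1) (T2 : measurableType d2) (R : realType)
  (m1 : {sigma_finite_measure set T1 -> \bar R})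
  (m2 : {sigma_finite_measure set T2 -> \bar R}).

Lemma measurable_Rintegral_param2 (h : T1 * T2 -> R) : measurable_fun setT h ->
  measurable_fun setT (fun y => \int[m1]_x h (x, y)).
Proof.
move=> mh; apply: (@measurable_Rintegral_param _ _ _ _ _ m1 (fun p => h (p.2, p.1))).
by apply: measurableT_comp mh _; exact: measurable_swap.
Qed.

Lemma Rintegral21 (h : T1 * T2 -> R) : (m1 \x m2)%E.-integrable setT (EFin \o h) ->
  \int[(m1 \x m2)%E]_z h z = \int[m2]_y \int[m1]_x h (x, y).
Proof.
move=> ih; rewrite /Rintegral -(integral21_prod_meas1 ih) /fubini_G /=.
congr fine; apply: ae_eq_integral => //.
- exact: measurable_fubini_G ih.
- apply/measurable_EFinP/measurable_Rintegral_param2.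
  by apply/measurable_EFinP; case/integrableP : ih.
have := ae_integrable2 ih; apply: filterS => x ix _ /=.
by rewrite fineK//; exact: integrable_fin_num.
Qed.

Lemma cmeas_slice1 (f : T1 * T2 -> R[i]) x : cmeas f -> cmeas (fun y => f (x, y)).
Proof.
by move=> [f1 f2]; split; [exact: (measurable_slice1 x f1)|exact: (measurable_slice1 x f2)].
Qed.

Lemma cmeas_slice2 (f : T1 * T2 -> R[i]) y : cmeas f -> cmeas (fun x => f (x, y)).
Proof.
by move=> [f1 f2]; split; [exact: (measurable_slice2 y f1)|exact: (measurable_slice2 y f2)].
Qed.

Lemma cmeas_cI_param (f : T1 * T2 -> R[i]) : cmeas f ->
  cmeas (fun x => cI m2 (fun y => f (x, y))).
Proof.
move=> [f1 f2]; split; [exact: (measurable_Rintegral_param _ f1)|].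
exact: (measurable_Rintegral_param _ f2).
Qed.

Lemma cI21 (f : T1 * T2 -> R[i]) : cintegrable (m1 \x m2)%E f ->
  cI (m1 \x m2)%E f = cI m2 (fun y => cI m1 (fun x => f (x, y))).
Proof. by move=> [f1 f2]; apply: complexP => /=; exact: Rintegral21. Qed.

Lemma ae_eq_cI d (X : measurableType d) (mu : {measure set X -> \bar R}) (f h : X -> R[i]) :
  cmeas f -> cmeas h -> {ae mu, forall x, f x = h x} -> cI mu f = cI mu h.
Proof.
move=> [f1 f2] [h1 h2] fh; apply: complexP => /=; congr fine;
  apply: ae_eq_integral => //; try exact/measurable_EFinP;
  by apply: filterS fh => x -> _.
Qed.

Lemma L2_slice2 (f : T1 * T2 -> R[i]) : L2 (m1 \x m2)%E f ->
  {ae m2, forall y, L2 m1 (fun x => f (x, y))}.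
Proof.
move=> [mf lf].
have i : (m1 \x m2)%E.-integrable setT (fun z => (sqmod (f z))%:E).
  apply/integrableP; split; first exact: cmeas_esqmod.
  by under eq_integral do rewrite gee0_abs ?lee_fin ?sqmod_ge0//.
have := ae_integrable2 i; apply: filterS => y iy; split; first exact: cmeas_slice2.
case/integrableP : iy => _; apply: le_lt_trans.
rewrite le_eqVlt; apply/orP; left; apply/eqP; apply: eq_integral => x _.
by rewrite gee0_abs ?lee_fin ?sqmod_ge0.
Qed.

End Swap.

Section Resolution.
Context (R : realType).

(** A continuous Parseval frame: f is sent isometrically to the function <f, K_z> of z. Joint
    measurability is included because tensor products integrate in both variables. *)
Definition resolution dZ dX (Z : measurableType dZ) (X : measurableType dX)
    (nu : {measure set Z -> \bar R}) (mu : {measure set X -> \bar R})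
    (K : Z -> X -> R[i]) :=
  [/\ cmeas (fun p : Z * X => K p.1 p.2), (forall z, L2 mu (K z)) &
   forall f, L2 mu f -> (\int[nu]_z (sqmod (cip mu f (K z)))%:E =
                         \int[mu]_x (sqmod (f x))%:E)%E].

Section Tensor.
Context dX1 dX2 (X1 : measurableType dX1) (X2 : measurableType dX2)
  (mu1 : {sigma_finite_measure set X1 -> \bar R})
  (mu2 : {sigma_finite_measure set X2 -> \bar R}).

Lemma cmeas_comp dY dY' (Y : measurableType dY) (Y' : measurableType dY')
  (f : Y -> R[i]) (p : Y' -> Y) : cmeas f -> measurable_fun setT p -> cmeas (fun y => f (p y)).
Proof. by move=> [f1 f2] mp; split; [exact: (measurableT_comp f1 mp)|exact: (measurableT_comp f2 mp)]. Qed.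

Lemma int_sqmod_tensor (k1 : X1 -> R[i]) (k2 : X2 -> R[i]) : cmeas k1 -> cmeas k2 ->
  (\int[(mu1 \x mu2)%E]_x (sqmod (k1 x.1 * k2 x.2))%:E =
   \int[mu1]_x (sqmod (k1 x))%:E * \int[mu2]_x (sqmod (k2 x))%:E)%E.
Proof.
move=> m1 m2; rewrite fubini_tonelli1 /fubini_F/=; last 2 first.
- apply/cmeas_esqmod/cmeasM.
    by apply: (cmeas_comp m1); exact: measurable_fst.
  by apply: (cmeas_comp m2); exact: measurable_snd.
- by move=> x; rewrite lee_fin sqmod_ge0.
have i2 : (0 <= \int[mu2]_x (sqmod (k2 x))%:E)%E.
  by apply: integral_ge0 => x _; rewrite lee_fin sqmod_ge0.
rewrite -ge0_integralZr//; last 2 first.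
- exact: cmeas_esqmod.
- by move=> x _; rewrite lee_fin sqmod_ge0.
by apply: eq_integral => x _; rewrite int_sqmodM.
Qed.

Lemma L2_tensor (k1 : X1 -> R[i]) (k2 : X2 -> R[i]) : L2 mu1 k1 -> L2 mu2 k2 ->
  L2 (mu1 \x mu2)%E (fun x => k1 x.1 * k2 x.2).
Proof.
move=> [m1 l1] [m2 l2]; split.
  apply: cmeasM.
    by apply: (cmeas_comp m1); exact: measurable_fst.
  by apply: (cmeas_comp m2); exact: measurable_snd.
have p1 : (0 <= \int[mu1]_x (sqmod (k1 x))%:E)%E.
  by apply: integral_ge0 => x _; rewrite lee_fin sqmod_ge0.
have p2 : (0 <= \int[mu2]_x (sqmod (k2 x))%:E)%E.
  by apply: integral_ge0 => x _; rewrite lee_fin sqmod_ge0.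
by rewrite int_sqmod_tensor// lte_mul_pinfty// ge0_fin_numE.
Qed.

Context dZ1 dZ2 (Z1 : measurableType dZ1) (Z2 : measurableType dZ2)
  (nu1 : {sigma_finite_measure set Z1 -> \bar R})
  (nu2 : {sigma_finite_measure set Z2 -> \bar R})
  (K1 : Z1 -> X1 -> R[i]) (K2 : Z2 -> X2 -> R[i]).

(** The first resolution is applied to almost every slice of [f], the second to the partial
    transforms [fz] so obtained; Fubini identifies the iterated transform with the full one. *)
Theorem resolution_tensor : resolution nu1 mu1 K1 -> resolution nu2 mu2 K2 ->
  resolution (nu1 \x nu2)%E (mu1 \x mu2)%E (fun z x => K1 z.1 x.1 * K2 z.2 x.2).
Proof.
move=> [mK1 LK1 rK1] [mK2 LK2 rK2].
have mK : cmeas (fun p : (Z1 * Z2) * (X1 * X2) => K1 p.1.1 p.2.1 * K2 p.1.2 p.2.2).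
  apply: cmeasM.
    apply: (cmeas_comp (p := fun p : (Z1 * Z2) * (X1 * X2) => (p.1.1, p.2.1)) mK1).
    apply: measurable_fun_pair.
      exact: (measurableT_comp measurable_fst measurable_fst).
    exact: (measurableT_comp measurable_fst measurable_snd).
  apply: (cmeas_comp (p := fun p : (Z1 * Z2) * (X1 * X2) => (p.1.2, p.2.2)) mK2).
  apply: measurable_fun_pair.
    exact: (measurableT_comp measurable_snd measurable_fst).
  exact: (measurableT_comp measurable_snd measurable_snd).
split=> // [z|f lf]; first exact: L2_tensor.
have mf := L2_cmeas lf.
have mipK : cmeas (fun z : Z1 * Z2 =>
    cip (mu1 \x mu2)%E f (fun x => K1 z.1 x.1 * K2 z.2 x.2)).
  apply: (@cmeas_cI_param _ _ _ _ R (sfprod mu1 mu2)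
    (fun p : (Z1 * Z2) * (X1 * X2) => f p.2 * (K1 p.1.1 p.2.1 * K2 p.1.2 p.2.2)^*)).
  by apply: cmeasM; [apply: (cmeas_comp mf); exact: measurable_snd|exact: cmeas_conj].
pose fz z1 x2 := cip mu1 (fun x1 => f (x1, x2)) (K1 z1).
have mfz : cmeas (fun p : Z1 * X2 => fz p.1 p.2).
  apply: (cmeas_cI_param mu1 (f := fun p : (Z1 * X2) * X1 =>
    f (p.2, p.1.2) * (K1 p.1.1 p.2)^*)).
  apply: cmeasM.
    apply: (cmeas_comp (p := fun p : (Z1 * X2) * X1 => (p.2, p.1.2)) mf).
    apply: measurable_fun_pair; first exact: measurable_snd.
    exact: (measurableT_comp measurable_snd measurable_fst).
  apply: cmeas_conj.
  apply: (cmeas_comp (p := fun p : (Z1 * X2) * X1 => (p.1.1, p.2)) mK1).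
  apply: measurable_fun_pair; last exact: measurable_snd.
  exact: (measurableT_comp measurable_fst measurable_fst).
have total : (\int[nu1]_z1 \int[mu2]_x2 (sqmod (fz z1 x2))%:E =
              \int[(mu1 \x mu2)%E]_x (sqmod (f x))%:E)%E.
  rewrite (fubini_tonelli (fun p : Z1 * X2 => (sqmod (fz p.1 p.2))%:E)); last 2 first.
  - exact: cmeas_esqmod.
  - by move=> p; rewrite lee_fin sqmod_ge0.
  rewrite fubini_tonelli2 ?/fubini_G; last 2 first.
  - exact: cmeas_esqmod.
  - by move=> p; rewrite lee_fin sqmod_ge0.
  apply: ge0_ae_eq_integral => //=.
  - apply: (measurable_fun_fubini_tonelli_G (fun p : Z1 * X2 => (sqmod (fz p.1 p.2))%:E)).
      exact: cmeas_esqmod.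
    by move=> p; rewrite lee_fin sqmod_ge0.
  - apply: (measurable_fun_fubini_tonelli_G (fun p : X1 * X2 => (sqmod (f p))%:E)).
      exact: cmeas_esqmod.
    by move=> p; rewrite lee_fin sqmod_ge0.
  - by move=> x _; apply: integral_ge0 => z _; rewrite lee_fin sqmod_ge0.
  - by move=> x _; apply: integral_ge0 => z _; rewrite lee_fin sqmod_ge0.
  by apply: filterS (L2_slice2 lf) => x2 /rK1 E _; exact: E.
(* Finiteness of the double integral in [total] makes almost every partial transform
   square-integrable, as the second resolution demands. *)
have aez : {ae nu1, forall z1, L2 mu2 (fz z1)}.
  have mI : measurable_fun setT (fun z1 => \int[mu2]_x2 (sqmod (fz z1 x2))%:E)%E.
    apply: (measurable_fun_fubini_tonelli_F (fun p : Z1 * X2 => (sqmod (fz p.1 p.2))%:E)).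
      exact: cmeas_esqmod.
    by move=> p; rewrite lee_fin sqmod_ge0.
  have I0 z1 : (0 <= \int[mu2]_x2 (sqmod (fz z1 x2))%:E)%E.
    by apply: integral_ge0 => z _; rewrite lee_fin sqmod_ge0.
  have : nu1.-integrable setT (fun z1 => \int[mu2]_x2 (sqmod (fz z1 x2))%:E)%E.
    apply/integrableP; split => //.
    under eq_integral do rewrite gee0_abs//.
    by rewrite total; exact: lf.2.
  move=> /(integrable_ae measurableT); apply: filterS => z1 /(_ I) Iz.
  by split; [exact: (cmeas_slice1 z1 mfz)|rewrite -ge0_fin_numE].
have ipE z : cip (mu1 \x mu2)%E f (fun x => K1 z.1 x.1 * K2 z.2 x.2) =
    cip mu2 (fz z.1) (K2 z.2).
  have lK : L2 (mu1 \x mu2)%E (fun x => K1 z.1 x.1 * K2 z.2 x.2) by exact: L2_tensor.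
  rewrite /cip cI21; last exact: L2_cintegrable.
  apply: ae_eq_cI.
  - apply: (cmeas_cI_param mu1 (f := fun p : X2 * X1 =>
      f (p.2, p.1) * (K1 z.1 p.2 * K2 z.2 p.1)^*)).
    apply: (cmeas_comp (p := fun p : X2 * X1 => (p.2, p.1))
      (f := fun p => f p * (K1 z.1 p.1 * K2 z.2 p.2)^*)); last exact: measurable_swap.
    by apply: cmeasM => //; exact: (cmeas_conj (L2_cmeas lK)).
  - by apply: cmeasM; [exact: (cmeas_slice1 z.1 mfz)|exact: (cmeas_conj (L2_cmeas (LK2 z.2)))].
  apply: filterS (L2_slice2 lf) => x2 Lx2.
  rewrite [RHS]mulrC -(cipZ _ Lx2 (LK1 z.1)).
  by apply: eq_cI => x1 /=; rewrite rmorphM /=; ring.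
rewrite -total fubini_tonelli1 /fubini_F; last 2 first.
- exact: cmeas_esqmod.
- by move=> p; rewrite lee_fin sqmod_ge0.
apply: ge0_ae_eq_integral => //.
- apply: (measurable_fun_fubini_tonelli_F (fun z : Z1 * Z2 =>
    (sqmod (cip (mu1 \x mu2)%E f (fun x => K1 z.1 x.1 * K2 z.2 x.2)))%:E)).
    exact: cmeas_esqmod.
  by move=> p; rewrite lee_fin sqmod_ge0.
- apply: (measurable_fun_fubini_tonelli_F (fun p : Z1 * X2 => (sqmod (fz p.1 p.2))%:E)).
    exact: cmeas_esqmod.
  by move=> p; rewrite lee_fin sqmod_ge0.
- by move=> x _; apply: integral_ge0 => z _; rewrite lee_fin sqmod_ge0.
- by move=> x _; apply: integral_ge0 => z _; rewrite lee_fin sqmod_ge0.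
apply: filterS aez => z1 Lz1 _; rewrite -rK2//.
by apply: eq_integral => z2 _; rewrite ipE.
Qed.

End Tensor.
End Resolution.

Lemma re_realM (R : realType) (a : R) (z : R[i]) : re (a%:C * z) = a * re z.
Proof. by rewrite !reim mul0r subr0. Qed.

Lemma im_realM (R : realType) (a : R) (z : R[i]) : im (a%:C * z) = a * im z.
Proof. by rewrite !reim mul0r addr0. Qed.

(** Lebesgue measure in the sigma-finite type over which the product measures are formed. *)
Definition lebm (R : realType) : {sigma_finite_measure set (measurableTypeR R) -> \bar R} :=
  @lebesgue_measure R.

Section Expi.
Context (R : realType).
Implicit Types a b : R.

Lemma expiD a b : expi (a + b) = expi a * expi b.
Proof. by apply: complexP; rewrite /expi /= ?cosD ?sinD //; ring. Qed.

Lemma expi0 : expi (0 : R) = 1.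
Proof. by apply: complexP; rewrite /expi /= ?cos0 ?sin0. Qed.

Lemma expiN a : expi (- a) = (expi a)^*.
Proof. by apply: complexP; rewrite /expi /= ?cosN ?sinN. Qed.

Lemma sqmod_expi a : sqmod (expi a) = 1.
Proof. by rewrite /sqmod /= cos2Dsin2. Qed.

Lemma measurable_cos : measurable_fun setT (@cos R).
Proof. by apply: continuous_measurable_fun; exact: continuous_cos. Qed.

Lemma measurable_sin : measurable_fun setT (@sin R).
Proof. by apply: continuous_measurable_fun; exact: continuous_sin. Qed.

Lemma cmeas_expi d (X : measurableType d) (p : X -> R) : measurable_fun setT p ->
  cmeas (fun x => expi (p x)).
Proof.
by move=> mp; split; [exact: (measurableT_comp measurable_cos mp)
  | exact: (measurableT_comp measurable_sin mp)].
Qed.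

End Expi.

Section Bounded.
Context d (X : measurableType d) (R : realType) (mu : {measure set X -> \bar R}).
Implicit Types (f h e : X -> R[i]) (phi : X -> R).

Lemma bounded_mul_integrable phi (g : X -> R) C : measurable_fun setT phi ->
  (forall x, `|phi x| <= C) -> mu.-integrable setT (EFin \o g) ->
  mu.-integrable setT (EFin \o (fun x => phi x * g x)).
Proof.
move=> mphi phiC ig; have C0 (x : X) : 0 <= C by exact: le_trans (normr_ge0 _) (phiC x).
have mg : measurable_fun setT g by apply/measurable_EFinP; case/integrableP : ig.
apply: (le_integrable measurableT _ _ (integrableZl measurableT C ig)).
  by apply/measurable_EFinP; exact: measurable_funM.
move=> x _; rewrite /= lee_fin !normrM; apply: ler_pM => //.
by rewrite (le_trans (phiC x))// ler_norm.
Qed.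

Lemma cintegrableD f h : cintegrable mu f -> cintegrable mu h ->
  cintegrable mu (fun x => f x + h x).
Proof.
move=> [f1 f2] [h1 h2]; split.
  have := integrableD measurableT f1 h1; apply: eq_integrable => // x _ /=.
  by rewrite re_add EFinD.
have := integrableD measurableT f2 h2; apply: eq_integrable => // x _ /=.
by rewrite im_add EFinD.
Qed.

Lemma cintegrable_bounded_mul f e C : cintegrable mu f -> cmeas e ->
  (forall x, `|re (e x)| <= C) -> (forall x, `|im (e x)| <= C) ->
  cintegrable mu (fun x => e x * f x).
Proof.
move=> [f1 f2] [m1 m2] r1 i1; split.
  have := integrableB measurableT (bounded_mul_integrable m1 r1 f1)
    (bounded_mul_integrable m2 i1 f2).
  by apply: eq_integrable => // x _ /=; rewrite re_mul EFinB.
have := integrableD measurableT (bounded_mul_integrable m1 r1 f2)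
  (bounded_mul_integrable m2 i1 f1).
by apply: eq_integrable => // x _ /=; rewrite im_mul EFinD.
Qed.

Lemma cintegrable0 : cintegrable mu (fun=> 0).
Proof. by split; exact: integrable0. Qed.

Lemma cI0 : cI mu (fun=> 0) = 0.
Proof. by apply: complexP; rewrite /= Rintegral_cst// mul0r. Qed.

Lemma cIZ f c : cintegrable mu f -> cI mu (fun x => c * f x) = c * cI mu f.
Proof.
move=> lf; have := cI_comb c cintegrable0 lf; rewrite cI0 add0r => <-.
by apply: eq_cI => x; rewrite add0r.
Qed.

Lemma cID f h : cintegrable mu f -> cintegrable mu h ->
  cI mu (fun x => f x + h x) = cI mu f + cI mu h.
Proof.
move=> lf lh; rewrite -[in RHS](mul1r (cI mu h)) -cI_comb//.
by apply: eq_cI => x; rewrite mul1r.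
Qed.

(** Dominated convergence with a multiple of the parts of [f] as majorant; it will make the
    multipliers closed under bounded pointwise limits. *)
Lemma cI_bounded_cvg f (phi : nat -> X -> R) (psi : X -> R) C : cintegrable mu f ->
  (forall n, measurable_fun setT (phi n)) -> measurable_fun setT psi ->
  (forall n x, `|phi n x| <= C) -> (forall x, (phi ^~ x) @ \oo --> psi x) ->
  (forall n, cI mu (fun x => (phi n x)%:C * f x) = 0) ->
  cI mu (fun x => (psi x)%:C * f x) = 0.
Proof.
move=> [f1 f2] mphi mpsi phiC phipsi cI0.
have key (g : X -> R) : mu.-integrable setT (EFin \o g) ->
    (forall n, \int[mu]_x (phi n x * g x) = 0) -> \int[mu]_x (psi x * g x) = 0.
  move=> ig H.
  have mg : measurable_fun setT g by apply/measurable_EFinP; case/integrableP : ig.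
  have [] := @dominated_convergence _ _ _ mu setT measurableT
    (fun n x => (phi n x * g x)%:E) (fun x => (psi x * g x)%:E) (fun x => (C * `|g x|)%:E).
  - by move=> n; apply/measurable_EFinP; exact: measurable_funM.
  - by apply/measurable_EFinP; exact: measurable_funM.
  - apply: aeW => x _; apply: cvg_EFin; first exact: nearW.
    by apply: cvgM; [exact: phipsi|exact: cvg_cst].
  - have /(integrableZl measurableT C) := integrable_abse ig.
    by apply: eq_integrable => // x _; rewrite /= EFinM.
  - by apply: aeW => x n _; rewrite /= lee_fin normrM ler_wpM2r.
  move=> _ _ /cvg_lim; rewrite /Rintegral => <- //.
  have E n : (\int[mu]_x (phi n x * g x)%:E = 0)%E.
    have fin := integrable_fin_num measurableT
      (bounded_mul_integrable (mphi n) (phiC n) ig).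
    by rewrite -(fineK fin); congr EFin; exact: H.
  by rewrite (_ : [sequence _]_n = fun=> 0%E) ?lim_cst//; apply/funext => n; exact: E.
apply: complexP => /=.
  under eq_Rintegral do rewrite re_realM.
  apply: key => // n; have /(congr1 (@complex.Re R)) := cI0 n => /= <-.
  by apply: eq_Rintegral => x _; rewrite re_realM.
under eq_Rintegral do rewrite im_realM.
apply: key => // n; have /(congr1 (@complex.Im R)) := cI0 n => /= <-.
by apply: eq_Rintegral => x _; rewrite im_realM.
Qed.

End Bounded.

(** * Polynomial approximation of the sign function *)

Section Sign.
Context (R : realType).

(* The iterates of this odd polynomial converge pointwise on [-1, 1] to the sign. *)
Definition sgpoly (x : R) := x * (3 - x ^+ 2) / 2.

Lemma sgpoly_bounded x : `|x| <= 1 -> `|sgpoly x| <= 1.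
Proof.
rewrite !ler_norml /sgpoly => /andP[x1 x2]; rewrite expr2.
(* The two products expand to 2 - 3 x + x^3 and 2 + 3 x - x^3, twice the distances of [sgpoly x] to
   1 and to -1. *)
have : 0 <= (1 - x) ^+ 2 * (2 + x) by rewrite mulr_ge0 ?sqr_ge0//; lra.
have : 0 <= (1 + x) ^+ 2 * (2 - x) by rewrite mulr_ge0 ?sqr_ge0//; lra.
by rewrite !expr2 => *; apply/andP; split; lra.
Qed.

Lemma iter_sgpoly_bounded n x : `|x| <= 1 -> `|iter n sgpoly x| <= 1.
Proof. by move=> x1; elim: n => //= n IH; exact: sgpoly_bounded. Qed.

Lemma iter_sgpolyN n x : iter n sgpoly (- x) = - iter n sgpoly x.
Proof. by elim: n => //= n ->; rewrite /sgpoly; ring. Qed.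

(** One step multiplies the distance to 1 by 1 - y/2 - y^2/2, which is at most 1 - x/2 as long as
    the iterate y stays above the starting point x. *)
Lemma iter_sgpoly_pos n x : 0 < x <= 1 ->
  x <= iter n sgpoly x <= 1 /\ 1 - iter n sgpoly x <= (1 - x / 2) ^+ n.
Proof.
move=> /andP[x0 x1]; elim: n => [|n [/andP[h1 h2] h3]] /=.
  by rewrite lexx x1 expr0; split => //; lra.
move: (iter n sgpoly x) h1 h2 h3 => y xy y1 H; rewrite exprS.
have E : 1 - sgpoly y = (1 - x / 2) * (1 - y) - (1 - y) * ((y - x) / 2 + y ^+ 2 / 2).
  by rewrite /sgpoly; field.
have y2 : 0 <= y ^+ 2 by exact: sqr_ge0.
have p1 : 0 <= (1 - y) * ((y - x) / 2 + y ^+ 2 / 2) by apply: mulr_ge0; lra.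
have p2 : (1 - x / 2) * (1 - y) <= (1 - x / 2) * (1 - x / 2) ^+ n.
  by rewrite ler_wpM2l//; lra.
have p3 : 0 <= (1 - y) * (y + y ^+ 2) by apply: mulr_ge0; lra.
have p4 : sgpoly y - y = (1 - y) * (y + y ^+ 2) / 2 by rewrite /sgpoly; field.
have /(sgpoly_bounded) : `|y| <= 1 by rewrite ler_norml; apply/andP; split; lra.
by rewrite ler_norml => /andP[_ q1]; split; [apply/andP; split; lra | lra].
Qed.

Lemma cvg_iter_sgpoly x : `|x| <= 1 -> (fun n => iter n sgpoly x) @ \oo --> Num.sg x.
Proof.
have pos y : 0 < y <= 1 -> (fun n => iter n sgpoly y) @ \oo --> (1 : R).
  move=> y01; have /andP[y0 y1] := y01.
  apply: (@squeeze_cvgr _ _ _ _ (fun n => 1 - (1 - y / 2) ^+ n) (fun=> 1)).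
  - near=> n; have [/andP[_ h2] h3] := iter_sgpoly_pos n y01.
    by rewrite h2 andbT; lra.
  - rewrite -[X in _ --> X]subr0; apply: cvgB; first exact: cvg_cst.
    by apply: cvg_expr; rewrite ger0_norm; lra.
  - exact: cvg_cst.
move=> x1; have [x0|x0|->] := ltrgt0P x.
- by rewrite gtr0_sg//; apply: pos; rewrite x0 (le_trans (ler_norm _)).
- rewrite ltr0_sg//; rewrite -[x in X in X @ _ --> _]opprK.
  under eq_fun do rewrite iter_sgpolyN.
  apply: cvgN; apply: pos; rewrite oppr_gt0 x0 (le_trans _ x1)//.
  by rewrite -normrN ler_norm.
- rewrite sgr0; have -> : (fun n => iter n sgpoly (0 : R)) = fun=> 0.
    by apply/funext; elim => //= n ->; rewrite /sgpoly !mul0r.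
  exact: cvg_cst.
Unshelve. all: by end_near. Qed.

End Sign.

Lemma ae_complex0 d (X : measurableType d) (R : realType) (mu : {measure set X -> \bar R})
    (f : X -> R[i]) : {ae mu, forall x, re (f x) = 0} -> {ae mu, forall x, im (f x) = 0} ->
  {ae mu, forall x, f x = 0}.
Proof. by apply: filterS2 => x a b; apply: complexP; rewrite ?a ?b. Qed.

(** * Completeness of the exponentials on a unit interval *)

Section TrigComplete.
Context (R : realType) (t : R).
Local Notation leb := (lebm R).
Implicit Types (H : R -> R[i]) (phi psi : R -> R).

Definition ek (k : int) (x : R) : R[i] := expi (2 * pi * k%:~R * x).

Lemma measurable_lin (a : R) : measurable_fun setT (fun x : R => a * x).
Proof. exact: measurable_funM. Qed.

Lemma cmeas_ek k : cmeas (ek k).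
Proof. by apply: cmeas_expi; exact: measurable_lin. Qed.

(* The bounded functions multiplying this class into itself form an algebra closed under
   bounded pointwise limits and contain cosine and sine; hence they include the indicators of
   Borel sets, which forces H = 0 almost everywhere. *)
Definition null_coef H :=
  [/\ cintegrable leb H, (forall x, x \notin `]t, t + 1[ -> H x = 0) &
   forall k, cI leb (fun x => ek k x * H x) = 0].

Definition multiplier phi :=
  [/\ measurable_fun setT phi, (exists C, forall x, `|phi x| <= C) &
   forall H, null_coef H -> null_coef (fun x => (phi x)%:C * H x)].

Lemma ek_integrable k H : cintegrable leb H -> cintegrable leb (fun x => ek k x * H x).
Proof.
move=> iH; apply: (cintegrable_bounded_mul (C := 1) iH (cmeas_ek k)) => x.
  exact: cos_max.
exact: sin_max.
Qed.

Lemma real_mul_integrable phi C H : measurable_fun setT phi -> (forall x, `|phi x| <= C) ->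
  cintegrable leb H -> cintegrable leb (fun x => (phi x)%:C * H x).
Proof.
move=> mphi phiC iH; have C0 : 0 <= C by exact: le_trans (normr_ge0 _) (phiC 0).
by apply: (cintegrable_bounded_mul (C := C) iH) => //= x; rewrite normr0.
Qed.

Lemma multiplier_cst c : multiplier (fun=> c).
Proof.
split=> [||H [iH sH cH]]; [exact: measurable_cst|by exists (`|c|)|].
split; first by apply: (@real_mul_integrable _ `|c|).
  by move=> x /sH ->; rewrite mulr0.
move=> k; rewrite -(mulr0 c%:C) -(cH k) -cIZ; last exact: ek_integrable.
by apply: eq_cI => x; ring.
Qed.

Lemma multiplierM phi psi : multiplier phi -> multiplier psi ->
  multiplier (fun x => phi x * psi x).
Proof.
move=> [m1 [C1 b1] H1] [m2 [C2 b2] H2]; split.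
- exact: measurable_funM.
- by exists (C1 * C2) => x; rewrite normrM; apply: ler_pM.
move=> H nH; have := H1 _ (H2 _ nH); congr null_coef.
by apply/funext => x; rewrite rmorphM mulrA.
Qed.

Lemma multiplierD phi psi : multiplier phi -> multiplier psi ->
  multiplier (fun x => phi x + psi x).
Proof.
move=> [m1 [C1 b1] H1] [m2 [C2 b2] H2]; split.
- exact: measurable_funD.
- by exists (C1 + C2) => x; rewrite (le_trans (ler_normD _ _))// lerD.
move=> H nH; have [i1 s1 c1] := H1 _ nH; have [i2 s2 c2] := H2 _ nH.
have E : (fun x => (phi x + psi x)%:C * H x) =
    fun x => (phi x)%:C * H x + (psi x)%:C * H x.
  by apply/funext => x; rewrite rmorphD mulrDl.
rewrite E; split; first exact: cintegrableD.
  by move=> x xN; rewrite s1// s2// addr0.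
move=> k; rewrite -[RHS]addr0 -{1}(c1 k) -(c2 k) -cID; try exact: ek_integrable.
by apply: eq_cI => x; rewrite mulrDr.
Qed.

(** Multiplication by [phi] mixes the coefficients of index [k + 1] and [k - 1], and all of these
    vanish. *)
Lemma multiplier_ek (c : R[i]) (phi : R -> R) : measurable_fun setT phi ->
  (forall x, `|phi x| <= 1) ->
  (forall x, (phi x)%:C = c * ek 1 x + c^* * ek (-1) x) -> multiplier phi.
Proof.
move=> mphi phi1 phiE; split=> //; first by exists 1.
move=> H [iH sH cH]; split; first exact: (real_mul_integrable mphi phi1).
  by move=> x /sH ->; rewrite mulr0.
move=> k; transitivity (c * cI leb (fun x => ek (k + 1) x * H x) +
    c^* * cI leb (fun x => ek (k - 1) x * H x)); last by rewrite !cH !mulr0 addr0.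
rewrite -cIZ; last exact: ek_integrable.
rewrite -cI_comb; last 2 first.
- have := cintegrable_bounded_mul (C := `|re c| + `|im c|) (ek_integrable (k + 1) iH) (cmeas_cst R c).
  by apply => x; rewrite ?lerDl ?lerDr.
- exact: ek_integrable.
apply: eq_cI => x; rewrite phiE.
have E j : ek (k + j) x = ek k x * ek j x.
  by rewrite /ek -expiD; congr expi; rewrite intrD; ring.
by rewrite !E; ring.
Qed.

Lemma ek1 x : ek 1 x = expi (2 * pi * x). Proof. by rewrite /ek mulr1. Qed.
Lemma ekN1 x : ek (-1) x = (expi (2 * pi * x))^*.
Proof. by rewrite /ek -expiN; congr expi; rewrite mulrN1z; ring. Qed.

Lemma multiplier_cos : multiplier (fun x => cos (2 * pi * (x - t))).
Proof.
apply: (@multiplier_ek (2^-1%:C * expi (- (2 * pi * t)))) => [|x|x].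
- by apply: (measurableT_comp (@measurable_cos R)); apply: measurable_funM => //; exact: measurable_funB.
- exact: cos_max.
rewrite ek1 ekN1 mulrBr cosB expiN.
by apply: complexP; rewrite !reim /expi /= ; field.
Qed.

Lemma multiplier_sin : multiplier (fun x => sin (2 * pi * (x - t))).
Proof.
(* [z0] is zero under an opaque name; the coefficient used next is -i/2, as in Euler's formula for
   the sine. *)
have [z0 zE] : exists z0 : R, z0 = 0 by exists 0.
apply: (@multiplier_ek ((z0 -i* 2^-1) * expi (- (2 * pi * t)))) => [|x|x].
- by apply: (measurableT_comp (@measurable_sin R)); apply: measurable_funM => //; exact: measurable_funB.
- exact: sin_max.
rewrite ek1 ekN1 mulrBr sinB expiN.
by apply: complexP; rewrite !reim /expi /= zE; field.
Qed.

Lemma multiplier_lim (phi_ : nat -> R -> R) phi C : (forall n, multiplier (phi_ n)) ->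
  (forall n x, `|phi_ n x| <= C) -> (forall x, phi_ ^~ x @ \oo --> phi x) -> multiplier phi.
Proof.
move=> mphi_ bd cv.
have m1 n : measurable_fun setT (phi_ n) by case: (mphi_ n).
have m2 : measurable_fun setT phi.
  by apply: (measurable_fun_cvg m1) => x _; exact: cv.
have b2 x : `|phi x| <= C.
  rewrite -(cvg_lim _ (cvg_norm (cv x)))//; apply: limr_le.
    by apply/cvg_ex; exists `|phi x|; apply: cvg_norm; exact: cv.
  by apply: nearW => n; exact: bd.
split=> //; first by exists C.
move=> H nH; have [iH sH cH] := nH; split; first exact: (real_mul_integrable m2 b2).
  by move=> x /sH ->; rewrite mulr0.
move=> k; transitivity (cI leb (fun x => (phi x)%:C * (ek k x * H x))).
  by apply: eq_cI => x; ring.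
apply: (cI_bounded_cvg (ek_integrable k iH) m1 m2 bd cv) => n.
have [_ _ /(_ _ nH)[_ _ /(_ k) <-]] := mphi_ n.
by apply: eq_cI => x; ring.
Qed.

Definition mset (A : set R) := measurable A /\ multiplier (\1_A).

(** The indicator is half of sg + sg^2 evaluated at [phi], and the sign of [phi] is a bounded
    pointwise limit of polynomials in [phi]. *)
Lemma mset_pos phi : (forall x, `|phi x| <= 1) -> multiplier phi -> mset [set x | 0 < phi x].
Proof.
move=> phi1 mphi; have mm : measurable_fun setT phi by case: mphi.
split.
  rewrite (_ : [set x | _] = phi @^-1` `]0, +oo[).
    by rewrite -[X in measurable X]setTI; exact: mm.
  by apply/seteqP; split => x /=; rewrite in_itv/= andbT.
have ms : multiplier (fun x => Num.sg (phi x)).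
  apply: (@multiplier_lim (fun n x => iter n (@sgpoly R) (phi x)) _ 1).
  - elim=> [//|n IH] /=; rewrite /sgpoly.
    have := multiplierM IH (multiplierD (multiplier_cst (3 / 2))
       (multiplierM (multiplier_cst (- 2^-1)) (multiplierM IH IH))).
    by congr multiplier; apply/funext => x; field.
  - by move=> n x; exact: iter_sgpoly_bounded.
  - by move=> x; exact: cvg_iter_sgpoly.
have := multiplierM (multiplier_cst 2^-1) (multiplierD ms (multiplierM ms ms)).
congr multiplier; apply/funext => x; rewrite indicE.
have -> : (x \in [set x | 0 < phi x]) = (0 < phi x) by apply/idP/idP; rewrite inE.
have [h|h|->] := ltrgt0P (phi x).
- by rewrite gtr0_sg//=; field.
- by rewrite ltr0_sg//=; field.
- by rewrite sgr0 /=; field.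
Qed.

Lemma mset_setC A : mset A -> mset (~` A).
Proof.
move=> [mA sA]; split; first exact: measurableC.
have := multiplierD (multiplier_cst 1) (multiplierM (multiplier_cst (-1)) sA).
by congr multiplier; apply/funext => x; rewrite !indicE in_setC; case: (x \in A) => /=; ring.
Qed.

Lemma mset_setI A B : mset A -> mset B -> mset (A `&` B).
Proof.
move=> [mA sA] [mB sB]; split; first exact: measurableI.
have := multiplierM sA sB; congr multiplier; apply/funext => x.
by rewrite !indicE in_setI; case: (x \in A); case: (x \in B) => /=; ring.
Qed.

(** The indicators of the decreasing finite intersections [B n] converge to that of the complement
    of the union. *)
Lemma mset_bigcup (F : nat -> set R) : (forall n, mset (F n)) -> mset (\bigcup_n F n).
Proof.
move=> mF; rewrite -[X in mset X]setCK setC_bigcup.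
pose B n := \bigcap_(i in `I_n) ~` F i.
have BS n : B n.+1 = B n `&` ~` F n.
  apply/seteqP; split => x.
    by move=> h; split=> [i /= ni|]; apply: h => //=; rewrite ltnW.
  by move=> [h1 h2] i /=; rewrite ltnS leq_eqVlt => /predU1P[->//|/h1].
have mB n : mset (B n).
  elim: n => [|n IH].
    split; first by rewrite (_ : B 0%N = setT)//; apply/seteqP; split => x // _ i.
    have := multiplier_cst 1; congr multiplier; apply/funext => x.
    by rewrite indicE mem_set// => i.
  by rewrite BS; apply: mset_setI => //; exact: mset_setC.
apply: mset_setC; split.
  by apply: bigcap_measurable => [|n _]; [exists 0%N|case: (mset_setC (mF n))].
apply: (@multiplier_lim (fun n => \1_(B n)) _ 1).
- by move=> n; case: (mB n).
- by move=> n x; rewrite indicE; case: (_ \in _); rewrite ?normr1 ?normr0.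
move=> x; rewrite indicE; have [xA|xA] := boolP (x \in \bigcap_i ~` F i).
  apply: cvg_near_cst; apply: nearW => n; rewrite indicE mem_set// => i _.
  by move: xA; rewrite inE => /(_ i I).
have [i Fi] : exists i, F i x.
  apply: contrapT => h; move/negP: xA; apply; rewrite inE => i _ Fi.
  by apply: h; exists i.
apply: cvg_near_cst; exists i.+1 => // n /= ni; rewrite indicE memNset//.
by move=> /(_ i ni).
Qed.

(** Functions of the class vanish off the window, so a set may be changed freely there. *)
Lemma mset_window A B : measurable A -> mset B ->
  (forall x, t < x < t + 1 -> (A x <-> B x)) -> mset A.
Proof.
move=> mA [mB [_ _ sB]] AB; split=> //; split; first exact: measurable_indic.
  by exists 1 => x; rewrite indicE; case: (_ \in _); rewrite ?normr1 ?normr0.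
move=> H nH; have := sB _ nH; congr null_coef; apply/funext => x.
have [xt|xt] := boolP (x \in `]t, t + 1[).
  rewrite !indicE; suff -> : (x \in A) = (x \in B) by [].
  by apply/idP/idP; rewrite !inE => h; apply/AB; rewrite // in_itv in xt.
by case: nH => _ /(_ _ xt) -> _; rewrite !mulr0.
Qed.

Let c x := cos (2 * pi * (x - t)).
Let s x := sin (2 * pi * (x - t)).

(** The rescaled function (phi - a) / (1 + |a|) stays within [-1, 1], where the sign iteration
    converges. *)
Lemma mset_gt phi a : (forall x, `|phi x| <= 1) -> multiplier phi -> mset [set x | a < phi x].
Proof.
move=> phi1 mphi; have nz : 0 < 1 + `|a| by rewrite ltr_pwDl.
have := @mset_pos (fun x => (1 + `|a|)^-1 * phi x + - (a / (1 + `|a|))).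
have -> : [set x | 0 < (1 + `|a|)^-1 * phi x + - (a / (1 + `|a|))] = [set x | a < phi x].
  apply/funext => x; apply/propext => /=.
  by rewrite subr_gt0 mulrC ltr_pM2l ?invr_gt0.
apply.
  move=> x; rewrite mulrC -mulrBl normrM [X in _ * X]ger0_norm ?invr_ge0 ?(ltW nz)//.
  by rewrite ler_pdivrMr// mul1r (le_trans (ler_normB _ _))// lerD2r.
apply: multiplierD; last exact: multiplier_cst.
by apply: multiplierM => //; exact: multiplier_cst.
Qed.

Lemma mset_lt phi a : (forall x, `|phi x| <= 1) -> multiplier phi -> mset [set x | phi x < a].
Proof.
move=> phi1 mphi; have := @mset_gt (fun x => -1 * phi x) (- a).
have -> : [set x | - a < -1 * phi x] = [set x | phi x < a].
  by apply/funext => x; apply/propext => /=; rewrite mulN1r ltrN2.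
apply; first by move=> x; rewrite mulN1r normrN.
by apply: multiplierM => //; exact: multiplier_cst.
Qed.

Lemma mset_cos_gt a : mset [set x | a < c x].
Proof. by apply: mset_gt; [move=> x; exact: cos_max|exact: multiplier_cos]. Qed.

Lemma mset_cos_lt a : mset [set x | c x < a].
Proof. by apply: mset_lt; [move=> x; exact: cos_max|exact: multiplier_cos]. Qed.

Lemma mset_sin_gt0 : mset [set x | 0 < s x].
Proof. by apply: mset_gt; [move=> x; exact: sin_max|exact: multiplier_sin]. Qed.

Lemma mset_sin_lt0 : mset [set x | s x < 0].
Proof. by apply: mset_lt; [move=> x; exact: sin_max|exact: multiplier_sin]. Qed.

Lemma sin_window_gt0 (y : R) : 0 < y < 1 -> (0 < sin (2 * pi * y)) = (y < 2^-1).
Proof.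
move=> /andP[y0 y1]; have p0 := pi_gt0 R; apply/idP/idP; last first.
  move=> y2; apply: sin_gt0_pi; rewrite !mulr_gt0//=.
  have : pi * (2 * y) < pi * 1 by rewrite ltr_pM2l//; lra.
  by lra.
apply: contraTT; rewrite -!leNgt => y2.
have -> : 2 * pi * y = pi * (2 * y - 1) + pi by ring.
rewrite sinDpi oppr_le0; apply: sin_ge0_pi; apply/andP; split.
  by rewrite mulr_ge0 ?pi_ge0//; lra.
by rewrite -[leRHS]mulr1 ler_wpM2l ?pi_ge0//; lra.
Qed.

Lemma sin_window_lt0 (y : R) : 0 < y < 1 -> (sin (2 * pi * y) < 0) = (2^-1 < y).
Proof.
move=> /andP[y0 y1].
have -> : sin (2 * pi * y) = - sin (2 * pi * (1 - y)).
  have -> : 2 * pi * (1 - y) = - (2 * pi * y) + pi *+ 2 by ring.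
  by rewrite sinD2pi sinN opprK.
rewrite oppr_lt0 sin_window_gt0; last by apply/andP; split; lra.
by apply/idP/idP => ?; lra.
Qed.

Lemma cos_window (y a : R) : 0 <= y <= 2^-1 -> 0 <= a <= 2^-1 ->
  (cos (2 * pi * a) < cos (2 * pi * y)) = (y < a).
Proof.
have p0 := pi_gt0 R.
have I z : 0 <= z <= 2^-1 -> 2 * pi * z \in `[0, pi].
  move=> /andP[z0 z1]; rewrite in_itv/=; apply/andP; split.
    by rewrite !mulr_ge0 ?pi_ge0.
  have : pi * (2 * z) <= pi * 1 by rewrite ler_wpM2l ?pi_ge0//; lra.
  by lra.
by move=> hy ha; rewrite ltr_cos ?I// ltr_pM2l// mulr_gt0.
Qed.

Lemma cos_window_refl (y : R) : cos (2 * pi * (1 - y)) = cos (2 * pi * y).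
Proof.
have -> : 2 * pi * (1 - y) = - (2 * pi * y) + pi *+ 2 by ring.
by rewrite cosD2pi cosN.
Qed.

(** Inside the window a ray is described by the sign of the sine, which tells the half of the
    period, and by the cosine, monotone on each half. The cases are an empty trace, a full trace,
    and an end point in the first or in the second half. *)
Lemma mset_ray b : mset `]-oo, b[%classic.
Proof.
pose a := b - t.
have E x : (`]-oo, b[%classic : set R) x <-> x - t < a by rewrite /= in_itv/= ltrD2r.
have [a0|a0] := leP a 0.
  (* The cosine is always above -2, so the union is the whole line and its complement is empty. *)
  apply: (mset_window _ (mset_setC (mset_bigcup (fun n => mset_cos_gt (-2))))) => // x /andP[h1 h2].
  rewrite E; split; first by lra.
  by move=> H; exfalso; apply: H; exists 0%N => //=; have := cos_geN1 (2 * pi * (x - t)); rewrite /c; lra.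
have [a1|a1] := leP 1 a.
  apply: (mset_window _ (mset_cos_gt (-2))) => // x /andP[h1 h2].
  rewrite E; split; last by lra.
  by move=> H /=; have := cos_geN1 (2 * pi * (x - t)); rewrite /c; lra.
have [a2|a2] := leP a 2^-1.
  apply: (mset_window _ (mset_setI mset_sin_gt0 (mset_cos_gt (cos (2 * pi * a))))) => // x /andP[h1 h2].
  rewrite E /s /c /=; split.
    move=> xa; rewrite sin_window_gt0; last by apply/andP; split; lra.
    by split; [lra|rewrite cos_window//; apply/andP; split; lra].
  rewrite sin_window_gt0; last by apply/andP; split; lra.
  by move=> [x2]; rewrite cos_window//; apply/andP; split; lra.
apply: (mset_window _ (mset_setC (mset_setI mset_sin_lt0
   (mset_setC (mset_cos_lt (cos (2 * pi * a))))))) => // x /andP[h1 h2].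
rewrite E /s /c /= -(cos_window_refl a) -(cos_window_refl (x - t)).
have y01 : 0 < x - t < 1 by apply/andP; split; lra.
rewrite not_andE not_notE sin_window_lt0//; split.
  move=> xa; have [x2|x2] := ltP 2^-1 (x - t); [right|by left].
  by rewrite cos_window ?ltrD2l ?ltrN2//; apply/andP; split; lra.
move=> [/negP|].
  by rewrite -leNgt; lra.
have [x2|x2] := leP (x - t) 2^-1; first by lra.
by rewrite cos_window ?ltrD2l ?ltrN2//; apply/andP; split; lra.
Qed.

Lemma mset_measurable (A : set R) : measurable A -> mset A.
Proof.
move=> mA; suff : measurable `<=` mset by apply.
rewrite [X in X `<=` _](RGenInftyO.measurableE R).
apply: smallest_sub; last by move=> _ [b ->]; exact: mset_ray.
split.
- split=> //; have := multiplier_cst 0; congr multiplier; apply/funext => x.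
  by rewrite indic0.
- by move=> B mB; rewrite setTD; exact: mset_setC.
- by move=> F mF; exact: mset_bigcup.
Qed.

(** Once every Borel indicator is a multiplier, the coefficient of index 0 says that [H] has
    integral zero over each Borel set. *)
Theorem trig_complete H : null_coef H -> {ae leb, forall x, H x = 0}.
Proof.
move=> nH; have [[iH1 iH2] _ _] := nH.
have z A : measurable A -> cI leb (fun x => (\1_A x)%:C * H x) = 0.
  move=> /mset_measurable[_ [_ _ /(_ _ nH)]][_ _ /(_ 0) <-].
  by apply: eq_cI => x; rewrite /ek mulr0 mul0r expi0 mul1r.
have key (g : R -> R) : leb.-integrable setT (EFin \o g) ->
    (forall A, measurable A -> \int[leb]_x (\1_A x * g x) = 0) -> {ae leb, forall x, g x = 0}.
  move=> ig gA.
  have : ae_eq leb setT (EFin \o g) (fun=> 0%E).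
    apply: integral_ae_eq => // A _ mA; rewrite integral0.
    have iA : leb.-integrable A (EFin \o g) by apply: integrableS ig.
    have fin := integrable_fin_num mA iA.
    rewrite -(fineK fin) -[0%E]/((0 : R)%:E); congr EFin.
    rewrite -(gA _ mA) /Rintegral integral_mkcond; congr fine; apply: eq_integral => x _.
    by rewrite patchE indicE; case: (x \in A); rewrite ?mul1r ?mul0r.
  by apply: filterS => x /(_ I) [].
have h1 : {ae leb, forall x, re (H x) = 0}.
  apply: key => // A mA; have /(congr1 (@complex.Re R)) /= := z _ mA.
  by under eq_Rintegral do rewrite re_realM.
have h2 : {ae leb, forall x, im (H x) = 0}.
  apply: key => // A mA; have /(congr1 (@complex.Im R)) /= := z _ mA.
  by under eq_Rintegral do rewrite im_realM.
exact: ae_complex0 h1 h2.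
Qed.
End TrigComplete.

(** * Affine changes of variable and integer tiling on the line *)

Definition pushm d d' (T1 : measurableType d) (T2 : measurableType d') (R : realType)
    (m : {measure set T1 -> \bar R}) (f : T1 -> T2) (mf : measurable_fun setT f) :
    {measure set T2 -> \bar R} :=
  measure_function_pushforward__canonical__measure_function_Measure m mf.

Section Affine.
Context (R : realType) (a c : R) (a0 : 0 < a).
Local Notation leb := (lebm R).

Let aff (x : measurableTypeR R) : measurableTypeR R := a * x + c.

Lemma measurable_affine : measurable_fun setT aff.
Proof. by apply: measurable_funD => //; exact: measurable_funM. Qed.

(** Uniqueness of Lebesgue measure: the rescaled image measure agrees with it on half-open
    intervals. *)
Let lebesgue_affine (A : set R) : measurable A ->
  (a%:E * leb (aff @^-1` A) = leb A)%E.
Proof.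
move=> mA; pose an : {nonneg R} := NngNum (ltW a0).
have push : leb A = mscale an (pushm leb measurable_affine) A.
  apply: lebesgue_measure_unique => // _ [[x y] _ <-].
  pose I := `](x - c) / a, (y - c) / a]%classic.
  transitivity (a%:E * @lebesgue_measure R I)%E; last first.
    congr (_ * lebesgue_measure _)%E.
    apply/funext => z; rewrite -[RHS]/(is_true (x < a * z + c <= y)).
    rewrite -[LHS]/(is_true ((x - c) / a < (z : R) <= (y - c) / a)).
    by rewrite ltr_pdivrMr// ler_pdivlMr// ltrBlDr lerBrDr [z * a]mulrC.
  rewrite /I /= !lebesgue_measure_itv/= !lte_fin.
  rewrite ltr_pM2r ?invr_gt0// ltrD2r; case: ifPn => _; last by rewrite mule0.
  by rewrite -!EFinD -EFinM -mulrBl mulrC divfK ?gt_eqF//; congr EFin; ring.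
by rewrite push.
Qed.

Lemma integral_affine (f : R -> \bar R) : measurable_fun setT f -> (forall x, 0 <= f x)%E ->
  (a%:E * \int[leb]_x f (a * x + c)%R = \int[leb]_x f x)%E.
Proof.
move=> mf f0; pose an : {nonneg R} := NngNum (ltW a0).
have -> : (\int[leb]_x f (a * x + c)%R = \int[pushm leb measurable_affine]_x f x)%E.
  by rewrite ge0_integral_pushforward//; exact: measurable_affine.
have -> : (\int[leb]_x f x = \int[mscale an (pushm leb measurable_affine)]_x f x)%E.
  by apply: eq_measure_integral => A mA _; rewrite /= -lebesgue_affine.
by rewrite ge0_integral_mscale.
Qed.

End Affine.

Section IntegerTiling.
Context (R : realType).
Local Notation leb := (lebm R).

(** A bijective enumeration of the integers, negative ones at odd places, since series are indexed
    by [nat]. *)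
Definition zn (n : nat) : int := if odd n then Negz n./2 else Posz n./2.

Lemma zn_inj : injective zn.
Proof.
move=> i j; rewrite /zn; case: ifP => oi; case: ifP => oj // [h];
by rewrite -(odd_double_half i) -(odd_double_half j) oi oj h.
Qed.

Lemma zn_surj k : exists n, zn n = k.
Proof.
case: k => k; [exists k.*2|exists k.*2.+1]; rewrite /zn /= odd_double ?doubleK//=.
by rewrite uphalf_double.
Qed.

Lemma measurable_translate (c : R) : measurable_fun setT (fun x : R => x + c).
Proof. exact: measurable_funD. Qed.

Lemma integral_translate (c : R) (f : R -> \bar R) : measurable_fun setT f ->
  (forall x, 0 <= f x)%E -> (\int[leb]_x f (x + c)%R = \int[leb]_x f x)%E.
Proof.
move=> mf f0; rewrite -(@integral_affine R 1 c ltr01 f mf f0) mul1e.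
by apply: eq_integral => x _; rewrite mul1r.
Qed.

(** Serves to write a frequency integral as an integral over u in [0, 1[ of sums over u + Z; for
    fixed u the sum is then a Parseval sum. *)
Lemma integral_tile (f : R -> \bar R) : measurable_fun setT f -> (forall x, 0 <= f x)%E ->
  (\int[leb]_x f x =
   \int[leb]_(u in `[0%R, 1%R[) \sum_(0 <= n <oo) f (u + (zn n)%:~R)%R)%E.
Proof.
move=> mf f0; pose F n := `[(zn n)%:~R, (zn n)%:~R + 1[%classic : set R.
have FT : \bigcup_n F n = setT.
  rewrite -subTset => x _; have [n nx] := zn_surj (Num.floor x).
  by exists n => //=; rewrite /F nx /= in_itv /=; have := floor_itv x; rewrite intrD.
have tF : trivIset setT F.
  apply/trivIsetP => i j _ _ ij; rewrite -subset0 => x [].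
  rewrite /F /= !in_itv /= => /andP[i1 i2] /andP[j1 j2].
  have : zn i < zn j + 1 by rewrite -(ltr_int R) intrD; exact: le_lt_trans i1 j2.
  have : zn j < zn i + 1 by rewrite -(ltr_int R) intrD; exact: le_lt_trans j1 i2.
  rewrite !ltzD1 => ji ij'; move/eqP: ij; apply; apply: zn_inj.
  by apply/eqP; rewrite eq_le ij' ji.
rewrite integral_nneseries//; last first.
  by move=> n; apply: measurable_funTS; apply: measurableT_comp mf _; exact: measurable_translate.
rewrite -FT ge0_integral_bigcup//; last 2 first.
- by move=> k; exact: measurable_itv.
- by rewrite FT.
apply: eq_eseriesr => n _.
rewrite integral_mkcond [RHS]integral_mkcond.
rewrite -(@integral_translate (zn n)%:~R (f \_ (F n))); last 2 first.
- by apply/(measurable_restrictT _ _).1 => //; [exact: measurable_itv|exact: measurable_funTS].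
- by move=> x; rewrite patchE; case: ifP.
apply: eq_integral => x _; rewrite !patchE.
have -> // : (x + (zn n)%:~R \in F n) = (x \in `[0%R, 1%R[%classic).
by apply/idP/idP; rewrite !inE /F /= !in_itv /= lerDr addrC ltrD2l.
Qed.

End IntegerTiling.

(** * The unit window and Moyal's identity in dimension one *)

Section Window.
Context (R : realType).
Local Notation leb := (lebm R).

Definition win (x : R) : R := \1_(`]0, 1[%classic) x.

(** The one-dimensional H_z, with [z] the pair of translation and frequency. The window is open at
    both ends, matching the support condition of [null_coef]. *)
Definition h1 (z : R * R) (x : R) : R[i] := expi (2 * pi * z.2 * x) * (win (x - z.1))%:C.

Lemma winE x : win x = (0 < x < 1)%R%:R.
Proof. by rewrite /win indicE mem_setE in_itv. Qed.

Lemma measurable_win : measurable_fun setT win.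
Proof. by apply: measurable_indic; exact: measurable_itv. Qed.

Lemma win_bound x : 0 <= win x <= 1.
Proof. by rewrite winE; case: ((0 < x) && (x < 1)); rewrite /= ?lexx ?ler01. Qed.

Lemma win_sqr x : win x * win x = win x.
Proof. by rewrite winE; case: ((0 < x) && (x < 1)); rewrite ?mulr1 ?mulr0. Qed.

Lemma sqmod_h1 z x : sqmod (h1 z x) = win (x - z.1).
Proof.
by rewrite /h1 sqmodM sqmod_expi mul1r /sqmod /= expr0n addr0 expr2 win_sqr.
Qed.

Lemma cmeas_real d (X : measurableType d) (p : X -> R) : measurable_fun setT p ->
  cmeas (fun x => (p x)%:C).
Proof. by move=> mp; split => //=; exact: measurable_cst. Qed.

Lemma cmeas_h1 : cmeas (fun p : (R * R) * R => h1 p.1 p.2).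
Proof.
apply: cmeasM.
  apply: cmeas_expi; apply: measurable_funM; last exact: measurable_snd.
  apply: measurable_funM => //.
  exact: (measurableT_comp measurable_snd measurable_fst).
apply: cmeas_real; apply: (measurableT_comp measurable_win).
apply: measurable_funB; first exact: measurable_snd.
exact: (measurableT_comp measurable_fst measurable_fst).
Qed.

Lemma integral_win (t : R) : (\int[leb]_x (win (x - t))%:E = 1)%E.
Proof.
rewrite (@integral_translate R (- t) (fun x => (win x)%:E)).
- rewrite integral_indic//= setIT.
  rewrite /lebm /= lebesgue_measure_itv/= lte_fin ltr01.
  by rewrite -EFinB subr0.
- by apply/measurable_EFinP; exact: measurable_win.
- by move=> x; rewrite lee_fin; case/andP: (win_bound x).
Qed.

Lemma L2_h1 z : L2 leb (h1 z).
Proof.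
split; first exact: (cmeas_slice1 z cmeas_h1).
by under eq_integral do rewrite sqmod_h1; rewrite integral_win ltry.
Qed.

End Window.

Section WindowIntegral.
Context (R : realType) (t : R).
Local Notation leb := (lebm R).

Lemma Rintegral_win (p : R -> R) : measurable_fun setT p ->
  \int[leb]_x (win (x - t) * p x) = fine (\int[leb]_(x in `[t, (t + 1)%R]) (p x)%:E)%E.
Proof.
move=> mp; rewrite /Rintegral (@integral_itv_bndoo R t (t + 1)); last first.
  by apply/measurable_EFinP; exact: measurable_funTS.
rewrite [in RHS]integral_mkcond; congr fine; apply: eq_integral => x _.
rewrite patchE mem_setE in_itv /= winE subr_gt0 ltrBlDl.
by case: ifP => _; rewrite ?mul1r ?mul0r.
Qed.

Lemma FTC2_everywhere (F f : R -> R) (a b : R) : a < b -> continuous f ->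
  (forall x : R, is_derive x 1 F (f x)) ->
  (\int[leb]_(x in `[a, b]) (f x)%:E = (F b)%:E - (F a)%:E)%E.
Proof.
move=> ab cf dF; apply: continuous_FTC2 => //.
- by apply: continuous_subspaceT => x; exact: cf.
- have cF : continuous F.
    by move=> x; apply: differentiable_continuous; apply/derivable1_diffP; case: (dF x).
  split.
  + by move=> x _; case: (dF x).
  + by apply: cvg_at_right_filter; exact: cF.
  + by apply: cvg_at_left_filter; exact: cF.
- by move=> x _; rewrite derive1E; case: (dF x).
Qed.

(** For nonzero [k] the primitives of the two parts have period 1, so the boundary terms cancel. *)
Lemma window_integral (k : int) :
  cI leb (fun x => ek k x * (win (x - t))%:C) = (k == 0)%:R.
Proof.
have [->|k0] := eqVneq k 0.
  have -> : cI leb (fun x => ek 0 x * (win (x - t))%:C) = cI leb (fun x => (win (x - t))%:C).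
    by apply: eq_cI => x; rewrite /ek mulr0 mul0r expi0 mul1r.
  apply: complexP => /=; last by rewrite Rintegral_cst// mul0r.
  by rewrite /Rintegral integral_win.
pose w : R := 2 * pi * k%:~R.
have w0 : w != 0 by rewrite !mulf_neq0 ?intr_eq0// gt_eqF ?pi_gt0.
have per : w * (t + 1) = w * t + (pi *+ 2) *~ k.
  by rewrite mulrDr mulr1; congr (_ + _); rewrite /w -mulrzr; ring.
have pers (f : R -> R) : (forall x, f (x + pi *+ 2) = f x) ->
    f (w * (t + 1)) = f (w * t).
  move=> pf; rewrite per {per}.
  have pn n x : f (x + (pi *+ 2) *+ n) = f x.
    by elim: n x => [|n IH] x; rewrite ?mulr0n ?addr0// mulrSr addrA pf IH.
  have pz (z : int) x : f (x + (pi *+ 2) *~ z) = f x.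
    case: z => n; first by rewrite -pmulrn pn.
    by rewrite NegzE mulrNz -pmulrn -(pn n.+1) subrK.
  by rewrite pz.
have mw : measurable_fun setT (fun x : R => w * x) by exact: measurable_funM.
have cw : continuous (fun x : R => w * x).
  by move=> x; apply: cvgM; [exact: cvg_cst|exact: cvg_id].
have E : cI leb (fun x => ek k x * (win (x - t))%:C) =
    cI leb (fun x => (win (x - t))%:C * ek k x) by apply: eq_cI => x; rewrite mulrC.
have mek := cmeas_ek R k.
rewrite E; apply: complexP.
  rewrite -[LHS]/(\int[leb]_x re ((win (x - t))%:C * ek k x)).
  under eq_Rintegral do rewrite re_realM.
  rewrite Rintegral_win; last exact: mek.1.
  have dF (x : R) : is_derive x 1 (fun x => w^-1 * sin (w * x)) (cos (w * x)).
    by apply: is_derive_eq; rewrite /GRing.scale /=; field.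
  rewrite -[X in fine X]/(\int[leb]_(x in `[t, (t + 1)%R]) (cos (w * x))%:E)%E.
  rewrite (FTC2_everywhere _ _ dF) ?ltrDl//; last first.
    by move=> x; apply: continuous_comp; [exact: cw|exact: continuous_cos].
  by rewrite (pers sin) ?subee// => x; rewrite sinD2pi.
rewrite -[LHS]/(\int[leb]_x im ((win (x - t))%:C * ek k x)).
under eq_Rintegral do rewrite im_realM.
rewrite Rintegral_win; last exact: mek.2.
have dF (x : R) : is_derive x 1 (fun x => - w^-1 * cos (w * x)) (sin (w * x)).
  by apply: is_derive_eq; rewrite /GRing.scale /=; field.
rewrite -[X in fine X]/(\int[leb]_(x in `[t, (t + 1)%R]) (sin (w * x))%:E)%E.
rewrite (FTC2_everywhere _ _ dF) ?ltrDl//; last first.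
  by move=> x; apply: continuous_comp; [exact: cw|exact: continuous_sin].
by rewrite (pers cos) ?subee// => x; rewrite cosD2pi.
Qed.

End WindowIntegral.

Lemma ae_imp d (X : measurableType d) (R : realType) (mu : {measure set X -> \bar R})
    (P Q : X -> Prop) : (forall x, P x -> Q x) ->
  {ae mu, forall x, P x} -> {ae mu, forall x, Q x}.
Proof. by move=> PQ; apply: filterS. Qed.

Section Moyal1.
Context (R : realType).
Local Notation leb := (lebm R).

Lemma cI_ae_zero d (X : measurableType d) (mu : {measure set X -> \bar R}) (f v : X -> R[i])
    (w : X -> R) : cmeas f -> cmeas v -> measurable_fun setT w ->
  {ae mu, forall x, (w x)%:C * v x = 0} -> cip mu (fun x => (w x)%:C * f x) v = 0.
Proof.
move=> mf mv mw ae0; rewrite -(cI0 mu); apply: ae_eq_cI.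
- apply: cmeasM; last exact: cmeas_conj.
  by apply: cmeasM => //; exact: cmeas_real.
- exact: cmeas_cst.
apply: filterS ae0 => x H.
have -> : (w x)%:C * f x * (v x)^* = f x * ((w x)%:C * v x)^*.
  by case: (f x) (v x) => a b [c e]; apply: complexP => /=; ring.
by rewrite H; case: (f x) => a b; apply: complexP => /=; ring.
Qed.

(** For fixed [t] and [u] these functions are the exponential basis of the window, modulated by
    [u]. *)
Lemma window_parseval (t u : R) (f : R -> R[i]) : L2 leb f ->
  (\sum_(0 <= n <oo) (sqmod (cip leb f (h1 (t, u + (zn n)%:~R))))%:E =
   \int[leb]_x (win (x - t) * sqmod (f x))%:E)%E.
Proof.
move=> lf; pose G n := h1 (t, u + (zn n)%:~R).
have mwt : measurable_fun setT (fun x : R => win (x - t)).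
  by apply: (measurableT_comp (@measurable_win R)); exact: measurable_funB.
pose fD x := (win (x - t))%:C * f x.
have lfD : L2 leb fD.
  split; first by apply: cmeasM; [exact: cmeas_real|case: lf].
  apply: le_lt_trans lf.2; apply: ge0_le_integral => //.
  - by move=> x _; rewrite lee_fin sqmod_ge0.
  - by apply: cmeas_esqmod; apply: cmeasM; [exact: cmeas_real|case: lf].
  - by apply: cmeas_esqmod; case: lf.
  move=> x _; rewrite lee_fin /fD sqmodM ler_piMl ?sqmod_ge0//.
  by rewrite /sqmod /= expr0n addr0 expr2 win_sqr; case/andP: (win_bound (x - t)).
have LG n : L2 leb (G n) by exact: L2_h1.
have cfD n : cip leb fD (G n) = cip leb f (G n).
  apply: eq_cI => x; rewrite /fD /G /h1 /=.
  have := win_sqr (x - t); move: (win _) => a aa.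
  case: (f x) (expi _) => p q [r s]; apply: complexP => /=;
  rewrite -[in RHS]aa; ring.
have ortho i j : cip leb (G i) (G j) = (i == j)%:R.
  rewrite -(inj_eq (@zn_inj)) -subr_eq0 -(window_integral t).
  apply: eq_cI => x; rewrite /G /h1 /= /ek.
  have -> : 2 * pi * (zn i - zn j)%:~R * x =
      2 * pi * (u + (zn i)%:~R) * x + - (2 * pi * (u + (zn j)%:~R) * x).
    by rewrite intrB; ring.
  rewrite expiD expiN; have := win_sqr (x - t); move: (win _) => a aa.
  case: (expi _) (expi _) => p q [r s]; apply: complexP => /=;
  rewrite -[in RHS]aa; ring.
have total v : L2 leb v -> (forall k, cip leb v (G k) = 0) -> cip leb fD v = 0.
  move=> lv v0; apply: cI_ae_zero => //; [by case: lf|by case: lv|].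
  (* Undoing the modulation by [u] yields ordinary Fourier coefficients of a function supported in
     the window. *)
  pose H x := expi (- (2 * pi * u * x)) * ((win (x - t))%:C * v x).
  have mH : cmeas (fun x : R => expi (- (2 * pi * u * x))).
    by apply: cmeas_expi; apply: measurableT_comp => //; exact: measurable_funM.
  have wv : cintegrable leb (fun x => (win (x - t))%:C * v x).
    have := L2_cintegrable lv (L2_h1 (t, 0)).
    rewrite (_ : (fun x => v x * (h1 (t, 0) x)^*) = fun x => (win (x - t))%:C * v x)//.
    apply/funext => x; rewrite /h1 /= mulr0 mul0r expi0.
    by case: (v x) => p q; apply: complexP => /=; ring.
  have nH : null_coef t H.
    split.
    - apply: (cintegrable_bounded_mul (C := 1) wv mH) => x; first exact: cos_max.
      exact: sin_max.
    - move=> x; rewrite in_itv/= /H winE subr_gt0 ltrBlDl => /negbTE ->.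
      by rewrite mul0r mulr0.
    (* The index is [- k] because [cip] conjugates its second argument. *)
    - move=> k; have [n nk] := zn_surj (- k); rewrite -(v0 n); apply: eq_cI => x.
      rewrite /H /G /h1 /ek /= nk.
      have -> : 2 * pi * (u + (- k)%:~R) * x = 2 * pi * u * x + - (2 * pi * k%:~R * x).
        by rewrite intrN; ring.
      rewrite expiD !expiN.
      by case: (expi _) (expi _) (v x) => p q [r s] [y z]; apply: complexP => /=; ring.
  apply: ae_imp (trig_complete nH) => x Hx; apply: sqmod_eq0.
  by rewrite -[LHS]mul1r -(sqmod_expi (- (2 * pi * u * x))) -sqmodM -/(H x) Hx sqmod0.
have := parseval LG ortho lfD total; rewrite nrmE//.
under eq_eseriesr do rewrite cfD.
move=> ->; apply: eq_integral => x _; congr EFin.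
by rewrite /fD sqmodM /sqmod /= expr0n addr0 expr2 win_sqr.
Qed.

(** Integrating over frequencies at fixed t gives the energy of [f] in ]t, t + 1[; each point x then
    lies in these windows for a set of t of measure 1. *)
Theorem resolution_h1 : resolution (leb \x leb)%E leb (@h1 R).
Proof.
split; [exact: cmeas_h1|exact: L2_h1|move=> f lf].
have mip : cmeas (fun z : R * R => cip leb f (h1 z)).
  apply: (cmeas_cI_param leb (f := fun p : (R * R) * R => f p.2 * (h1 p.1 p.2)^*)).
  apply: cmeasM; last exact: (cmeas_conj (@cmeas_h1 R)).
  by apply: (cmeas_comp (L2_cmeas lf)); exact: measurable_snd.
rewrite fubini_tonelli1/= /fubini_F; last 2 first.
- exact: cmeas_esqmod.
- by move=> z; rewrite lee_fin sqmod_ge0.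
have inner t : (\int[leb]_w (sqmod (cip leb f (h1 (t, w))))%:E =
    \int[leb]_x (win (x - t) * sqmod (f x))%:E)%E.
  rewrite (integral_tile (f := fun w => (sqmod (cip leb f (h1 (t, w))))%:E)); last 2 first.
  - by apply: (measurable_slice1 t (h := fun z => (sqmod (cip leb f (h1 z)))%:E)); exact: cmeas_esqmod.
  - by move=> w; rewrite lee_fin sqmod_ge0.
  under eq_integral do rewrite (window_parseval _ _ lf).
  rewrite integral_cst//=.
  by rewrite /lebm lebesgue_measure_itv/= lte_fin ltr01 -EFinB subr0 mule1.
under eq_integral do rewrite inner.
have mw : measurable_fun setT (fun p : R * R => (win (p.2 - p.1) * sqmod (f p.2))%:E).
  apply/measurable_EFinP; apply: measurable_funM.
    apply: (measurableT_comp (@measurable_win R)).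
    by apply: measurable_funB; [exact: measurable_snd|exact: measurable_fst].
  by apply: (measurableT_comp (cmeas_sqmod (L2_cmeas lf))); exact: measurable_snd.
have w0 (p : R * R) : (0 <= (win (p.2 - p.1) * sqmod (f p.2))%:E)%E.
  by rewrite lee_fin mulr_ge0 ?sqmod_ge0//; case/andP: (win_bound (p.2 - p.1)).
transitivity (\int[leb]_x \int[leb]_t (win (x - t) * sqmod (f x))%:E)%E.
  exact: (@fubini_tonelli _ _ _ _ R leb leb
    (fun p : R * R => (win (p.2 - p.1) * sqmod (f p.2))%:E) mw w0).
apply: eq_integral => x _ /=.
under eq_integral do rewrite mulrC EFinM.
rewrite ge0_integralZl_EFin ?sqmod_ge0//; last 2 first.
- by move=> t _; rewrite lee_fin; case/andP: (win_bound (x - t)).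
- apply/measurable_EFinP; apply: (measurableT_comp (@measurable_win R)).
  by apply: measurable_funB.
rewrite -[RHS]mule1; congr (_ * _)%E.
rewrite -(integral_win (x - 1)); apply: eq_integral => t _; congr EFin.
rewrite !winE; suff -> : (0 < x - t < 1) = (0 < t - (x - 1) < 1) by [].
apply/idP/idP => /andP[? ?]; apply/andP; split; lra.
Qed.

End Moyal1.

(** * Lebesgue measure on R^m *)

Section Borel.
Context (R : realType).

(** Row vectors with the same sigma-algebra as [borel_rV], packaged as a measurable type. *)
Definition Tm (m : nat) : measurableType _ := g_sigma_algebraType (@open 'rV[R]_m).

Lemma continuous_measurable_Tm m (f : 'rV[R]_m -> R) : continuous f ->
  measurable_fun setT (f : Tm m -> R).
Proof.
move=> cf; apply: (measurability _ (RGenOpens.measurableE R)).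
move=> _ [_ [a [b ->]] <-]; rewrite setTI; apply: sub_sigma_algebra.
by apply: open_comp => // x _; exact: cf.
Qed.

Lemma measurable_coord m (i : 'I_m) : measurable_fun setT (fun v : Tm m => (v : 'rV_m) 0 i).
Proof.
apply: continuous_measurable_Tm => v; exact: coord_continuous.
Qed.

(* A countable base of boxes, so that measurability can be checked on coordinates. *)
Definition qbox m (q : 'rV[rat]_m * rat) : set 'rV[R]_m :=
  [set v | forall i, `|v 0 i - ratr (q.1 0 i)| < ratr q.2].

Lemma open_qbox m (U : set 'rV[R]_m) : open U ->
  U = \bigcup_(q in [set q | qbox q `<=` U]) qbox q.
Proof.
move=> oU; apply/seteqP; split=> [v Uv|v [q /= qU Hv]]; last exact: (qU _ Hv).
have /nbhs_ballP[e /= e0 eU] := open_nbhs_nbhs (conj oU Uv).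
have [r /andP[r0 re]] : exists r : rat, 0 < (ratr r : R) < e / 2.
  have /rat_in_itvoo[r rI] : 0 < e / 2 by rewrite divr_gt0.
  by exists r; rewrite in_itv in rI.
have /choice[c Hc] : forall i, exists c : rat, `|v 0 i - ratr c| < ratr r.
  move=> i; have /rat_in_itvoo[c] : v 0 i - ratr r < v 0 i + ratr r by lra.
  by rewrite in_itv /= => /andP[c1 c2]; exists c; rewrite ltr_norml; apply/andP; split; lra.
exists (\row_i c i, r); last by move=> i /=; rewrite mxE.
move=> w /= H; apply: eU; split=> // i j; rewrite ord1 /ball /=.
have := H j; have := Hc j; rewrite mxE; rewrite !ltr_norml => /andP[? ?] /andP[? ?].
by apply/andP; split; lra.
Qed.

Lemma measurable_bigcup_count d (X : measurableType d) (I : countType) (P : set I)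
    (F : I -> set X) : (forall i, measurable (F i)) -> measurable (\bigcup_(i in P) F i).
Proof.
move=> mF.
have -> : \bigcup_(i in P) F i =
    \bigcup_n (if unpickle n is Some i then if i \in P then F i else set0 else set0).
  apply/seteqP; split => x [i Pi Fi].
    by exists (pickle i) => //; rewrite pickleK mem_set.
  move: Fi; case: (unpickle i) => [j|//]; case: ifPn => // jP Fj.
  by exists j => //; rewrite inE in jP.
apply: bigcupT_measurable => n.
by case: (unpickle n) => [i|]; [case: ifP => _|].
Qed.

Lemma measurable_into_Tm d (X : measurableType d) m (p : X -> 'rV[R]_m) :
  (forall i, measurable_fun setT (fun x => p x 0 i)) -> measurable_fun setT (p : X -> Tm m).
Proof.
move=> mp; apply: (@measurability _ _ X (Tm m) setT p (@open 'rV[R]_m)); first by [].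
move=> _ [U oU <-].
rewrite setTI (open_qbox oU) preimage_bigcup; apply: measurable_bigcup_count => q.
have -> : p @^-1` qbox q =
    \bigcap_(i in [set: 'I_m]) [set x | `|p x 0 i - ratr (q.1 0 i)| < ratr q.2].
  by apply/seteqP; split => x /=; [move=> H i _; exact: H|move=> H i; exact: H].
apply: fin_bigcap_measurable => // i _.
have -> : [set x | `|p x 0 i - ratr (q.1 0 i)| < ratr q.2] =
    (fun x => p x 0 i) @^-1` `]ratr (q.1 0 i) - ratr q.2, ratr (q.1 0 i) + ratr q.2[.
  apply/seteqP; split => x /=; rewrite in_itv /= ltr_norml => /andP[? ?];
  by apply/andP; split; lra.
by rewrite -[X in measurable X]setTI; apply: mp => //; exact: measurable_itv.
Qed.

Local Notation CC := (R[i] : numClosedFieldType).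

Lemma continuous_re : continuous (fun z : CC => re z).
Proof.
move=> z; apply/(@cvgrPdist_lt _ _ _ (nbhs z) (nbhs_filter z)) => e e0.
apply/nbhs_ballP; exists e%:C => /=.
  by rewrite ltcR.
move=> w; rewrite -ball_normE /= => zw; rewrite -ltcR; apply: le_lt_trans zw.
by rewrite -re_opp -re_add; exact: normc_ge_Re.
Qed.

Lemma normc_ge_Im (z : R[i]) : `|im z|%:C <= `|z|.
Proof.
rewrite normc_def lecR -sqrtr_sqr ler_sqrt ?addr_ge0 ?sqr_ge0//.
by case: z => a b /=; rewrite lerDr sqr_ge0.
Qed.

Lemma continuous_im : continuous (fun z : CC => im z).
Proof.
move=> z; apply/(@cvgrPdist_lt _ _ _ (nbhs z) (nbhs_filter z)) => e e0.
apply/nbhs_ballP; exists e%:C => /=.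
  by rewrite ltcR.
move=> w; rewrite -ball_normE /= => zw; rewrite -ltcR; apply: le_lt_trans zw.
by rewrite -im_opp -im_add; exact: normc_ge_Im.
Qed.

Lemma normc_le (z : R[i]) : `|z| <= (`|re z| + `|im z|)%:C.
Proof.
rewrite normc_def lecR -[leRHS]ger0_norm ?addr_ge0// -sqrtr_sqr ler_sqrt ?sqr_ge0//.
rewrite sqrrD !real_normK ?num_real//; case: z => a b /=.
by rewrite addrAC lerDl mulrn_wge0// mulr_ge0.
Qed.

(** In the order of R[i] a positive element is real, so complex radii reduce to real ones. *)
Lemma gt0_CC (e : R[i]) : 0 < e -> e = (re e)%:C /\ 0 < re e.
Proof. by case: e => a b; rewrite ltcE /= => /andP[/eqP -> ->]. Qed.

Lemma continuous_pair_CC : continuous (fun v : 'rV[R]_2 => (v 0 0 +i* v 0 1) : CC).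
Proof.
move=> v; apply/(@cvgrPdist_lt _ _ _ (nbhs v) (nbhs_filter v)) => e /gt0_CC[-> e0].
near=> w; apply: le_lt_trans (normc_le _) _; rewrite ltcR /=.
have H : ball v (re e / 2) w by near: w; apply: nbhsx_ballx; rewrite divr_gt0.
by case: H => _ H; have := H 0 0; have := H 0 1; rewrite /ball /=; lra.
Unshelve. all: by end_near. Qed.

(** The pair of parts is read as a map into R^2, where open sets are countable unions of rational
    boxes. *)
Lemma cmeas_open_preimage d (X : measurableType d) (f : X -> R[i]) : cmeas f ->
  forall U : set CC, open U -> measurable (f @^-1` U).
Proof.
move=> [f1 f2] U oU.
pose p x : 'rV[R]_2 := \row_j (if j == 0 then re (f x) else im (f x)).
have mp : measurable_fun setT (p : X -> Tm 2).
  apply: measurable_into_Tm => i; have [->|i0] := eqVneq i 0.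
    by rewrite (_ : (fun x => _) = fun x => re (f x))//; apply/funext => x; rewrite mxE.
  by rewrite (_ : (fun x => _) = fun x => im (f x))//; apply/funext => x; rewrite mxE (negbTE i0).
have -> : f @^-1` U = p @^-1` [set v | U (v 0 0 +i* v 0 1)].
  by apply/funext => x; rewrite /preimage /= !mxE /=; case: (f x).
rewrite -[X in measurable X]setTI; apply: mp => //; apply: sub_sigma_algebra.
by apply: open_comp oU => v _; exact: continuous_pair_CC.
Qed.

Lemma measurable_rVP m (f : 'rV[R]_m -> R[i]) :
  measurable_rV f <-> cmeas (f : Tm m -> R[i]).
Proof.
split=> [mf|mf U oU]; last exact: (@cmeas_open_preimage _ (Tm m) f mf U oU).
split; apply: (measurability _ (RGenOpens.measurableE R));
  move=> _ [_ [a [b ->]] <-]; rewrite setTI.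
  apply: (mf [set z | `]a, b[%classic (re z)]).
  by apply: open_comp => // z _; exact: continuous_re.
apply: (mf [set z | `]a, b[%classic (im z)]).
by apply: open_comp => // z _; exact: continuous_im.
Qed.

End Borel.

Section LebesgueRm.
Context (R : realType).
Local Notation leb := (lebm R).

Definition rowf k (p : R * 'rV[R]_k) : 'rV[R]_k.+1 := row_mx (p.1%:M : 'rV_1) p.2.

Lemma rowf0 k (p : R * 'rV[R]_k) : rowf p 0 ord0 = p.1.
Proof.
have -> : ord0 = lshift k (ord0 : 'I_1) :> 'I_(1 + k) by apply/val_inj.
by apply: (etrans (@row_mxEl _ 1 1 k (p.1%:M) p.2 0 ord0)); rewrite mxE eqxx mulr1n.
Qed.

Lemma rowfS k (p : R * 'rV[R]_k) (i : 'I_k) : rowf p 0 (lift ord0 i) = p.2 0 i.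
Proof.
have -> : lift ord0 i = rshift 1 i :> 'I_(1 + k) by apply/val_inj.
exact: (@row_mxEr _ 1 1 k (p.1%:M) p.2 0 i).
Qed.

Lemma measurable_rowf k : measurable_fun setT (@rowf k : measurableTypeR R * Tm R k -> Tm R k.+1).
Proof.
apply: measurable_into_Tm => i; have [j ->|->] := unliftP ord0 i.
  under eq_fun do rewrite rowfS.
  exact: (measurableT_comp (@measurable_coord R k j) measurable_snd).
by under eq_fun do rewrite rowf0; exact: measurable_fst.
Qed.

Definition unrowf k (v : 'rV[R]_k.+1) : R * 'rV[R]_k := (v 0 ord0, \row_i v 0 (lift ord0 i)).

Lemma rowfK k : cancel (@rowf k) (@unrowf k).
Proof.
move=> [x v]; rewrite /unrowf rowf0; congr pair.
by apply/rowP => i; rewrite mxE rowfS.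
Qed.

Lemma unrowfK k : cancel (@unrowf k) (@rowf k).
Proof.
move=> v; apply/rowP => i; have [j ->|->] := unliftP ord0 i; last by rewrite rowf0.
by rewrite rowfS mxE.
Qed.

Lemma measurable_unrowf k :
  measurable_fun setT (@unrowf k : Tm R k.+1 -> measurableTypeR R * Tm R k).
Proof.
apply: measurable_fun_pair; first exact: measurable_coord.
by apply: measurable_into_Tm => i; under eq_fun do rewrite mxE; exact: measurable_coord.
Qed.

Definition consm k (mu : {sigma_finite_measure set (Tm R k) -> \bar R}) :
  set (Tm R k.+1) -> \bar R := pushm (sfprod leb mu) (@measurable_rowf k).

Section ConsSigmaFinite.
Context k (mu : {sigma_finite_measure set (Tm R k) -> \bar R}).

HB.instance Definition _ := Measure.copy (consm mu) (pushm (sfprod leb mu) (@measurable_rowf k)).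

Let consm_sigma_finite : sigma_finite setT (consm mu).
Proof.
have [F FT mF] := sigma_finiteT (sfprod leb mu).
exists (fun n => @unrowf k @^-1` F n); first by rewrite -preimage_bigcup -FT preimage_setT.
move=> n; have [mFn Fn] := mF n; split.
  by rewrite -[X in measurable X]setTI; exact: measurable_unrowf.
rewrite [ltLHS](_ : _ = sfprod leb mu (F n))//.
rewrite /consm /pushm /= /pushforward; congr (sfprod leb mu _).
by apply/funext => p; rewrite /preimage /= rowfK.
Qed.

HB.instance Definition _ :=
  Measure_isSigmaFinite.Build _ _ _ (consm mu) consm_sigma_finite.

End ConsSigmaFinite.

(** The unique point of R^0, carrying the Dirac mass with which the recursion for [muR] starts. *)
Definition point0 : Tm R 0 := (0 : 'rV[R]_0).

(** The recursion copies that of [iint_e] and [iint_r], so that both iterated integrals become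
    integrals against a single sigma-finite measure. *)
Fixpoint muR (m : nat) : {sigma_finite_measure set (Tm R m) -> \bar R} :=
  match m with
  | 0 => dirac point0
  | k.+1 => consm (muR k)
  end.

Lemma int_muRS k (F : Tm R k.+1 -> \bar R) : measurable_fun setT F -> (forall v, 0 <= F v)%E ->
  (\int[muR k.+1]_v F v = \int[leb]_x \int[muR k]_v F (rowf (x, v)))%E.
Proof.
move=> mF F0; have H : (\int[muR k.+1]_v F v =
    \int[pushm (sfprod leb (muR k)) (@measurable_rowf k)]_v F v)%E by [].
rewrite H ge0_integral_pushforward//; last exact: measurable_rowf.
rewrite ?preimage_setT.
have mFr : measurable_fun setT (F \o @rowf k : measurableTypeR R * Tm R k -> \bar R).
  exact: (measurableT_comp mF (@measurable_rowf k)).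
exact: (@fubini_tonelli1 _ _ _ _ R leb (muR k) (F \o @rowf k) mFr (fun p => F0 (rowf p))).
Qed.

Lemma int_muR0 (F : Tm R 0 -> \bar R) : measurable_fun setT F ->
  (\int[muR 0]_v F v = F point0)%E.
Proof. by move=> mF; rewrite integral_dirac// diracT mul1e. Qed.

Lemma measurable_rowf_slice k x : measurable_fun setT (fun v : Tm R k => rowf (x, v) : Tm R k.+1).
Proof. exact: (measurable_slice1 x (@measurable_rowf k)). Qed.

Lemma iint_eE m (F : Tm R m -> \bar R) : measurable_fun setT F -> (forall v, 0 <= F v)%E ->
  iint_e F = (\int[muR m]_v F v)%E.
Proof.
elim: m F => [|k IH] F mF F0; first by rewrite int_muR0.
rewrite int_muRS//=; apply: eq_integral => x _.
apply: (IH (fun v => F (rowf (x, v)))) => [|v]; last exact: F0.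
exact: (measurableT_comp mF (measurable_rowf_slice x)).
Qed.

(** Serves [iint_rE], where the inner iterated integrals agree with true integrals only for almost
    every first coordinate and must be compared as measurable functions. *)
Lemma measurable_iint_r d (X : measurableType d) m (G : X * Tm R m -> R) :
  measurable_fun setT G -> measurable_fun setT (fun x => iint_r (fun v => G (x, v))).
Proof.
elim: m d X G => [|k IH] d X G mG; first by exact: (measurable_slice2 point0 mG).
have mH : measurable_fun setT (fun p : X * measurableTypeR R =>
    iint_r (fun v => G (p.1, rowf (p.2, v)))).
  apply: (IH _ _ (fun q : (X * measurableTypeR R) * Tm R k => G (q.1.1, rowf (q.1.2, q.2)))).
  apply: (measurableT_comp mG); apply: measurable_fun_pair.
    exact: (measurableT_comp measurable_fst measurable_fst).
  apply: (measurableT_comp (@measurable_rowf k)); apply: measurable_fun_pair.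
    exact: (measurableT_comp measurable_snd measurable_fst).
  exact: measurable_snd.
exact: (measurable_Rintegral_param leb mH).
Qed.

Lemma integrable_rowf k (F : Tm R k.+1 -> R) : (muR k.+1).-integrable setT (EFin \o F) ->
  (sfprod leb (muR k)).-integrable setT (EFin \o (F \o @rowf k)).
Proof.
move=> iF; have mF : measurable_fun setT F by apply/measurable_EFinP; case/integrableP : iF.
pose Fr : measurableTypeR R * Tm R k -> R := F \o @rowf k.
have mFr : measurable_fun setT (EFin \o Fr).
  by apply/measurable_EFinP; exact: (measurableT_comp mF (@measurable_rowf k)).
apply/integrableP; split => //.
case/integrableP : iF => mEF; rewrite int_muRS//; last exact: measurableT_comp.
by rewrite (fubini_tonelli1 (fun p => `|(Fr p)%:E|%E))//; exact: measurableT_comp.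
Qed.

Lemma Rintegral_rowf k (F : Tm R k.+1 -> R) : (muR k.+1).-integrable setT (EFin \o F) ->
  \int[muR k.+1]_v F v = \int[sfprod leb (muR k)]_p F (rowf p).
Proof.
move=> iF; rewrite /Rintegral; congr fine.
apply: (@integral_pushforward _ _ _ _ R _ (@measurable_rowf k) (sfprod leb (muR k))
  setT (EFin \o F)) => //; last exact: integrable_rowf.
by case/integrableP : iF.
Qed.

Lemma iint_rE m (F : Tm R m -> R) : (muR m).-integrable setT (EFin \o F) ->
  iint_r F = \int[muR m]_v F v.
Proof.
elim: m F => [|k IH] F iF.
  by rewrite /Rintegral int_muR0//; case/integrableP : iF.
have mF : measurable_fun setT F by apply/measurable_EFinP; case/integrableP : iF.
pose Fr : measurableTypeR R * Tm R k -> R := F \o @rowf k.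
have iFr : (leb \x muR k)%E.-integrable setT (EFin \o Fr) := integrable_rowf iF.
rewrite Rintegral_rowf//; transitivity (\int[(leb \x muR k)%E]_z Fr z); last by [].
rewrite Rintegral12//=; congr fine; apply: ae_eq_integral => //.
- apply/measurable_EFinP.
  apply: (@measurable_iint_r _ (measurableTypeR R) k (fun p => F (rowf p))).
  exact: (measurableT_comp mF (@measurable_rowf k)).
- apply/measurable_EFinP; apply: (measurable_Rintegral_param (muR k)).
  exact: (measurableT_comp mF (@measurable_rowf k)).
apply: ae_imp (ae_integrable1 iFr) => x ix _.
by congr EFin; exact: IH.
Qed.

End LebesgueRm.

Section AffineRm.
Context (R : realType).
Local Notation leb := (lebm R).
Local Notation muR := (@muR R).

Lemma rowfE k x (v : 'rV[R]_k) (s : R) (c : 'rV[R]_k.+1) :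
  s *: rowf (x, v) + c = rowf (s * x + c 0 ord0, s *: v + \row_i c 0 (lift ord0 i)).
Proof.
apply/rowP => i; rewrite mxE [X in X + _]mxE; have [j ->|->] := unliftP ord0 i.
  by rewrite !rowfS !mxE.
by rewrite !rowf0.
Qed.

Lemma measurable_affine_Tm m (s : R) (c : 'rV[R]_m) :
  measurable_fun setT (fun v : Tm R m => (s *: (v : 'rV[R]_m) + c : Tm R m)).
Proof.
apply: measurable_into_Tm => i; under eq_fun do rewrite !mxE.
by apply: measurable_funD => //; apply: measurable_funM => //; exact: measurable_coord.
Qed.

Lemma measurable_int_slice k (F : Tm R k.+1 -> \bar R) : measurable_fun setT F ->
  (forall v, 0 <= F v)%E ->
  measurable_fun setT (fun x : measurableTypeR R => \int[muR k]_v F (rowf (x, v)))%E.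
Proof.
move=> mF F0.
apply: (@measurable_fun_fubini_tonelli_F _ _ (measurableTypeR R) (Tm R k) R (muR k)
  (fun p => F (rowf p))) => //.
exact: (measurableT_comp mF (@measurable_rowf R k)).
Qed.

Lemma integral_affine_Tm m (s : R) (c : 'rV[R]_m) (F : Tm R m -> \bar R) : 0 < s ->
  measurable_fun setT F -> (forall v, 0 <= F v)%E ->
  ((s ^+ m)%:E * \int[muR m]_v F (s *: (v : 'rV[R]_m) + c)%R = \int[muR m]_v F v)%E.
Proof.
move=> s0; elim: m c F => [|k IH] c F mF F0.
  rewrite !int_muR0//; last exact: (measurableT_comp mF (measurable_affine_Tm s c)).
  by rewrite expr0 mul1e; congr F; apply/rowP; case.
rewrite !int_muRS//; last first.
  exact: (measurableT_comp mF (measurable_affine_Tm s c)).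
under eq_integral => x _ do under eq_integral => v _ do rewrite rowfE.
rewrite exprS EFinM -muleA.
rewrite -(@integral_affine R s (c 0 ord0) s0 (fun x => \int[muR k]_v F (rowf (x, v)))%E); last 2 first.
- exact: measurable_int_slice.
- by move=> x; apply: integral_ge0.
congr (_ * _)%E; rewrite -ge0_integralZl_EFin ?exprn_ge0 ?(ltW s0)//; last 2 first.
- by move=> x _; apply: integral_ge0.
- have := measurable_int_slice (measurableT_comp mF (measurable_affine_Tm s c)) (fun=> F0 _).
  by congr (measurable_fun _ _); apply/funext => x; apply: eq_integral => v _; rewrite /= rowfE.
apply: eq_integral => x _.
rewrite (IH _ (fun v => F (rowf (s * x + c 0 ord0, v))))//.
exact: (measurableT_comp mF (@measurable_rowf_slice R k _)).
Qed.

Lemma integral_translate_Tm m (c : 'rV[R]_m) (F : Tm R m -> \bar R) :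
  measurable_fun setT F -> (forall v, 0 <= F v)%E ->
  (\int[muR m]_v F ((v : 'rV[R]_m) + c)%R = \int[muR m]_v F v)%E.
Proof.
move=> mF F0; rewrite -(@integral_affine_Tm m 1 c F ltr01 mF F0) expr1n mul1e.
by apply: eq_integral => v _; rewrite scale1r.
Qed.

Lemma row_mx_rowf a b x (t : 'rV[R]_a) (w : 'rV[R]_b) :
  row_mx (rowf (x, t)) w = rowf (x, row_mx t w) :> 'rV[R]_(a + b).+1.
Proof.
apply/rowP => i; have [j ->|->] := unliftP ord0 i; last first.
  have e : ord0 = lshift b (ord0 : 'I_a.+1) :> 'I_(a + b).+1 by apply/val_inj.
  rewrite rowf0 [in LHS]e; apply: (etrans (@row_mxEl _ 1 a.+1 b _ _ 0 ord0)).
  exact: rowf0.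
rewrite rowfS /=; case: (split_ordP j) => k ->.
  rewrite row_mxEl.
  have -> : lift ord0 (lshift b k) = lshift b (lift ord0 k) :> 'I_(a.+1 + b) by apply/val_inj.
  by apply: (etrans (@row_mxEl _ 1 a.+1 b _ _ 0 _)); rewrite rowfS.
rewrite row_mxEr.
have -> : lift ord0 (rshift a k) = rshift a.+1 k :> 'I_(a.+1 + b) by apply/val_inj.
exact: (@row_mxEr _ 1 a.+1 b).
Qed.

Lemma measurable_row_mx a b :
  measurable_fun setT (fun p : Tm R a * Tm R b => row_mx (p.1 : 'rV[R]_a) (p.2 : 'rV[R]_b) : Tm R (a + b)).
Proof.
apply: measurable_into_Tm => i; case: (split_ordP i) => j ->.
  under eq_fun do rewrite row_mxEl.
  exact: (measurableT_comp (@measurable_coord R a j) measurable_fst).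
under eq_fun do rewrite row_mxEr.
exact: (measurableT_comp (@measurable_coord R b j) measurable_snd).
Qed.

(** A phase-space point is one row vector of size m + m, whereas the resolution of the identity is
    indexed by pairs; this connects the two. *)
Lemma integral_split a b (F : Tm R (a + b) -> \bar R) : measurable_fun setT F ->
  (forall v, 0 <= F v)%E ->
  (\int[muR (a + b)]_v F v =
   \int[muR a]_t \int[muR b]_w F (row_mx (t : 'rV[R]_a) (w : 'rV[R]_b)))%E.
Proof.
elim: a F => [|a IH] F mF F0.
  rewrite int_muR0; last first.
    apply: (@measurable_fun_fubini_tonelli_F _ _ (Tm R 0) (Tm R b) R (muR b)
      (fun p => F (row_mx (p.1 : 'rV[R]_0) (p.2 : 'rV[R]_b)))) => //.
    exact: (measurableT_comp mF (@measurable_row_mx 0 b)).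
  apply: eq_integral => v _; congr F; apply/rowP => i.
  rewrite -[LHS](@row_mxEr _ 1 0 b (point0 R) v 0 i).
  by congr (row_mx _ _ _ _); apply/val_inj.
rewrite [in RHS]int_muRS; last 2 first.
- apply: (@measurable_fun_fubini_tonelli_F _ _ (Tm R a.+1) (Tm R b) R (muR b)
    (fun p => F (row_mx (p.1 : 'rV[R]_a.+1) (p.2 : 'rV[R]_b)))) => //.
  exact: (measurableT_comp mF (@measurable_row_mx a.+1 b)).
- by move=> v; apply: integral_ge0.
rewrite (@int_muRS R (a + b) F mF F0); apply: eq_integral => x _.
rewrite (IH (fun v => F (rowf (x, v)))) //; last first.
  exact: (measurableT_comp mF (@measurable_rowf_slice R _ x)).
by apply: eq_integral => t _; apply: eq_integral => w _; rewrite row_mx_rowf.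
Qed.

End AffineRm.

Section Swap4.
Context (R : realType) dA dB dC dD (A : measurableType dA) (B : measurableType dB)
  (C : measurableType dC) (D : measurableType dD)
  (a : {sigma_finite_measure set A -> \bar R}) (b : {sigma_finite_measure set B -> \bar R})
  (c : {sigma_finite_measure set C -> \bar R}) (d : {sigma_finite_measure set D -> \bar R}).

(** Tensoring orders phase space as (t1, w1), (t2, w2), whereas splitting rows orders it as (t1,
    t2), (w1, w2). *)
Lemma integral_swap4 (F : (A * B) * (C * D) -> \bar R) : measurable_fun setT F ->
  (forall p, 0 <= F p)%E ->
  (\int[a]_x \int[b]_y \int[c]_z \int[d]_w F ((x, y), (z, w)) =
   \int[sfprod (sfprod a c) (sfprod b d)]_p F ((p.1.1, p.2.1), (p.1.2, p.2.2)))%E.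
Proof.
move=> mF F0.
pose F' (p : (A * C) * (B * D)) := F ((p.1.1, p.2.1), (p.1.2, p.2.2)).
have mF' : measurable_fun setT F'.
  apply: (measurableT_comp mF).
  apply: measurable_fun_pair; apply: measurable_fun_pair.
  - exact: (measurableT_comp measurable_fst measurable_fst).
  - exact: (measurableT_comp measurable_fst measurable_snd).
  - exact: (measurableT_comp measurable_snd measurable_fst).
  - exact: (measurableT_comp measurable_snd measurable_snd).
have F'0 p : (0 <= F' p)%E by exact: F0.
transitivity (\int[sfprod a c]_q \int[sfprod b d]_r F' (q, r))%E; last first.
  by apply/esym; exact: (@fubini_tonelli1 _ _ _ _ R (sfprod a c) (sfprod b d) F' mF' F'0).
have mG : measurable_fun setT (fun q => \int[sfprod b d]_r F' (q, r))%E.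
  exact: (@measurable_fun_fubini_tonelli_F _ _ _ _ R (sfprod b d) F').
have G0 q : (0 <= \int[sfprod b d]_r F' (q, r))%E by apply: integral_ge0.
transitivity (\int[a]_x \int[c]_z \int[sfprod b d]_r F' ((x, z), r))%E; last first.
  by apply/esym; exact: (@fubini_tonelli1 _ _ _ _ R a c _ mG G0).
apply: eq_integral => x _.
have mX : measurable_fun setT (fun p : B * (C * D) => F ((x, p.1), p.2)).
  apply: (measurableT_comp mF); apply: measurable_fun_pair; last exact: measurable_snd.
  by apply: measurable_fun_pair => //; exact: measurable_fst.
have mY : measurable_fun setT (fun q : (B * C) * D => F ((x, q.1.1), (q.1.2, q.2))).
  apply: (measurableT_comp mF); apply: measurable_fun_pair; apply: measurable_fun_pair => //.
  - exact: (measurableT_comp measurable_fst measurable_fst).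
  - exact: (measurableT_comp measurable_snd measurable_fst).
have mYD : measurable_fun setT (fun q : B * C => \int[d]_w F ((x, q.1), (q.2, w)))%E.
  exact: (@measurable_fun_fubini_tonelli_F _ _ _ _ R d
    (fun q : (B * C) * D => F ((x, q.1.1), (q.1.2, q.2)))).
have YD0 (q : B * C) : (0 <= \int[d]_w F ((x, q.1), (q.2, w)))%E by apply: integral_ge0.
transitivity (\int[c]_z \int[b]_y \int[d]_w F ((x, y), (z, w)))%E.
  exact: (@fubini_tonelli _ _ _ _ R b c (fun q : B * C => \int[d]_w F ((x, q.1), (q.2, w)))%E).
apply: eq_integral => z _; apply/esym.
have mZ : measurable_fun setT (fun r : B * D => F' ((x, z), r)).
  exact: (measurable_slice1 (x, z) mF').
exact: (@fubini_tonelli1 _ _ _ _ R b d (fun r : B * D => F' ((x, z), r)) mZ).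
Qed.

End Swap4.

(** * Resolution of the identity by cube windows *)

Section Moyal.
Context (R : realType).
Local Notation leb := (lebm R).
Local Notation muR := (@muR R).
Local Notation Tm := (Tm R).

Definition hm m (z : 'rV[R]_m * 'rV[R]_m) (x : 'rV[R]_m) : R[i] :=
  expi (2 * pi * dotR z.2 x) * (\prod_(i < m) win (x 0 i - z.1 0 i))%:C.

Lemma hm0 z x : hm (m := 0) z x = 1.
Proof. by rewrite /hm /dotR !big_ord0 mulr0 expi0 mulr1. Qed.

Lemma hm_rowf k (t w x : R * 'rV[R]_k) :
  hm (rowf t, rowf w) (rowf x) = h1 (t.1, w.1) x.1 * hm (t.2, w.2) x.2.
Proof.
rewrite /hm /h1 /dotR /= !big_ord_recl !rowf0 rmorphM /=.
have -> : \sum_(i < k) rowf w 0 (lift ord0 i) * rowf x 0 (lift ord0 i) =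
    \sum_(i < k) w.2 0 i * x.2 0 i by apply: eq_bigr => i _; rewrite !rowfS.
have -> : \prod_(i < k) win (rowf x 0 (lift ord0 i) - rowf t 0 (lift ord0 i)) =
    \prod_(i < k) win (x.2 0 i - t.2 0 i) by apply: eq_bigr => i _; rewrite !rowfS.
by rewrite mulrDr expiD [2 * pi * (w.1 * _)]mulrA; ring.
Qed.

Lemma cmeas_hm m : cmeas (fun p : (Tm m * Tm m) * Tm m => hm p.1 p.2).
Proof.
have mc (i : 'I_m) : measurable_fun setT (fun p : (Tm m * Tm m) * Tm m => (p.2 : 'rV[R]_m) 0 i).
  exact: (measurableT_comp (@measurable_coord R m i) measurable_snd).
have mt (i : 'I_m) : measurable_fun setT (fun p : (Tm m * Tm m) * Tm m => (p.1.1 : 'rV[R]_m) 0 i).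
  apply: (measurableT_comp (@measurable_coord R m i)).
  exact: (measurableT_comp measurable_fst measurable_fst).
have mw (i : 'I_m) : measurable_fun setT (fun p : (Tm m * Tm m) * Tm m => (p.1.2 : 'rV[R]_m) 0 i).
  apply: (measurableT_comp (@measurable_coord R m i)).
  exact: (measurableT_comp measurable_snd measurable_fst).
apply: cmeasM.
  apply: cmeas_expi; apply: measurable_funM => //.
  by apply: measurable_sum => i; apply: measurable_funM.
apply: cmeas_real; apply: measurable_prod => i _.
by apply: (measurableT_comp (@measurable_win R)); exact: measurable_funB.
Qed.

Lemma cmeas_hm_slice m (z : Tm m * Tm m) : cmeas (hm z : Tm m -> R[i]).
Proof.
exact: (@cmeas_slice1 _ _ (Tm m * Tm m)%type (Tm m) R (fun p => hm p.1 p.2) z (@cmeas_hm m)).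
Qed.

Lemma cI_rowf k (f : Tm k.+1 -> R[i]) : cintegrable (muR k.+1) f ->
  cI (muR k.+1) f = cI (sfprod leb (muR k)) (fun p => f (rowf p)).
Proof.
by move=> [f1 f2]; apply: complexP; [exact: (Rintegral_rowf f1)|exact: (Rintegral_rowf f2)].
Qed.

Lemma cmeas_rowf k (f : Tm k.+1 -> R[i]) : cmeas f ->
  cmeas (fun p : measurableTypeR R * Tm k => f (rowf p)).
Proof. by move=> mf; apply: (cmeas_comp mf); exact: measurable_rowf. Qed.

Lemma int_sqmod_rowf k (f : Tm k.+1 -> R[i]) : cmeas f ->
  (\int[muR k.+1]_x (sqmod (f x))%:E =
   \int[sfprod leb (muR k)]_p (sqmod (f (rowf p)))%:E)%E.
Proof.
move=> mf; rewrite int_muRS; last 2 first.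
- exact: cmeas_esqmod.
- by move=> v; rewrite lee_fin sqmod_ge0.
apply/esym; apply: (@fubini_tonelli1 _ _ _ _ R leb (muR k) (fun p => (sqmod (f (rowf p)))%:E)).
  exact/cmeas_esqmod/cmeas_rowf.
by move=> p; rewrite lee_fin sqmod_ge0.
Qed.

Lemma L2_rowf k (f : Tm k.+1 -> R[i]) : cmeas f ->
  L2 (sfprod leb (muR k)) (fun p => f (rowf p)) <-> L2 (muR k.+1) f.
Proof.
move=> mf; split=> -[_ lf]; split => //; first by rewrite int_sqmod_rowf.
  exact: cmeas_rowf.
by rewrite -int_sqmod_rowf.
Qed.

(** Induction on the dimension: splitting off one coordinate factors [hm] into [h1] times a
    lower-dimensional [hm]. In dimension 0 everything is evaluation at a point. *)
Theorem resolution_hm m : resolution (sfprod (muR m) (muR m)) (muR m) (@hm m).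
Proof.
elim: m => [|k IH].
  split; first exact: cmeas_hm.
    move=> z; split; first exact: (cmeas_hm_slice z).
    rewrite int_muR0; first exact: ltry.
    exact: (cmeas_esqmod (cmeas_hm_slice z)).
  move=> f lf; have mf := L2_cmeas lf.
  have E z : cip (muR 0) f (hm z) = f (point0 R).
    have [m1 m2] : cmeas (fun x : Tm 0 => f x * (hm z x)^*).
      by apply: cmeasM => //; apply: cmeas_conj; exact: (cmeas_hm_slice z).
    apply: complexP; rewrite /= /Rintegral int_muR0 /=; try exact/measurable_EFinP;
    by rewrite hm0; case: (f _) => a b /=; ring.
  under eq_integral do rewrite E.
  rewrite int_muR0; last exact: cmeas_esqmod.
  transitivity (\int[muR 0]_x \int[muR 0]_y (sqmod (f (point0 R)))%:E)%E.
    apply: (@fubini_tonelli1 _ _ _ _ R (muR 0) (muR 0) (fun=> (sqmod (f (point0 R)))%:E)) => //.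
    by move=> p; rewrite lee_fin sqmod_ge0.
  by rewrite !int_muR0.
have h1R : resolution (sfprod leb leb) leb (@h1 R) := @resolution_h1 R.
have [mT LT rT] := resolution_tensor h1R IH.
have Lh z : L2 (muR k.+1) (hm z).
  have mh : cmeas (hm z : Tm k.+1 -> R[i]) := cmeas_hm_slice z.
  apply/(L2_rowf mh); case: z {mh} => t w.
  have := LT (((unrowf t).1, (unrowf w).1), ((unrowf t).2, (unrowf w).2)).
  suff -> : (fun p => hm (t, w) (rowf p)) = fun p => h1 ((unrowf t).1, (unrowf w).1) p.1 *
      hm ((unrowf t).2, (unrowf w).2) p.2 by [].
  by apply/funext => p; rewrite -hm_rowf !unrowfK.
split=> //; first exact: cmeas_hm.
move=> f lf; have mf := L2_cmeas lf.
have lfr := (L2_rowf mf).2 lf.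
have mip : cmeas (fun z : Tm k.+1 * Tm k.+1 => cip (muR k.+1) f (hm z)).
  apply: (@cmeas_cI_param _ _ (Tm k.+1 * Tm k.+1)%type (Tm k.+1) R (muR k.+1)
    (fun p => f p.2 * (hm p.1 p.2)^*)).
  apply: cmeasM; last exact: (cmeas_conj (@cmeas_hm k.+1)).
  by apply: (cmeas_comp mf); exact: measurable_snd.
pose Phi (z : Tm k.+1 * Tm k.+1) := (sqmod (cip (muR k.+1) f (hm z)))%:E.
have mPhi : measurable_fun setT Phi by exact: cmeas_esqmod.
have Phi0 z : (0 <= Phi z)%E by rewrite lee_fin sqmod_ge0.
rewrite int_sqmod_rowf// -(rT _ lfr).
transitivity (\int[muR k.+1]_t \int[muR k.+1]_w Phi (t, w))%E.
  exact: (@fubini_tonelli1 _ _ _ _ R (muR k.+1) (muR k.+1) Phi).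
rewrite int_muRS; last 2 first.
- exact: (@measurable_fun_fubini_tonelli_F _ _ _ _ R (muR k.+1) Phi).
- by move=> t; apply: integral_ge0.
pose F (p : (measurableTypeR R * Tm k) * (measurableTypeR R * Tm k)) := Phi (rowf p.1, rowf p.2).
have mF : measurable_fun setT F.
  apply: (measurableT_comp mPhi); apply: measurable_fun_pair.
    exact: (measurableT_comp (@measurable_rowf R k) measurable_fst).
  exact: (measurableT_comp (@measurable_rowf R k) measurable_snd).
transitivity (\int[leb]_x \int[muR k]_y \int[leb]_z \int[muR k]_w F ((x, y), (z, w)))%E.
  apply: eq_integral => x _; apply: eq_integral => v _.
  apply: (@int_muRS R k (fun w => Phi (rowf (x, v), w))) => //.
  exact: (@measurable_slice1 _ _ (Tm k.+1) (Tm k.+1) _ _ Phi (rowf (x, v)) mPhi).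
rewrite (@integral_swap4 R _ _ _ _ _ _ _ _ leb (muR k) leb (muR k) F)//; last by move=> p; exact: Phi0.
apply: eq_integral => p _; rewrite /F /Phi /=; congr (sqmod _)%:E.
rewrite /cip cI_rowf; last exact: L2_cintegrable.
by apply: eq_cI => q; rewrite hm_rowf.
Qed.

End Moyal.

(** * Moyal's identity and covariance *)

Section PhaseSpace.
Context (R : realType).
Local Notation leb := (lebm R).
Local Notation muR := (@muR R).
Local Notation Tm := (Tm R).

Lemma int_sqmod_hm m (z : Tm m * Tm m) : (\int[muR m]_x (sqmod (hm z x))%:E = 1)%E.
Proof.
elim: m z => [|k IH] [t w].
  rewrite int_muR0; last exact: (cmeas_esqmod (cmeas_hm_slice (t, w))).
  by rewrite hm0 /sqmod /= expr0n expr1n addr0.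
rewrite int_sqmod_rowf; last exact: (cmeas_hm_slice (t, w)).
pose z1 := ((unrowf t).1, (unrowf w).1); pose z2 := ((unrowf t).2, (unrowf w).2) : Tm k * Tm k.
transitivity (\int[(leb \x muR k)%E]_p (sqmod (h1 z1 p.1 * hm z2 p.2))%:E)%E.
  by apply: eq_integral => p _; rewrite -hm_rowf !unrowfK.
rewrite (@int_sqmod_tensor R _ _ _ _ leb (muR k) (h1 z1) (hm z2 : Tm k -> R[i])).
- rewrite IH mule1; under eq_integral do rewrite sqmod_h1.
  exact: integral_win.
- exact: (cmeas_slice1 z1 (@cmeas_h1 R)).
- exact: cmeas_hm_slice.
Qed.

Lemma L2_hm m (z : Tm m * Tm m) : L2 (muR m) (hm z : Tm m -> R[i]).
Proof. by split; [exact: cmeas_hm_slice|rewrite int_sqmod_hm ltry]. Qed.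

Lemma nrm_hm m (z : Tm m * Tm m) : nrm (muR m) (hm z : Tm m -> R[i]) = 1.
Proof.
have := int_sqmod_hm z; rewrite -nrmE; last exact: L2_hm.
by case.
Qed.

Lemma Rintegral_translate m (c : 'rV[R]_m) (f : Tm m -> R) : measurable_fun setT f ->
  \int[muR m]_x f ((x : 'rV[R]_m) + c) = \int[muR m]_x f x.
Proof.
move=> mf; have mf' : measurable_fun setT (EFin \o f) by exact/measurable_EFinP.
rewrite /Rintegral integralE [in RHS]integralE; congr (fine (_ - _)).
  have := @integral_translate_Tm R m c _ (measurable_funepos mf') (fun x => funepos_ge0 (EFin \o f) x).
  by move=> <-; apply: eq_integral => x _; rewrite !funeposE.
have := @integral_translate_Tm R m c _ (measurable_funeneg mf') (fun x => funeneg_ge0 (EFin \o f) x).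
by move=> <-; apply: eq_integral => x _; rewrite !funenegE.
Qed.

Lemma cI_translate m (c : 'rV[R]_m) (f : Tm m -> R[i]) : cmeas f ->
  cI (muR m) (fun x => f ((x : 'rV[R]_m) + c)) = cI (muR m) f.
Proof.
by move=> [f1 f2]; apply: complexP; [exact: (Rintegral_translate c f1)|exact: (Rintegral_translate c f2)].
Qed.

Lemma measurable_shift m (c : 'rV[R]_m) :
  measurable_fun setT (fun x : Tm m => ((x : 'rV[R]_m) + c : Tm m)).
Proof.
have := measurable_affine_Tm 1 c; rewrite (_ : (fun v => _) = fun x => x + c)//.
by apply/funext => v; rewrite scale1r.
Qed.

Definition Hz m (z : 'rV[R]_(m + m)) : 'rV[R]_m -> R[i] := hm (lsubmx z, rsubmx z).

Lemma measurable_split m :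
  measurable_fun setT (fun z : Tm (m + m) => (lsubmx z, rsubmx z) : Tm m * Tm m).
Proof.
apply: measurable_fun_pair; apply: measurable_into_Tm => i; under eq_fun do rewrite mxE;
exact: measurable_coord.
Qed.

Lemma cmeas_cip_Hz m (f : Tm m -> R[i]) : cmeas f ->
  cmeas (fun z : Tm (m + m) => cip (muR m) f (Hz z)).
Proof.
move=> mf; apply: (@cmeas_comp R _ _ (Tm m * Tm m)%type (Tm (m + m))
    (fun z => cip (muR m) f (hm z)) (fun z => (lsubmx z, rsubmx z))); last exact: measurable_split.
apply: (@cmeas_cI_param _ _ (Tm m * Tm m)%type (Tm m) R (muR m)
    (fun p => f p.2 * (hm p.1 p.2)^*)).
apply: cmeasM; last exact: (cmeas_conj (@cmeas_hm R m)).
by apply: (cmeas_comp mf); exact: measurable_snd.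
Qed.

Theorem moyal m (f : Tm m -> R[i]) : L2 (muR m) f ->
  (\int[muR (m + m)]_z (sqmod (cip (muR m) f (Hz z)))%:E = \int[muR m]_x (sqmod (f x))%:E)%E.
Proof.
move=> lf; have [_ _ rH] := resolution_hm R m; rewrite -rH//.
have mip : measurable_fun setT (fun z : Tm m * Tm m => (sqmod (cip (muR m) f (hm z)))%:E).
  apply: cmeas_esqmod; apply: (@cmeas_cI_param _ _ (Tm m * Tm m)%type (Tm m) R (muR m)
    (fun p => f p.2 * (hm p.1 p.2)^*)).
  apply: cmeasM; last exact: (cmeas_conj (@cmeas_hm R m)).
  by apply: (cmeas_comp (L2_cmeas lf)); exact: measurable_snd.
rewrite integral_split; last 2 first.
- exact/cmeas_esqmod/cmeas_cip_Hz/(L2_cmeas lf).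
- by move=> z; rewrite lee_fin sqmod_ge0.
transitivity (\int[muR m]_t \int[muR m]_w (sqmod (cip (muR m) f (hm (t, w))))%:E)%E.
  apply: eq_integral => t _; apply: eq_integral => w _.
  by rewrite /Hz row_mxKl row_mxKr.
apply/esym; apply: (@fubini_tonelli1 _ _ _ _ R (muR m) (muR m)
  (fun z => (sqmod (cip (muR m) f (hm z)))%:E)) => // z.
by rewrite lee_fin sqmod_ge0.
Qed.

Section Gabor.
Context (m : nat) (g : 'rV[R]_m -> R[i]) (lam : nat -> 'rV[R]_(m + m)) (phi : nat -> R).
Hypothesis Lg : L2 (muR m) g.
Local Notation G := (gabor g lam phi).

Lemma measurable_dotR (w : 'rV[R]_m) : measurable_fun setT (fun x : Tm m => dotR w x).
Proof.
apply: measurable_sum => i; apply: measurable_funM => //; exact: measurable_coord.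
Qed.

Lemma dotRD (w x y : 'rV[R]_m) : dotR w (x + y) = dotR w x + dotR w y.
Proof. by rewrite /dotR -big_split; apply: eq_bigr => i _; rewrite mxE mulrDr. Qed.

Lemma dotRBl (w x y : 'rV[R]_m) : dotR (w - x) y = dotR w y - dotR x y.
Proof. by rewrite /dotR -sumrB; apply: eq_bigr => i _; rewrite !mxE mulrBl. Qed.

Lemma cmeas_gabor k : cmeas (G k : Tm m -> R[i]).
Proof.
apply: cmeasM.
  apply: cmeasM; first exact: cmeas_cst.
  by apply: cmeas_expi; apply: measurable_funM => //; exact: measurable_dotR.
by apply: (cmeas_comp (L2_cmeas Lg)); exact: measurable_shift.
Qed.

Lemma int_sqmod_gabor k :
  (\int[muR m]_x (sqmod (G k x))%:E = \int[muR m]_x (sqmod (g x))%:E)%E.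
Proof.
have E x : sqmod (G k x) = sqmod (g (x - lsubmx (lam k))).
  by rewrite /gabor !sqmodM !sqmod_expi !mul1r.
under eq_integral do rewrite E.
apply: (@integral_translate_Tm R m (- lsubmx (lam k)) (fun x => (sqmod (g x))%:E)).
  exact: (cmeas_esqmod (L2_cmeas Lg)).
by move=> x; rewrite lee_fin sqmod_ge0.
Qed.

Lemma L2_gabor k : L2 (muR m) (G k : Tm m -> R[i]).
Proof. by split; [exact: cmeas_gabor|rewrite int_sqmod_gabor; case: Lg]. Qed.

Lemma nrm_gabor k : nrm (muR m) (G k : Tm m -> R[i]) = nrm (muR m) g.
Proof.
have := int_sqmod_gabor k; rewrite -!nrmE//; last exact: L2_gabor.
by case.
Qed.

(** Translating the integration variable by the time part of [lam k] moves the shift onto [Hz], up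
    to the unimodular factor [c]. *)
Lemma gabor_covariance k z :
  sqmod (cip (muR m) (G k) (Hz z)) = sqmod (cip (muR m) g (Hz (z - lam k))).
Proof.
pose a := lsubmx (lam k); pose b := rsubmx (lam k).
pose t := lsubmx z; pose w := rsubmx z.
pose c := expi (phi k) * expi (2 * pi * dotR (b - w) a).
suff -> : cip (muR m) (G k) (Hz z) = c * cip (muR m) g (Hz (z - lam k)).
  by rewrite sqmodM /c sqmodM !sqmod_expi !mul1r.
have Lz (z' : 'rV[R]_(m + m)) : L2 (muR m) (Hz z' : Tm m -> R[i]) by exact: L2_hm.
rewrite -cipZ; [|exact: Lg|exact: Lz].
rewrite /cip -(@cI_translate m a); last first.
  by apply: cmeasM; [exact: cmeas_gabor|exact/cmeas_conj/L2_cmeas/Lz].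
apply: eq_cI => x; rewrite /gabor /Hz /hm /= -/a -/b -/t -/w addrK.
have -> : lsubmx (z - lam k) = t - a by apply/rowP => i; rewrite !mxE.
have -> : rsubmx (z - lam k) = w - b by apply/rowP => i; rewrite !mxE.
have -> : \prod_(i < m) win ((x + a) 0 i - t 0 i) = \prod_(i < m) win (x 0 i - (t - a) 0 i).
  by apply: eq_bigr => i _; congr win; rewrite !mxE; ring.
have eB (u v : R) : 2 * pi * (u - v) = 2 * pi * u + - (2 * pi * v) :> R by ring.
rewrite /c !dotRBl !dotRD !eB // ![2 * pi * (_ + _)]mulrDr !expiD !expiN.
move: (\prod_(i < m) _) => W.
move: (expi (phi k)) (g x) => e1 e2.
move: (expi (2 * pi * dotR b x)) (expi (2 * pi * dotR b a)) => B1 B2.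
move: (expi (2 * pi * dotR w x)) (expi (2 * pi * dotR w a)) => W1 W2.
have cB (y : R[i]) : Num.conj (Num.conj y) = y by exact: conjcK.
have -> : conjc B1 = Num.conj B1 by [].
have -> : conjc W2 = Num.conj W2 by [].
rewrite !rmorphM /= !cB; ring.
Qed.

End Gabor.
End PhaseSpace.

(** * The cubes MQ_n(O) *)

Section Cubes.
Context (R : realType) (d : nat) (M : 'M[R]_d).
Hypothesis uM : M \in unitmx.
Local Notation muR := (@muR R).
Local Notation T := (Tm R d).

(** A coordinate of M^-1 v, in which the sets [MQ M O n] are sup-norm balls. *)
Definition mcoord (v : 'rV[R]_d) (i : 'I_d) : R := \sum_j invmx M i j * v 0 j.

Lemma mcoordD v w i : mcoord (v + w) i = mcoord v i + mcoord w i.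
Proof. by rewrite -big_split; apply: eq_bigr => j _; rewrite mxE mulrDr. Qed.

Lemma mcoordZ s v i : mcoord (s *: v) i = s * mcoord v i.
Proof. by rewrite /mcoord mulr_sumr; apply: eq_bigr => j _; rewrite mxE mulrCA. Qed.

Lemma mcoord_image (y : 'rV[R]_d) i : mcoord (M *m y^T)^T i = y 0 i.
Proof.
transitivity ((invmx M *m (M *m y^T)) i 0).
  by rewrite mxE; apply: eq_bigr => j _; rewrite mxE.
by rewrite mulKmx// mxE.
Qed.

Lemma MQP O n v : MQ M O n v <-> forall i, `|mcoord v i - O 0 i| <= n%:R / 2.
Proof.
split=> [[y Qy <-] i|h]; first by rewrite mcoord_image; exact: Qy.
exists (invmx M *m v^T)^T; last by rewrite trmxK mulKVmx// trmxK.
move=> i; have := h i; congr (`|_ - _| <= _).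
by rewrite !mxE; apply: eq_bigr => j _; rewrite mxE.
Qed.

Lemma measurable_MQ O n : measurable (MQ M O n : set T).
Proof.
have -> : MQ M O n = \bigcap_(i in [set: 'I_d])
    [set v : T | `|mcoord v i - O 0 i| <= n%:R / 2].
  by apply/seteqP; split => v; [move/MQP => h i _; exact: h|move=> h; apply/MQP => i; exact: h].
apply: fin_bigcap_measurable => // i _.
rewrite -[X in measurable X]setTI; apply: (@measurable_fun_le _ T R setT) => //.
apply: measurableT_comp => //; apply: measurable_funB => //.
apply: measurable_sum => j; apply: measurable_funM => //; exact: measurable_coord.
Qed.

(** Triangle inequality for the norm whose balls are the sets [MQ M 0 r]; together with [MQ_opp] it
    carries the geometry near the boundary. *)
Lemma MQ_add O n r v w : MQ M O n v -> MQ M 0 r w -> MQ M O (n + r) (v + w).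
Proof.
move=> /MQP hv /MQP hw; apply/MQP => i; rewrite mcoordD natrD mulrDl.
have := hw i; rewrite mxE subr0 addrAC => wi.
by rewrite (le_trans (ler_normD _ _))// lerD.
Qed.

Lemma MQ_opp r w : MQ M 0 r w -> MQ M 0 r (- w).
Proof.
move=> /MQP hw; apply/MQP => i; have := hw i.
by rewrite -(scaleN1r w) mcoordZ !mxE !subr0 mulN1r normrN.
Qed.

Lemma MQ_le O n r v : (n <= r)%N -> MQ M O n v -> MQ M O r v.
Proof.
move=> nr /MQP hv; apply/MQP => i; apply: le_trans (hv i) _.
by rewrite ler_pM2r ?invr_gt0// ler_nat.
Qed.

Lemma MQ_exhaust v : exists r0, forall r, (r0 <= r)%N -> MQ M 0 r v.
Proof.
have [r0 hr] : exists r0 : nat, 2 * (\sum_i `|mcoord v i|) <= r0%:R.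
  by exists (Num.bound (2 * (\sum_i `|mcoord v i|))); rewrite ltW// archi_boundP// mulr_ge0// sumr_ge0.
exists r0 => r r0r; apply: (MQ_le r0r); apply/MQP => i; rewrite mxE subr0.
rewrite ler_pdivlMr// mulrC (le_trans _ hr)// ler_pM2l//.
by rewrite (bigD1 i)//= lerDl sumr_ge0.
Qed.

Lemma int_prod_win : (\int[muR d]_x (\prod_(i < d) win ((x : 'rV[R]_d) 0 i))%:E = 1)%E.
Proof.
rewrite -[RHS](@int_sqmod_hm R d (0, 0)); apply: eq_integral => x _; congr _%:E.
rewrite /hm sqmodM sqmod_expi mul1r /sqmod /= expr0n addr0 expr2 -big_split.
by apply: eq_bigr => i _; rewrite /= mxE subr0 win_sqr.
Qed.

Lemma measurable_eindic (S : set T) : measurable S ->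
  measurable_fun setT (fun x : T => ((\1_S x : R)%:E)).
Proof. by move=> mS; apply/measurable_EFinP; exact: measurable_indic. Qed.

Lemma measure_indic (S : set T) : measurable S -> (\int[muR d]_x (\1_S x : R)%:E = muR d S)%E.
Proof. by move=> mS; rewrite integral_indic// setIT. Qed.

Lemma measure_affine (S : set T) (s : R) (c : 'rV[R]_d) : 0 < s -> measurable S ->
  ((s ^+ d)%:E * \int[muR d]_v (\1_S (s *: (v : 'rV[R]_d) + c) : R)%:E = muR d S)%E.
Proof.
move=> s0 mS; rewrite -(measure_indic mS).
apply: (@integral_affine_Tm R d s c (fun v => (\1_S v : R)%:E)) => //.
exact: measurable_eindic.
Qed.

Lemma measurable_prod_win :
  measurable_fun setT (fun x : T => (\prod_(i < d) win ((x : 'rV[R]_d) 0 i))%:E).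
Proof.
apply/measurable_EFinP; apply: measurable_prod => i _.
apply: (measurableT_comp (@measurable_win R)); exact: measurable_coord.
Qed.

Lemma prod_win_le (x : 'rV[R]_d) (S : set T) (y : T) :
  ((forall i, 0 < x 0 i < 1) -> S y) -> \prod_(i < d) win (x 0 i) <= \1_S y.
Proof.
move=> h; have [x01|] := pselect (forall i, 0 < x 0 i < 1).
  rewrite [leRHS]indicE mem_set; last exact: h. rewrite big1// => i _.
  by rewrite winE x01.
move=> /existsNP[i /negP/negbTE xi]; rewrite (bigD1 i)//= winE xi mul0r.
by rewrite indicE; case: (_ \in _).
Qed.

(** [K] bounds the coordinates [mcoord] on the unit cube, so shrinking that cube by the factor 2 (K
    + 1) puts it inside the set. *)
Lemma measure_unit_MQ_gt0 : (0 < muR d (MQ M 0 1))%E.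
Proof.
pose K := \sum_i \sum_j `|invmx M i j|.
have K0 : 0 <= K by apply: sumr_ge0 => i _; apply: sumr_ge0.
have s0 : 0 < (2 * (K + 1))^-1 by rewrite invr_gt0 mulr_gt0// ltr_wpDl.
rewrite -(measure_affine 0 s0 (measurable_MQ 0 1)).
rewrite mule_gt0// ?lte_fin ?exprn_gt0//.
apply: (@lt_le_trans _ _ 1%E) => //; rewrite -int_prod_win.
apply: ge0_le_integral => //.
- by move=> x _; rewrite lee_fin prodr_ge0// => i _; have /andP[] := win_bound (x 0 i).
- exact: measurable_prod_win.
- apply: (measurableT_comp (measurable_eindic (measurable_MQ 0 1))).
  exact: measurable_affine_Tm.
move=> x _; rewrite lee_fin; apply: prod_win_le => x01; apply/MQP => i.
have xi : `|mcoord x i| <= K.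
  apply: (le_trans (ler_norm_sum _ _ _)); rewrite /K [leRHS](bigD1 i)//=.
  apply: (@le_trans _ _ (\sum_j `|invmx M i j|)); last first.
    by rewrite lerDl sumr_ge0// => j _; apply: sumr_ge0.
  apply: ler_sum => j _; rewrite normrM ler_piMr//.
  by have /andP[x0 x1] := x01 j; rewrite gtr0_norm// ltW.
rewrite addr0 mcoordZ mxE subr0 normrM (gtr0_norm s0) ler_pdivrMl ?mulr_gt0 ?ltr_wpDl//.
by apply: (le_trans xi); lra.
Qed.

(** [K] bounds the ordinary coordinates of all points of the set, which therefore lies in the cube
    of side 2 (K + 1) centred at 0. *)
Lemma measure_unit_MQ_lty : (muR d (MQ M 0 1) < +oo)%E.
Proof.
pose K := \sum_i \sum_j `|M i j|.
have K0 : 0 <= K by apply: sumr_ge0 => i _; apply: sumr_ge0.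
have s0 : 0 < 2 * (K + 1) by rewrite mulr_gt0// ltr_wpDl.
rewrite -(measure_affine (const_mx (- (K + 1))) s0 (measurable_MQ 0 1)).
apply: (@le_lt_trans _ _ ((2 * (K + 1)) ^+ d)%:E); last exact: ltry.
rewrite -[leRHS]mule1 lee_wpmul2l ?lee_fin ?exprn_ge0 ?(ltW s0)//.
rewrite -int_prod_win; apply: ge0_le_integral => //.
- apply: (measurableT_comp (measurable_eindic (measurable_MQ 0 1))).
  exact: measurable_affine_Tm.
- exact: measurable_prod_win.
move=> x _; rewrite lee_fin indicE; case: (boolP (_ \in _)) => [|_]; last first.
  by rewrite prodr_ge0// => i _; have /andP[] := win_bound (x 0 i).
move=> /set_mem[y Qy yE]; rewrite big1// => i _.
rewrite winE; suff -> : 0 < x 0 i < 1 by [].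
have : `|2 * (K + 1) * x 0 i - (K + 1)| <= K.
  have := congr1 (fun v : 'rV[R]_d => v 0 i) yE; rewrite /= !mxE => <-.
  apply: (le_trans (ler_norm_sum _ _ _)); rewrite /K [leRHS](bigD1 i)//=.
  apply: (@le_trans _ _ (\sum_j `|M i j|)); last by rewrite lerDl sumr_ge0// => j _; apply: sumr_ge0.
  apply: ler_sum => j _; rewrite normrM ler_piMr// mxE.
  by have := Qy j; rewrite mxE subr0 => /le_trans -> //; lra.
rewrite ler_norml => /andP[h1 h2].
rewrite -(@pmulr_rgt0 _ (2 * (K + 1)))// -(@ltr_pM2l _ (2 * (K + 1)) s0 (x 0 i) 1) mulr1.
by apply/andP; split; lra.
Qed.

(** Dilation by [n] and translation by M O carry the unit set onto this one. *)
Lemma measure_MQ O n : (0 < n)%N ->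
  muR d (MQ M O n) = ((n%:R ^+ d)%:E * muR d (MQ M 0 1))%E.
Proof.
move=> n0; have s0 : 0 < n%:R :> R by rewrite ltr0n.
rewrite -(measure_affine (M *m O^T)^T s0 (measurable_MQ O n)); congr (_ * _)%E.
rewrite -(measure_indic (measurable_MQ 0 1)); apply: eq_integral => x _.
rewrite !indicE; congr (_%:R)%:E; congr nat_of_bool; apply/idP/idP => /set_mem/MQP h; apply/mem_set/MQP => i;
  have := h i; rewrite mcoordD mcoordZ mcoord_image addrK mxE subr0 normrM (gtr0_norm s0);
  by rewrite -ler_pdivlMl// mulrA mulVf ?gt_eqF.
Qed.

End Cubes.

(** * The density estimate *)

Section SeriesIntegral.
Context d0 (X : measurableType d0) (R : realType) (mu : {measure set X -> \bar R}).

(** A certificate for a family to be summed over [k] and integrated over [x]. Certificates add and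
    scale, so the error bound can be assembled from its six terms. *)
Definition int_bounded (f : nat -> X -> R) (c : R) : Prop :=
  [/\ forall k, measurable_fun setT (f k), forall k x, 0 <= f k x &
      (\sum_(0 <= k <oo) \int[mu]_x (f k x)%:E <= c%:E)%E].

Lemma int_boundedD f h a b : int_bounded f a -> int_bounded h b ->
  int_bounded (fun k x => f k x + h k x) (a + b).
Proof.
move=> [mf f0 fa] [mh h0 hb]; split=> [k|k x|].
- exact: measurable_funD.
- exact: addr_ge0.
have E k : (\int[mu]_x (f k x + h k x)%:E = \int[mu]_x (f k x)%:E + \int[mu]_x (h k x)%:E)%E.
  under eq_integral do rewrite EFinD.
  by rewrite ge0_integralD//; [move=> x _; rewrite lee_fin|exact/measurable_EFinP|
    move=> x _; rewrite lee_fin|exact/measurable_EFinP].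
under eq_eseriesr do rewrite E.
rewrite nneseriesD; first by rewrite EFinD leeD.
- by move=> k _ _; apply: integral_ge0 => x _; rewrite lee_fin.
- by move=> k _ _; apply: integral_ge0 => x _; rewrite lee_fin.
Qed.

Lemma int_boundedZ f a c : 0 <= c -> int_bounded f a ->
  int_bounded (fun k x => c * f k x) (c * a).
Proof.
move=> c0 [mf f0 fa]; split=> [k|k x|].
- exact: measurable_funM.
- exact: mulr_ge0.
have E k : (\int[mu]_x (c * f k x)%:E = c%:E * \int[mu]_x (f k x)%:E)%E.
  under eq_integral do rewrite EFinM.
  by rewrite ge0_integralZl_EFin//; [move=> x _; rewrite lee_fin|exact/measurable_EFinP].
under eq_eseriesr do rewrite E.
rewrite nneseriesZl; first by rewrite EFinM lee_wpmul2l// lee_fin.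
by move=> k _; apply: integral_ge0 => x _; rewrite lee_fin.
Qed.

(** The case of a sum over [k] bounded at each point; [int_bounded_coef] is the mirror case, with an
    integral bounded for each [k]. *)
Lemma int_bounded_weight (p : X -> R) (f : nat -> X -> R) (C I : R) :
  0 <= C -> measurable_fun setT p -> (forall x, 0 <= p x) ->
  (forall k, measurable_fun setT (f k)) -> (forall k x, 0 <= f k x) ->
  (forall x, (\sum_(0 <= k <oo) (f k x)%:E <= C%:E)%E) ->
  (\int[mu]_x (p x)%:E <= I%:E)%E ->
  int_bounded (fun k x => p x * f k x) (C * I).
Proof.
move=> C0 mp p0 mf f0 fC pI; split=> [k|k x|].
- exact: measurable_funM.
- exact: mulr_ge0.
have mpf k : measurable_fun setT (fun x => (p x * f k x)%:E).
  by apply/measurable_EFinP; exact: measurable_funM.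
rewrite -integral_nneseries//; last by move=> k x _; rewrite lee_fin mulr_ge0.
apply: (@le_trans _ _ (\int[mu]_x (C%:E * (p x)%:E))%E); last first.
  rewrite ge0_integralZl_EFin//; [|by move=> x _; rewrite lee_fin|exact/measurable_EFinP].
  by rewrite EFinM lee_wpmul2l// lee_fin.
apply: ge0_le_integral => //.
- by move=> x _; apply: nneseries_ge0 => k _ _; rewrite lee_fin mulr_ge0.
- apply: (@ge0_emeasurable_sum _ _ _ _ (fun k x => (p x * f k x)%:E) xpredT) => //.
  by move=> k x _ _; rewrite lee_fin mulr_ge0.
- by apply/measurable_EFinP; exact: measurable_funM.
move=> x _; under eq_eseriesr do rewrite EFinM.
rewrite nneseriesZl; last by move=> k _; rewrite lee_fin.
by rewrite [leRHS]muleC lee_wpmul2l// lee_fin.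
Qed.

(** Pointwise, the limit is dominated by the full series of the [q k], which is integrated term by
    term. *)
Lemma Rintegral_le_int_bounded (q : nat -> X -> R) (c : R) (u : nat -> X -> R) (l : X -> R) :
  int_bounded q c -> measurable_fun setT l -> mu.-integrable setT (EFin \o l) ->
  (forall k x, `|u k x| <= q k x) ->
  (forall x, series (fun k => u k x) @ \oo --> l x) ->
  `|\int[mu]_x l x| <= c.
Proof.
move=> [mq q0 qc] ml il uq ul.
have le1 x : (`|l x|%:E <= \sum_(0 <= k <oo) (q k x)%:E)%E.
  have h : (fun n => `|series (u^~ x) n|%:E) @ \oo --> `|l x|%:E.
    by apply: cvg_EFin; [exact: nearW|exact: (cvg_norm (ul x))].
  apply: (cvge_le _ h); apply: nearW => n; rewrite /= /series /=.
  apply: (@le_trans _ _ (\sum_(0 <= k < n) (q k x)%:E)%E).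
    rewrite sumEFin lee_fin (le_trans (ler_norm_sum _ _ _))// ler_sum// => k _; exact: uq.
  by apply: nneseries_lim_ge => k _ _; rewrite lee_fin.
apply: (le_trans (le_normr_Rintegral _ il)) => //.
rewrite -lee_fin fineK; last first.
  by apply: integrable_fin_num => //; exact: (integrable_norm il).
apply: le_trans qc; rewrite -integral_nneseries//; last 2 first.
- by move=> k; exact/measurable_EFinP.
- by move=> k x _; rewrite lee_fin.
apply: ge0_le_integral => //.
- by apply/measurable_EFinP; exact: measurableT_comp.
- apply: (@ge0_emeasurable_sum _ _ _ _ (fun k x => (q k x)%:E) xpredT) => [k x _ _|k _].
    by rewrite lee_fin.
  exact/measurable_EFinP.
Qed.
End SeriesIntegral.

Section Counting.
Context (R : realType).
(** A convergent series of zeros and ones has terms eventually below 1, hence zero. *)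
Lemma finite_of_series (S : set nat) (C : R) :
  (\sum_(0 <= k <oo) (\1_S k : R)%:E <= C%:E)%E -> finite_set S.
Proof.
move=> h.
have i0 k : (0 <= (\1_S k : R)%:E)%E by rewrite lee_fin indicE.
have cv : cvgn (series (fun k => \1_S k : R)).
  apply: nondecreasing_is_cvgn.
    by apply: nondecreasing_series => k _ _; rewrite indicE.
  exists C => _ [n _ <-]; rewrite -lee_fin (le_trans _ h)// -sumEFin.
  exact: nneseries_lim_ge.
have /cvgrPdist_lt /(_ 1 ltr01)[N _ hN] := cvg_series_cvg_0 cv.
apply: (@sub_finite_set _ _ `I_N); last exact: finite_II.
move=> k Sk /=; rewrite ltnNge; apply/negP => Nk.
by have := hN k Nk; rewrite /= indicE mem_set// sub0r normrN normr1 ltxx.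
Qed.

Lemma finite_nat_bounded (S : set nat) : finite_set S -> exists N, S `<=` `I_N.
Proof.
move=> /finite_seqP[F ->]; exists (\max_(k <- F) k.+1)%N => k /= kF.
exact: (@leq_bigmax_seq _ F xpredT succn k).
Qed.

(** Brings sums over Lambda_n into the shape of partial sums of a series over all indices, in which
    the error estimate is stated. *)
Lemma fsbig_indic (V : lmodType R) (S : set nat) N (f : nat -> V) : S `<=` `I_N ->
  \sum_(k \in S) f k = \sum_(k < N) (\1_S k : R) *: f k.
Proof.
move=> SN.
transitivity (\sum_(k \in S) (\1_S k : R) *: f k).
  by apply: eq_fsbigr => k kS; rewrite indicE kS scale1r.
rewrite (fsbig_widen S `I_N)//; first by rewrite -fsbig_ord.
by move=> k /=[_ nS]; rewrite indicE memNset// scale0r.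
Qed.
End Counting.

Section Tails.
Context (R : realType) (d : nat) (M : 'M[R]_d) (O : 'rV[R]_d) (lam : nat -> 'rV[R]_d).
Local Notation T := (Tm R d).
Local Notation mu := (@muR R d).
Context (F : T -> R) (CB : R).
Hypotheses (uM : M \in unitmx) (mF : measurable_fun setT F) (F0 : forall w, 0 <= F w).
Hypotheses (Flty : (\int[mu]_w (F w)%:E < +oo)%E) (Fgt0 : (0 < \int[mu]_w (F w)%:E)%E).
Hypotheses (CB0 : 0 <= CB)
  (FCB : forall z : T, (\sum_(0 <= k <oo) (F ((z : 'rV[R]_d) - lam k))%:E <= CB%:E)%E).

Local Notation E := (MQ M O).
Local Notation B := (MQ M 0).
Local Notation ind S := (\1_S : 'rV[R]_d -> R).

Definition tailF (r : nat) (w : 'rV[R]_d) : R := ind (~` B r) w * F w.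
Definition tail (r : nat) : R := fine (\int[mu]_w (tailF r w)%:E).
Definition Gs : R := fine (\int[mu]_w (F w)%:E).
(** For positive [n] this is the volume of [MQ M O n], whatever the centre. *)
Definition vE (n : nat) : R := n%:R ^+ d * fine (mu (B 1%N)).

Lemma indic_ge0 (S : set 'rV[R]_d) x : 0 <= ind S x.
Proof. by rewrite indicE. Qed.

Lemma indic_le1 (S : set 'rV[R]_d) x : ind S x <= 1.
Proof. by rewrite indicE; case: (_ \in _). Qed.

Lemma measure_E n : (0 < n)%N -> mu (E n) = (vE n)%:E.
Proof.
move=> n0; rewrite measure_MQ// /vE EFinM fineK// ge0_fin_numE//.
exact: measure_unit_MQ_lty.
Qed.

Lemma vE_gt0 n : (0 < n)%N -> 0 < vE n.
Proof.
move=> n0; rewrite mulr_gt0 ?exprn_gt0 ?ltr0n// fine_gt0//.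
by rewrite measure_unit_MQ_gt0// measure_unit_MQ_lty.
Qed.

Lemma measurable_ind_shift (S : set T) (c : 'rV[R]_d) : measurable S ->
  measurable_fun setT (fun z : T => ind S ((z : 'rV[R]_d) + c)).
Proof.
move=> mS; apply: (measurableT_comp (@measurable_indic _ T R setT S mS)).
exact: measurable_shift.
Qed.

Lemma measurable_tailF r : measurable_fun setT (tailF r : T -> R).
Proof.
apply: measurable_funM => //; apply: measurable_indic.
exact: (measurableC (measurable_MQ uM 0 r)).
Qed.

Lemma tailF_ge0 r w : 0 <= tailF r w.
Proof. by rewrite mulr_ge0// indic_ge0. Qed.

Lemma int_tailF_le r : (\int[mu]_w (tailF r w)%:E <= \int[mu]_w (F w)%:E)%E.
Proof.
apply: ge0_le_integral => //.
- by move=> w _; rewrite lee_fin tailF_ge0.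
- by apply/measurable_EFinP; exact: measurable_tailF.
- exact/measurable_EFinP.
- by move=> w _; rewrite lee_fin ler_piMl// indic_le1.
Qed.

Lemma tailE r : (\int[mu]_w (tailF r w)%:E = (tail r)%:E)%E.
Proof.
rewrite /tail fineK// ge0_fin_numE; first exact: le_lt_trans (int_tailF_le r) Flty.
by apply: integral_ge0 => w _; rewrite lee_fin tailF_ge0.
Qed.

Lemma tail_ge0 r : 0 <= tail r.
Proof.
by rewrite fine_ge0// integral_ge0// => w _; rewrite lee_fin tailF_ge0.
Qed.

Lemma GsE : (\int[mu]_w (F w)%:E = Gs%:E)%E.
Proof. by rewrite /Gs fineK// ge0_fin_numE// ltW. Qed.

Lemma Gs_gt0 : 0 < Gs.
Proof. by rewrite -lte_fin -GsE. Qed.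

Lemma tail_cvg0 : tail @ \oo --> 0.
Proof.
have mf r : measurable_fun setT (fun w : T => (tailF r w)%:E).
  by apply/measurable_EFinP; exact: measurable_tailF.
have cv : {ae mu, forall w, setT w -> (tailF r w)%:E @[r --> \oo] --> (0 : \bar R)%E}.
  apply: aeW => w _ /=; have [r0 hr] := MQ_exhaust uM w.
  apply: cvg_near_cst; near=> r.
  rewrite /tailF indicE memNset ?mul0r//; apply; apply: hr; near: r; by exists r0.
have iF : mu.-integrable setT (EFin \o F).
  apply/integrableP; split; first exact/measurable_EFinP.
  by under eq_integral do rewrite /= ger0_norm//.
have dom : {ae mu, forall w r, setT w -> (`|(tailF r w)%:E| <= (EFin \o F) w)%E}.
  apply: aeW => w r _ /=; rewrite lee_fin ger0_norm ?tailF_ge0//.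
  by rewrite ler_piMl// indic_le1.
have [_ _] := dominated_convergence measurableT mf (measurable_cst _) cv iF dom.
by rewrite integral0 => h; exact: fine_cvg.
Unshelve. all: by end_near. Qed.

Lemma int_core r : (\int[mu]_w (ind (B r) w * F w)%:E = (Gs - tail r)%:E)%E.
Proof.
have mB : measurable_fun setT (fun w : T => (ind (B r) w * F w)%:E).
  apply/measurable_EFinP; apply: measurable_funM => //.
  by exact: (@measurable_indic _ T R setT _ (measurable_MQ uM 0 r)).
have := GsE.
have -> : (\int[mu]_w (F w)%:E = \int[mu]_w ((ind (B r) w * F w)%:E + (tailF r w)%:E))%E.
  apply: eq_integral => w _; rewrite -EFinD /tailF -mulrDl; congr _%:E.
  rewrite !indicE in_setC; case: (w \in _) => /=; ring.
rewrite ge0_integralD//; last 3 first.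
- by move=> w _; rewrite lee_fin mulr_ge0// indic_ge0.
- by move=> w _; rewrite lee_fin tailF_ge0.
- by apply/measurable_EFinP; exact: measurable_tailF.
rewrite tailE EFinB => <-; rewrite addeK//.
Qed.

Lemma int_F_shift (p : T -> R) (c : 'rV[R]_d) : measurable_fun setT p -> (forall x, 0 <= p x) ->
  (\int[mu]_z (p ((z : 'rV[R]_d) - c)%R)%:E = \int[mu]_z (p z)%:E)%E.
Proof.
move=> mp p0; apply: (@integral_translate_Tm R d (- c) (fun z => (p z)%:E)).
  exact/measurable_EFinP.
by move=> z; rewrite lee_fin.
Qed.

(* Every counted index carries F-mass at least Gs - tail r inside E (n + r), where the total
   mass has density at most CB. *)
Lemma count_core n r (w : 'rV[R]_d) : (0 < n)%N ->
  (\sum_(0 <= k <oo) ((Gs - tail r) * ind (E n) (lam k + w)%R)%:E <= (CB * vE (n + r))%:E)%E.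
Proof.
move=> n0; have mE := measurable_MQ uM O (n + r).
have [_ _] : int_bounded mu
    (fun k (z : T) => ind (E (n + r)) (z + w) * F (z - lam k)) (CB * vE (n + r)).
  apply: int_bounded_weight => //.
  - exact: measurable_ind_shift.
  - move=> k; apply: (measurableT_comp mF); exact: measurable_shift.
  - rewrite -[w]opprK (@int_F_shift (ind (E (n + r))))//.
    + by rewrite measure_indic// measure_E// addn_gt0 n0.
apply: le_trans; apply: lee_nneseries => k _.
  by move=> _; rewrite lee_fin mulr_ge0 ?indic_ge0// -lee_fin -int_core integral_ge0// => z _;
    rewrite lee_fin mulr_ge0// indic_ge0.
rewrite [X in ((_ * X)%:E <= _)%E]indicE; case: (boolP (_ \in _)) => [/set_mem Ek|_]; last first.
  by rewrite mulr0 integral_ge0// => z _; rewrite lee_fin mulr_ge0// indic_ge0.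
rewrite mulr1 -int_core -(int_F_shift (lam k) (p := fun z => ind (B r) z * F z)); last 2 first.
- by apply: measurable_funM => //; exact: (@measurable_indic _ T R setT _ (measurable_MQ uM 0 r)).
- by move=> z; rewrite mulr_ge0// indic_ge0.
apply: ge0_le_integral => //.
- by move=> z _; rewrite lee_fin mulr_ge0// indic_ge0.
- apply/measurable_EFinP; apply: measurable_funM.
    exact: (measurable_ind_shift _ (measurable_MQ uM 0 r)).
  apply: (measurableT_comp mF); exact: measurable_shift.
- apply/measurable_EFinP; apply: measurable_funM; first exact: measurable_ind_shift.
  apply: (measurableT_comp mF); exact: measurable_shift.
move=> z _; rewrite lee_fin ler_wpM2r//.
rewrite [leLHS]indicE; case: (boolP (_ \in _)) => [/set_mem Bz|_]; last exact: indic_ge0.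
rewrite indicE mem_set//; have -> : z + w = (lam k + w) + (z - lam k).
  by rewrite [z - _]addrC addrACA subrr add0r addrC.
exact: MQ_add.
Qed.

(** With the tail below half the mass and [n > r], [vE (n + r) <= 2 ^+ d * vE n] gives the constant.
    The shift [w] provides uniformity over translates, for use under an integral in
    [int_bounded_qerr]. *)
Lemma count_le : exists K n0, [/\ 0 <= K, (0 < n0)%N &
  forall n w, (n0 <= n)%N ->
    (\sum_(0 <= k <oo) (ind (E n) (lam k + w)%R)%:E <= (K * vE n)%:E)%E].
Proof.
have G2 : 0 < Gs / 2 by rewrite divr_gt0 ?Gs_gt0.
have /cvgr_lt/(_ _ G2)[r _ hr] := tail_cvg0.
have {hr}hr : tail r < Gs / 2 by apply: hr => /=.
exists ((Gs / 2)^-1 * (CB * 2 ^+ d)), r.+1; split => // [|n w rn].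
  by rewrite mulr_ge0 ?invr_ge0 ?(ltW G2)// mulr_ge0// exprn_ge0.
have n0 : (0 < n)%N by exact: leq_trans rn.
have : (\sum_(0 <= k <oo) (Gs / 2)%:E * (ind (E n) (lam k + w)%R)%:E <=
    (CB * (2 ^+ d * vE n))%:E)%E.
  apply: (@le_trans _ _ (CB * vE (n + r))%:E); last first.
    rewrite lee_fin ler_wpM2l// /vE mulrA -exprMn ler_wpM2r ?fine_ge0//.
    rewrite lerXn2r ?nnegrE// -natrM ler_nat mul2n -addnn leq_add2l; exact: ltnW.
  apply: le_trans (count_core r w n0); apply: lee_nneseries => k _.
    by move=> _; rewrite -EFinM lee_fin mulr_ge0 ?indic_ge0// ltW.
  by rewrite -EFinM lee_fin ler_wpM2r ?indic_ge0//; lra.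
rewrite nneseriesZl; last by move=> k _; rewrite lee_fin indic_ge0.
rewrite muleC -lee_pdivlMr// -EFinM => h; apply: (le_trans h).
by rewrite lee_fin le_eqVlt; apply/orP; left; apply/eqP; field; rewrite gt_eqF// Gs_gt0.
Qed.
End Tails.

Lemma int_bounded_coef d0 (X : measurableType d0) (R : realType) (mu : {measure set X -> \bar R})
    (c : nat -> R) (f : nat -> X -> R) (C I : R) :
  (forall k, 0 <= c k) -> (\sum_(0 <= k <oo) (c k)%:E <= C%:E)%E ->
  (forall k, measurable_fun setT (f k)) -> (forall k x, 0 <= f k x) -> 0 <= I ->
  (forall k, (\int[mu]_x (f k x)%:E <= I%:E)%E) ->
  int_bounded mu (fun k x => c k * f k x) (I * C).
Proof.
move=> c0 cC mf f0 I0 fI; split=> [k|k x|].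
- exact: measurable_funM.
- exact: mulr_ge0.
apply: (@le_trans _ _ (\sum_(0 <= k <oo) (I%:E * (c k)%:E))%E).
  apply: lee_nneseries => [k _ _|k _].
    by apply: integral_ge0 => x _; rewrite lee_fin mulr_ge0.
  under eq_integral do rewrite EFinM.
  rewrite ge0_integralZl_EFin//; first by rewrite muleC lee_wpmul2r// lee_fin.
  - by move=> x _; rewrite lee_fin.
  - exact/measurable_EFinP.
rewrite nneseriesZl; first by rewrite EFinM lee_wpmul2l// lee_fin.
by move=> k _; rewrite lee_fin.
Qed.

Lemma amgm_weighted (R : realType) (s a x y : R) : 0 < s -> 0 <= x -> 0 <= y -> a ^+ 2 <= x * y ->
  `|a| <= s / 2 * x + (2 * s)^-1 * y.
Proof.
move=> s0 x0 y0 h.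
have q0 : 0 <= s / 2 * x + (2 * s)^-1 * y.
  by rewrite addr_ge0// mulr_ge0 ?divr_ge0 ?invr_ge0 ?mulr_ge0// ltW.
rewrite -(@ler_pXn2r _ 2)// ?nnegrE//; rewrite real_normK ?num_real//; apply: (le_trans h).
rewrite -subr_ge0 (_ : _ - _ = (s / 2 * x - (2 * s)^-1 * y) ^+ 2) ?sqr_ge0//.
by field; rewrite gt_eqF.
Qed.

Section ErrorBound.
Context (R : realType) (d : nat) (M : 'M[R]_d) (O : 'rV[R]_d) (lam : nat -> 'rV[R]_d).
Local Notation T := (Tm R d).
Local Notation mu := (@muR R d).
(** In the application [al k z] is |<H_z, g~_k>|^2 and [a k z] is the kernel a_k(z), with [CA] =
    1/A, [CB] = B and [CC] = |g|^2 / A^2. *)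
Context (F : T -> R) (CA CB CC : R) (al a : nat -> T -> R).
Hypotheses (uM : M \in unitmx) (mF : measurable_fun setT F) (F0 : forall w, 0 <= F w).
Hypotheses (Flty : (\int[mu]_w (F w)%:E < +oo)%E) (Fgt0 : (0 < \int[mu]_w (F w)%:E)%E).
Hypotheses (CA0 : 0 <= CA) (CB0 : 0 <= CB) (CC0 : 0 <= CC).
Hypotheses (FCB : forall z : T, (\sum_(0 <= k <oo) (F ((z : 'rV[R]_d) - lam k))%:E <= CB%:E)%E).
Hypotheses (mal : forall k, measurable_fun setT (al k)) (al0 : forall k z, 0 <= al k z).
Hypotheses (alCA : forall z, (\sum_(0 <= k <oo) (al k z)%:E <= CA%:E)%E).
Hypotheses (alCC : forall k, (\int[mu]_z (al k z)%:E <= CC%:E)%E).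
Hypotheses (ma : forall k, measurable_fun setT (a k)).
Hypothesis a_sq : forall k z, a k z ^+ 2 <= al k z * F ((z : 'rV[R]_d) - lam k).
Hypothesis a_one : forall z, series (fun k => a k z) @ \oo --> (1 : R).

Local Notation E := (MQ M O).
Local Notation B := (MQ M 0).
Local Notation ind S := (\1_S : 'rV[R]_d -> R).
Local Notation tailF := (tailF M F).
Local Notation tail := (tail M F).
Local Notation vE := (vE M).
Local Notation Fl k z := (F ((z : 'rV[R]_d) - lam k)).

Lemma mFl k : measurable_fun setT (fun z : T => Fl k z).
Proof. by apply: (measurableT_comp mF); exact: measurable_shift. Qed.

Lemma int_Fl k : (\int[mu]_z (Fl k z)%:E = \int[mu]_z (F z)%:E)%E.
Proof. exact: int_F_shift. Qed.

Lemma integrable_a k : mu.-integrable setT (EFin \o a k).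
Proof.
have i1 : mu.-integrable setT (EFin \o al k).
  apply/integrableP; split; first exact/measurable_EFinP.
  under eq_integral do rewrite /= ger0_norm//.
  exact: le_lt_trans (alCC k) (ltry _).
have i2 : mu.-integrable setT (EFin \o (fun z : T => Fl k z)).
  apply/integrableP; split; first by apply/measurable_EFinP; exact: mFl.
  under eq_integral do rewrite /= ger0_norm//.
  by rewrite int_Fl.
apply: (le_integrable measurableT _ _ (integrableD measurableT i1 i2)); first by apply/measurable_EFinP; exact: ma.
move=> z _ /=; rewrite lee_fin.
have := amgm_weighted (ltr01 : 0 < 1 :> R) (al0 k z) (F0 _) (a_sq k z).
move=> /le_trans; apply; apply: le_trans (ler_norm _).
by have := al0 k z; have := F0 (z - lam k); lra.
Qed.

(** Subtraction of naturals truncates, whence the side conditions [r < n] and [r <= n] below. *)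
Definition ringE n r : set 'rV[R]_d := E (n + r) `\` E (n - r).

Lemma measurable_ringE n r : measurable (ringE n r : set T).
Proof. exact: (measurableD (measurable_MQ uM O _) (measurable_MQ uM O _)). Qed.

Lemma measure_ringE n r : (r < n)%N -> mu (ringE n r) = (vE (n + r) - vE (n - r))%:E.
Proof.
move=> rn; have nr : (0 < n - r)%N by rewrite subn_gt0.
have nr' : (0 < n + r)%N by rewrite addn_gt0 (leq_ltn_trans _ rn).
rewrite measureD//; last 3 first.
- exact: (measurable_MQ uM O (n + r)).
- exact: (measurable_MQ uM O (n - r)).
- by apply: (@le_lt_trans _ _ (vE (n + r))%:E); [rewrite -(measure_E O uM nr')|exact: ltry].
have -> : E (n + r) `&` E (n - r) = E (n - r).
  apply/seteqP; split=> [v []//|v Ev]; split=> //.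
  by apply: (MQ_le uM) Ev; rewrite (leq_trans (leq_subr _ _))// leq_addr.
by rewrite EFinB; congr (_ - _)%E; exact: measure_E.
Qed.

Lemma ringP n r k (z : 'rV[R]_d) : ind (E n) (lam k) != ind (E n) z -> (r <= n)%N ->
  B r (z - lam k) -> ringE n r z.
Proof.
move=> ne rn Bz; split.
  have [Ez|nEz] := pselect (E n z); first by apply: (MQ_le uM) Ez; rewrite leq_addr.
  have [El|nEl] := pselect (E n (lam k)); last by move: ne; rewrite !indicE !memNset// eqxx.
  by rewrite -[z](subrK (lam k)) addrC; exact: (MQ_add uM).
move=> Ez; move: ne; rewrite !indicE !mem_set ?eqxx//.
  by apply: (MQ_le uM) Ez; rewrite leq_subr.
rewrite -(subnK rn) (_ : lam k = z + - (z - lam k)); last by rewrite opprB addrC subrK.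
by apply: (MQ_add uM Ez); exact: (MQ_opp uM).
Qed.

(* If lam k and z lie on different sides of the boundary of E n, then either they differ by an
   element of B r and z lies in the ring, or z - lam k is in the tail of F. In the second case
   AM-GM is applied with a weight s, to be chosen before r. *)
Definition qerr n r s k (z : 'rV[R]_d) : R :=
  1 / 2 * (ind (ringE n r) z * al k z + ind (ringE n r) z * Fl k z) +
  (s / 2 * (ind (E n) (lam k) * al k z + ind (E n) z * al k z) +
  (2 * s)^-1 * (ind (E n) (lam k) * tailF r (z - lam k) + ind (E n) z * tailF r (z - lam k))).

(** When the two indicators agree the left side is zero. Otherwise exactly one of them is 1, so
    their sums inside [qerr] drop out. *)
Lemma qerr_dominates n r s k z : (r <= n)%N -> 0 < s ->
  `|(ind (E n) (lam k) - ind (E n) z) * a k z| <= qerr n r s k z.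
Proof.
move=> rn s0; rewrite normrM /qerr.
have := amgm_weighted (ltr01 : 0 < 1 :> R) (al0 k z) (F0 _) (a_sq k z).
have := amgm_weighted s0 (al0 k z) (F0 _) (a_sq k z).
have rp := @ringP n r k z ^~ rn.
have p0 : 0 <= s / 2 by rewrite divr_ge0// ltW.
have p1 : 0 <= (2 * s)^-1 by rewrite invr_ge0 mulr_ge0// ltW.
have := mulr_ge0 p1 (F0 (z - lam k)); have := mulr_ge0 p0 (al0 k z).
move: rp (al0 k z) (F0 (z - lam k)); rewrite /tailF mulr1.
move: (s / 2) ((2 * s)^-1) (al k z) (Fl k z) `|a k z| => s1 s2 x y b.
have [eq|ne] := eqVneq (ind (E n) (lam k)) (ind (E n) z).
  rewrite eq subrr normr0 mul0r => _ x0 y0 p q _ _.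
  have e0 := indic_ge0 (E n) z; have r0 := indic_ge0 (ringE n r) z.
  have t0 := indic_ge0 (~` B r) (z - lam k).
  move: (ind (E n) z) (ind (ringE n r) z) (ind (~` _) _) e0 r0 t0 => e rr t e0 r0 t0.
  have r1 : 0 <= rr * x by exact: mulr_ge0.
  have r2 : 0 <= rr * y by exact: mulr_ge0.
  have r3 : 0 <= e * (s1 * x) by exact: mulr_ge0.
  have r4 : 0 <= e * (t * (s2 * y)) by apply: mulr_ge0 => //; exact: mulr_ge0.
  by nra.
move=> rp x0 y0 p q h1 h2.
have -> : `|ind (E n) (lam k) - ind (E n) z| = 1.
  move: ne; rewrite !indicE; case: (_ \in _); case: (_ \in _); rewrite ?eqxx//= => _.
    by rewrite subr0 normr1.
  by rewrite sub0r normrN normr1.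
have e1 : ind (E n) (lam k) + ind (E n) z = 1.
  move: ne; rewrite !indicE; case: (_ \in _); case: (_ \in _); rewrite ?eqxx//= => _.
    by rewrite addr0.
  by rewrite add0r.
rewrite -!mulrDl -!mulrDr e1 !mul1r.
have [Bz|nBz] := pselect (B r (z - lam k)).
  have -> : ind (~` B r) (z - lam k) = 0 by rewrite indicE memNset//; apply.
  have -> : ind (ringE n r) z = 1 by rewrite indicE mem_set//; exact: rp.
  lra.
have -> : ind (~` B r) (z - lam k) = 1 by rewrite indicE mem_set.
have r1 : 0 <= ind (ringE n r) z * (x + y) by rewrite mulr_ge0 ?indic_ge0// addr_ge0.
lra.
Qed.

(** Terms with an indicator in [z] use the pointwise sums over [k] and a volume; terms with the
    indicator of [lam k] use integrals for fixed [k] and the count [N]. The last tail term fits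
    neither scheme directly. *)
Lemma int_bounded_qerr n r s (N : R) : (r < n)%N -> 0 < s -> 0 <= N ->
  (forall w : 'rV[R]_d, (\sum_(0 <= k <oo) (ind (E n) (lam k + w)%R)%:E <= N%:E)%E) ->
  int_bounded mu (qerr n r s)
    (1 / 2 * (CA * (vE (n + r) - vE (n - r)) + CB * (vE (n + r) - vE (n - r))) +
    (s / 2 * (CC * N + CA * vE n) + (2 * s)^-1 * (tail r * N + N * tail r))).
Proof.
move=> rn s0 N0 hN; have n0 : (0 < n)%N := leq_ltn_trans (leq0n r) rn.
have mind (S : set T) : measurable S -> measurable_fun setT (ind S : T -> R).
  by move=> mS; exact: (@measurable_indic _ T R setT S mS).
have ind0 (S : set T) (x : T) : 0 <= ind S x by exact: indic_ge0.
have mE := measurable_MQ uM O n; have mr := measurable_ringE n r.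
have mt : measurable_fun setT (tailF r : T -> R) := measurable_tailF uM mF r.
have t0 z : 0 <= tailF r z := tailF_ge0 M F0 r z.
have mtk k : measurable_fun setT (fun z : T => tailF r ((z : 'rV[R]_d) - lam k)).
  by apply: (measurableT_comp mt); exact: measurable_shift.
have itk k : (\int[mu]_z (tailF r ((z : 'rV[R]_d) - lam k)%R)%:E = (tail r)%:E)%E.
  by rewrite (int_F_shift (lam k) mt t0) (tailE uM mF F0 Flty).
have chiN : (\sum_(0 <= k <oo) (ind (E n) (lam k))%:E <= N%:E)%E.
  by have := hN 0; under eq_eseriesr do rewrite addr0.
have iring : (\int[mu]_z (ind (ringE n r) z)%:E <= (vE (n + r) - vE (n - r))%:E)%E.
  by rewrite (measure_indic mr) measure_ringE.
have iE : (\int[mu]_z (ind (E n) z)%:E <= (vE n)%:E)%E.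
  by rewrite (measure_indic mE) (measure_E O uM n0).
apply: int_boundedD.
  apply: int_boundedZ; first by lra.
  apply: int_boundedD; apply: int_bounded_weight => //; try exact: mind; by move=> k; exact: mFl.
apply: int_boundedD; apply: int_boundedZ.
- by rewrite divr_ge0// ltW.
- apply: int_boundedD; last by apply: int_bounded_weight => //; exact: mind.
  by apply: int_bounded_coef => // k; exact: indic_ge0.
- by rewrite invr_ge0 mulr_ge0// ltW.
- apply: int_boundedD.
    apply: int_bounded_coef => //; first by rewrite tail_ge0.
    by move=> k; rewrite itk.
  (* Substituting z + lam k for z frees the tail from [k]; what remains is the number of points lam
     k + z in [E n], at most [N] for every z. *)
  have [_ _ h] : int_bounded mu (fun k z => tailF r z * ind (E n) (lam k + z)) (N * tail r).
    apply: int_bounded_weight => //.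
    - move=> k; under eq_fun do rewrite addrC; exact: measurable_ind_shift.
    - by rewrite (tailE uM mF F0 Flty).
  split=> [k|k z|]; first by apply: measurable_funM => //; exact: mind.
    by rewrite mulr_ge0.
  apply: le_trans h; apply: lee_nneseries => [k _ _|k _].
    by apply: integral_ge0 => z _; rewrite lee_fin mulr_ge0.
  rewrite -(int_F_shift (lam k) (p := fun z => tailF r z * ind (E n) (lam k + z))).
  + by under [leRHS]eq_integral do rewrite [lam k + _]addrC subrK mulrC.
  + apply: measurable_funM => //; under eq_fun do rewrite addrC; exact: measurable_ind_shift.
  + by move=> z; rewrite mulr_ge0.
Qed.

(** As the [a k] sum to 1 at every point, the volume is also a sum over [k], and the difference
    integrates the series with terms [(ind (E n) (lam k) - ind (E n) z) * a k z]. *)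
Lemma error_bound n r s K N : (r < n)%N -> 0 < s -> 0 <= K ->
  Lam_n lam M O n `<=` `I_N ->
  (forall w : 'rV[R]_d, (\sum_(0 <= k <oo) (ind (E n) (lam k + w)%R)%:E <= (K * vE n)%:E)%E) ->
  `|\sum_(k < N) ind (E n) (lam k) * \int[mu]_z a k z - vE n| <=
    1 / 2 * (CA * (vE (n + r) - vE (n - r)) + CB * (vE (n + r) - vE (n - r))) +
    (s / 2 * (CC * (K * vE n) + CA * vE n) +
     (2 * s)^-1 * (tail r * (K * vE n) + K * vE n * tail r)).
Proof.
move=> rn s0 K0 LN hK; have n0 : (0 < n)%N := leq_ltn_trans (leq0n r) rn.
have mE := measurable_MQ uM O n.
pose l (z : T) := \sum_(k < N) ind (E n) (lam k) * a k z - ind (E n) z.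
have i1 k : mu.-integrable setT (EFin \o (fun z => ind (E n) (lam k) * a k z)).
  have := integrableZl measurableT (ind (E n) (lam k)) (integrable_a k).
  by apply: eq_integrable => // z _; rewrite /= EFinM.
have i2 j : mu.-integrable setT (EFin \o (fun z => \sum_(k < j) ind (E n) (lam k) * a k z)).
  have := integrable_sum measurableT (index_enum 'I_j) (P := xpredT) (fun k _ => i1 (nat_of_ord k)).
  by apply: eq_integrable => // z _; rewrite /= sumEFin.
have i3 : mu.-integrable setT (EFin \o (ind (E n) : T -> R)).
  apply/integrableP; split; first exact: measurable_eindic.
  under eq_integral do rewrite /= ger0_norm ?indic_ge0//.
  by rewrite (measure_indic mE) (measure_E O uM n0) ltry.
have il : mu.-integrable setT (EFin \o l).
  have := integrableB measurableT (i2 N) i3.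
  by apply: eq_integrable => // z _; rewrite /= EFinB.
have E1 j : \int[mu]_z (\sum_(k < j) ind (E n) (lam k) * a k z) =
    \sum_(k < j) ind (E n) (lam k) * \int[mu]_z a k z.
  elim: j => [|j IH]; first by rewrite big_ord0; under eq_Rintegral do rewrite big_ord0; rewrite Rintegral_cst// mul0r.
  under eq_Rintegral do rewrite big_ord_recr/=.
  rewrite (RintegralD measurableT (i2 j) (i1 j)) IH big_ord_recr/=; congr (_ + _).
  by rewrite RintegralZl//; exact: integrable_a.
have -> : \sum_(k < N) ind (E n) (lam k) * \int[mu]_z a k z - vE n = \int[mu]_z l z.
  rewrite /l (RintegralB measurableT (i2 N) i3) E1; congr (_ - _).
  by rewrite /Rintegral (measure_indic mE) (measure_E O uM n0).
apply: (@Rintegral_le_int_bounded _ _ _ mu (qerr n r s) _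
  (fun k z => (ind (E n) (lam k) - ind (E n) z) * a k z)) => //.
- apply: int_bounded_qerr => //; rewrite mulr_ge0// ltW//; exact: vE_gt0.
- by have /integrableP[/measurable_EFinP] := il.
- by move=> k z; apply: qerr_dominates => //; exact: ltnW.
move=> z.
have h : ind (E n) z * series (a^~ z) j @[j --> \oo] --> ind (E n) z.
  rewrite -[X in _ --> X]mulr1; apply: cvgM; [exact: cvg_cst|exact: a_one].
have h2 : \sum_(k < N) ind (E n) (lam k) * a k z - ind (E n) z * series (a^~ z) j @[j --> \oo]
    --> l z.
  by rewrite /l; apply: cvgB; [exact: cvg_cst|exact: h].
apply: cvg_trans h2; apply: near_eq_cvg; near=> j.
have Nj : (N <= j)%N by near: j; exists N.
rewrite /series/= big_mkord; under [RHS]eq_bigr do rewrite mulrBl.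
rewrite big_mkord sumrB -mulr_sumr; congr (_ - _).
rewrite -(subnKC Nj) big_split_ord/= [X in _ = _ + X]big1 ?addr0// => i _.
rewrite indicE memNset ?mul0r// => h3; have := LN (N + i)%N h3.
by rewrite /= ltnNge leq_addr.
Unshelve. all: by end_near. Qed.

End ErrorBound.

Lemma cvg_natr_ratio (R : realType) (r : nat) :
  ((n + r)%:R / n%:R : R) @[n --> \oo] --> (1 : R).
Proof.
apply/cvgrPdist_lt => e e0; near=> n.
have n0 : 0 < n%:R :> R by rewrite ltr0n; near: n; exists 1%N.
have -> : 1 - (n + r)%:R / n%:R = - (r%:R / n%:R) :> R by rewrite natrD; field; rewrite gt_eqF.
rewrite normrN ger0_norm ?divr_ge0 ?ler0n// ltr_pdivrMr// -ltr_pdivrMl// mulrC.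
near: n; exact: nbhs_infty_gtr.
Unshelve. all: by end_near. Qed.

Lemma cvg_natr_ratio_sub (R : realType) (r : nat) :
  ((n - r)%:R / n%:R : R) @[n --> \oo] --> (1 : R).
Proof.
have h : 2 - ((n + r)%:R / n%:R : R) @[n --> \oo] --> (1 : R).
  have e1 : 1 = 2 - 1 :> R by lra.
  rewrite [X in _ --> X]e1.
  by apply: cvgB; [exact: cvg_cst|exact: cvg_natr_ratio].
apply: cvg_trans h; apply: near_eq_cvg; near=> n.
have n0 : n%:R != 0 :> R by rewrite pnatr_eq0 -lt0n; near: n; exists 1%N.
have rn : (r <= n)%N by near: n; exists r.
by rewrite natrD natrB//; field.
Unshelve. all: by end_near. Qed.

Lemma cvg_exprn (R : realType) (u : nat -> R) d : u @ \oo --> (1 : R) ->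
  u n ^+ d @[n --> \oo] --> (1 : R).
Proof.
move=> hu; elim: d => [|d IH]; first by under eq_fun do rewrite expr0; exact: cvg_cst.
have h : u n * u n ^+ d @[n --> \oo] --> (1 : R) by rewrite -[X in _ --> X]mulr1; exact: cvgM.
by under eq_fun do rewrite exprS.
Qed.

(** Ring volumes are differences of d-th powers of n + r and n - r, both asymptotic to n^d. *)
Lemma cvg_ring_ratio (R : realType) d (M : 'M[R]_d) (uM : M \in unitmx) r :
  (vE M (n + r) - vE M (n - r)) / vE M n @[n --> \oo] --> (0 : R).
Proof.
have h : ((n + r)%:R / n%:R : R) ^+ d - ((n - r)%:R / n%:R) ^+ d @[n --> \oo] --> (0 : R).
  rewrite -(subrr (1 : R)); apply: cvgB; apply: cvg_exprn.
    exact: cvg_natr_ratio.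
  exact: cvg_natr_ratio_sub.
apply: cvg_trans h; apply: near_eq_cvg; near=> n.
have n0 : (0 < n)%N by near: n; exists 1%N.
have := vE_gt0 uM (ltn0Sn 0); rewrite /vE expr1n mul1r => V0.
rewrite !expr_div_n; field; rewrite gt_eqF// expf_neq0//= pnatr_eq0 -lt0n//.
Unshelve. all: by end_near. Qed.

(** * Passage to the limit *)

Section Limit.
Context (R : realType) (d : nat) (M : 'M[R]_d) (O : 'rV[R]_d) (lam : nat -> 'rV[R]_d).
Local Notation T := (Tm R d).
Local Notation mu := (@muR R d).
Context (F : T -> R) (CA CB CC : R) (al a : nat -> T -> R).
Hypotheses (uM : M \in unitmx) (mF : measurable_fun setT F) (F0 : forall w, 0 <= F w).
Hypotheses (Flty : (\int[mu]_w (F w)%:E < +oo)%E) (Fgt0 : (0 < \int[mu]_w (F w)%:E)%E).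
Hypotheses (CA0 : 0 <= CA) (CB0 : 0 <= CB) (CC0 : 0 <= CC).
Hypotheses (FCB : forall z : T, (\sum_(0 <= k <oo) (F ((z : 'rV[R]_d) - lam k))%:E <= CB%:E)%E).
Hypotheses (mal : forall k, measurable_fun setT (al k)) (al0 : forall k z, 0 <= al k z).
Hypotheses (alCA : forall z, (\sum_(0 <= k <oo) (al k z)%:E <= CA%:E)%E).
Hypotheses (alCC : forall k, (\int[mu]_z (al k z)%:E <= CC%:E)%E).
Hypotheses (ma : forall k, measurable_fun setT (a k)).
Hypothesis a_sq : forall k z, a k z ^+ 2 <= al k z * F ((z : 'rV[R]_d) - lam k).
Hypothesis a_one : forall z, series (fun k => a k z) @ \oo --> (1 : R).

Lemma indic_Lam n k : \1_(MQ M O n) (lam k) = \1_(Lam_n lam M O n) k :> R.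
Proof.
rewrite !indicE; congr (_%:R); congr nat_of_bool.
Qed.

Theorem density_limit : exists K n0, [/\ 0 <= K, (0 < n0)%N,
    (forall n, (n0 <= n)%N -> finite_set (Lam_n lam M O n)),
    (forall n, (n0 <= n)%N -> cardL lam M O n <= K * vE M n) &
    (\sum_(k \in Lam_n lam M O n) \int[mu]_z a k z) / vE M n @[n --> \oo] --> (1 : R)].
Proof.
have [K [n0 [K0 n00 hK]]] := count_le O uM mF F0 Flty Fgt0 CB0 FCB.
have ser n : (n0 <= n)%N ->
    (\sum_(0 <= k <oo) (\1_(Lam_n lam M O n) k : R)%:E <= (K * vE M n)%:E)%E.
  by move=> hn; have := hK n 0 hn; under eq_eseriesr do rewrite addr0 indic_Lam.
have fin n : (n0 <= n)%N -> finite_set (Lam_n lam M O n).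
  by move=> /ser; exact: finite_of_series.
exists K, n0; split=> // [n hn|].
  have [N LN] := finite_nat_bounded (fin n hn).
  rewrite /cardL (@fsbig_indic R R^o _ _ (fun=> 1) LN) -lee_fin.
  apply: le_trans (ser n hn); rewrite -sumEFin.
  under eq_bigr do rewrite [_ *: _]mulr1.
  rewrite -(big_mkord xpredT (fun k => (\1_(Lam_n lam M O n) k : R)%:E)).
  by apply: nneseries_lim_ge => k _ _; rewrite lee_fin indicE.
apply/cvgrPdist_lt => e e0.
(* Each of the three error terms gets at most e/4 of the volume: [s] settles the dual term, [r] then
   makes the tail small relative to [s], and [n] finally thins the ring. The added 1 keeps
   denominators positive. *)
pose s := e / (2 * (CC * K + CA + 1)).
have D0 : 0 < CC * K + CA + 1 by rewrite ltr_wpDl// addr_ge0// mulr_ge0.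
have s0 : 0 < s by rewrite divr_gt0// mulr_gt0.
have t0 : 0 < e * s / (4 * (K + 1)) by rewrite divr_gt0 ?(mulr_gt0 e0 s0)// mulr_gt0// ltr_wpDl.
have /cvgr_lt/(_ _ t0)[r _ hr] := tail_cvg0 uM mF F0 Flty.
have {hr}hr : tail M F r < e * s / (4 * (K + 1)) by apply: hr => /=.
have C0 : 0 < e / (2 * (CA + CB + 1)) by rewrite divr_gt0// mulr_gt0// ltr_wpDl// addr_ge0.
near=> n.
have hn : (n0 <= n)%N by near: n; exists n0.
have rn : (r < n)%N by near: n; exists r.+1.
have ring : (vE M (n + r) - vE M (n - r)) / vE M n < e / (2 * (CA + CB + 1)).
  by near: n; exact: (cvgr_lt _ (cvg_ring_ratio uM r)).
have v0 : 0 < vE M n by apply: vE_gt0 => //; exact: leq_trans hn.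
have [N LN] := finite_nat_bounded (fin n hn).
have := error_bound uM mF F0 Flty CA0 CB0 CC0 FCB mal al0 alCA alCC ma a_sq a_one
  rn s0 K0 LN (hK n ^~ hn).
under eq_bigr do rewrite indic_Lam.
rewrite -(@fsbig_indic R R^o _ _ (fun k => \int[mu]_z a k z) LN).
move: (\sum_(k \in _) _) => I eb.
have -> : 1 - I / vE M n = (vE M n - I) / vE M n by field; rewrite gt_eqF.
rewrite normrM normfV (gtr0_norm v0) ltr_pdivrMr// distrC; apply: (le_lt_trans eb).
rewrite ltr_pdivrMr// in ring.
move: ring hr v0; move: (vE M n) (vE M (n + r)) (vE M (n - r)) => v v1 v2 ring hr v0.
have h1 : (CA + CB) * (v1 - v2) <= e / 2 * v.
  have AB0 : 0 <= CA + CB by exact: addr_ge0.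
  apply: (le_trans (ler_wpM2l AB0 (ltW ring))); rewrite mulrA ler_wpM2r ?(ltW v0)//.
  rewrite mulrA ler_pdivrMr; last by rewrite mulr_gt0// ltr_wpDl.
  by nra.
have h2 : s / 2 * (CC * (K * v) + CA * v) < e / 4 * v.
  have es : e / 4 = s / 2 * (CC * K + CA + 1) by rewrite /s; field; rewrite gt_eqF.
  rewrite es -subr_gt0 (_ : _ - _ = s / 2 * v); last by ring.
  by rewrite mulr_gt0// divr_gt0.
have h3 : (2 * s)^-1 * (tail M F r * (K * v) + K * v * tail M F r) <= e / 4 * v.
  rewrite (_ : _ * (_ + _) = s^-1 * tail M F r * K * v); last by field; rewrite gt_eqF.
  rewrite ler_wpM2r ?(ltW v0)//.
  apply: (@le_trans _ _ (e / (4 * (K + 1)) * K)).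
    rewrite ler_wpM2r// ler_pdivrMl//; apply: (le_trans (ltW hr)).
    by rewrite [e * s]mulrC -mulrA.
  rewrite mulrAC ler_pdivrMr; last by rewrite mulr_gt0// ltr_wpDl.
  by rewrite mulrA divfK ?pnatr_eq0// ler_wpM2l ?(ltW e0)// lerDl.
move: h2 h3; move: (s / 2 * _) ((2 * s)^-1 * _) => X Y h2 h3.
have := mulr_gt0 e0 v0; move: (v1 - v2) h1 => w h1 ev.
have {}h1 : (CA + CB) * w <= e * v / 2 by rewrite mulrAC.
have {}h2 : X < e * v / 4 by rewrite mulrAC.
have {}h3 : Y <= e * v / 4 by rewrite mulrAC.
rewrite -mulrDl; move: (_ * w) (e * v) h1 h2 h3 ev => Z W; lra.
Unshelve. all: by end_near. Qed.
End Limit.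

(** * Gabor frames *)

Section Bridge.
Context (R : realType).
Notation CC := (R[i] : numClosedFieldType).

Lemma cseriesP (a : nat -> R[i]) (l : R[i]) :
  cseries_to a l <-> ((fun N => \sum_(k < N) (a k : CC)) @ \oo --> (l : CC)).
Proof.
have reE N : re (\sum_(k < N) (a k : CC)) = series (fun k => re (a k)) N.
  rewrite /series /= big_mkord; elim: N => [|N IH]; first by rewrite !big_ord0.
  by rewrite !big_ord_recr/= -IH; case: (\sum_(i < N) _) => ? ?; case: (a N).
have imE N : im (\sum_(k < N) (a k : CC)) = series (fun k => im (a k)) N.
  rewrite /series /= big_mkord; elim: N => [|N IH]; first by rewrite !big_ord0.
  by rewrite !big_ord_recr/= -IH; case: (\sum_(i < N) _) => ? ?; case: (a N).
split=> [[h1 h2]|h]; last first.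
  split.
    have := cvg_comp _ _ h (@continuous_re R l).
    by rewrite (_ : _ \o _ = series (fun k => re (a k)))//; apply/funext => N; rewrite /= reE.
  have := cvg_comp _ _ h (@continuous_im R l).
  by rewrite (_ : _ \o _ = series (fun k => im (a k)))//; apply/funext => N; rewrite /= imE.
apply/cvgrPdist_lt => e /gt0_CC[-> e0]; near=> N.
apply: le_lt_trans (normc_le _) _; rewrite ltcR.
have H1 : `|re l - series (fun k => re (a k)) N| < re e / 2.
  by near: N; move/cvgrPdist_lt: h1; apply; rewrite divr_gt0.
have H2 : `|im l - series (fun k => im (a k)) N| < re e / 2.
  by near: N; move/cvgrPdist_lt: h2; apply; rewrite divr_gt0.
rewrite -reE in H1; rewrite -imE in H2; rewrite re_add re_opp im_add im_opp; lra.
Unshelve. all: by end_near. Qed.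

Context (m : nat).
Local Notation mu := (@muR R m).

Lemma l2norm2_int (f : 'rV[R]_m -> R[i]) : cmeas (f : Tm R m -> R[i]) ->
  l2norm2 f = (\int[mu]_x (sqmod (f x))%:E)%E.
Proof.
move=> mf; apply: iint_eE; first exact: cmeas_esqmod.
by move=> x; rewrite lee_fin sqmod_ge0.
Qed.

Lemma inL2P (f : 'rV[R]_m -> R[i]) : inL2 f <-> L2 mu f.
Proof.
split=> [[/measurable_rVP mf]|[mf lf]].
  by rewrite l2norm2_int// => lf; split.
by split; [exact/measurable_rVP|rewrite l2norm2_int].
Qed.

Lemma l2norm2E (f : 'rV[R]_m -> R[i]) : L2 mu f -> l2norm2 f = (nrm mu f)%:E.
Proof. by move=> lf; rewrite l2norm2_int ?nrmE//; exact: (L2_cmeas lf). Qed.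

Lemma ipE (f h : 'rV[R]_m -> R[i]) : L2 mu f -> L2 mu h -> ip f h = cip mu f h.
Proof.
move=> lf lh; have [i1 i2] := L2_cintegrable lf lh.
by rewrite /ip /cint /cip /cI (iint_rE i1) (iint_rE i2).
Qed.

(* Polarisation of Moyal's identity. *)
Lemma int_re_cip_Hz (u v : 'rV[R]_m -> R[i]) : L2 mu u -> L2 mu v ->
  \int[@muR R (m + m)]_z re (cip mu (Hz z) v * cip mu u (Hz z)) = re (cip mu u v).
Proof.
move=> lu lv.
pose U f (z : Tm R (m + m)) := sqmod (cip mu f (Hz z)).
have iU f : L2 mu f -> (@muR R (m + m)).-integrable setT (EFin \o U f).
  move=> lf; apply/integrableP; split.
    exact: (cmeas_esqmod (cmeas_cip_Hz (L2_cmeas lf))).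
  under eq_integral do rewrite /= ger0_norm ?sqmod_ge0//.
  by rewrite moyal//; case: lf.
have IU f : L2 mu f -> \int[@muR R (m + m)]_z U f z = nrm mu f.
  by move=> lf; rewrite /Rintegral moyal// -nrmE.
have lw := L2_comb 1 lu lv.
have Lh (z : 'rV[R]_(m + m)) : L2 mu (Hz z : Tm R m -> R[i]) by exact: L2_hm.
have E z : re (cip mu (Hz z) v * cip mu u (Hz z)) =
    2^-1 * (U (fun x => u x + 1 * v x) z - U u z - U v z).
  rewrite /U (cip_comb 1 lu lv (Lh z)) (cipC lv (Lh z)) /sqmod.
  case: (cip mu u _) => a b; case: (cip mu v _) => c d /=; field => //.
have i1 := integrableB measurableT (iU _ lw) (iU _ lu).
have i2 := integrableB measurableT i1 (iU _ lv).
transitivity (\int[@muR R (m + m)]_z (2^-1 * (U (fun x => u x + 1 * v x) z - U u z - U v z))).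
  by congr fine; apply: eq_integral => z _; rewrite E.
rewrite RintegralZl// RintegralB//; last exact: iU.
rewrite RintegralB//; [|exact: iU|exact: iU].
rewrite !IU// nrm_comb// rmorph1 mul1r /sqmod /= expr0n expr1n addr0 mul1r; field => //.
Qed.

End Bridge.

(** All the analysis reaches the theorem through this statement: [r k] is the real number <g_k,
    g~_k>, [C] will keep the density away from 0 and [K] will keep it finite. *)
Theorem gabor_density_limit (R : realType) (m : nat) (g : 'rV[R]_m -> R[i])
    (lam : nat -> 'rV[R]_(m + m)) (phi : nat -> R)
    (O : 'rV[R]_(m + m)) (M : 'M[R]_(m + m)) :
  inL2 g -> is_frame (gabor g lam phi) -> M \in unitmx ->
  exists (r : nat -> R) (C K : R) (n0 : nat),
    [/\ forall k, ip (gabor g lam phi k) (candual (gabor g lam phi) k) = (r k)%:C,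
        0 < C /\ forall k, r k <= C,
        (0 < n0)%N /\ (forall n, (n0 <= n)%N -> finite_set (Lam_n lam M O n)),
        (forall n, (n0 <= n)%N -> cardL lam M O n <= K * vE M n) &
        (\sum_(k \in Lam_n lam M O n) r k) / vE M n @[n --> \oo] --> (1 : R)].
Proof.
move=> /inL2P Lg [A [B [A0 [B0 fr]]]] uM.
pose mu := muR R m; pose G := gabor g lam phi.
have LG k : L2 mu (G k) by exact: L2_gabor.
have bessel f : L2 mu f -> (\sum_(0 <= k <oo) (sqmod (cip mu f (G k)))%:E <= (B * nrm mu f)%:E)%E.
  move=> lf; have [_] := fr _ ((inL2P f).2 lf); rewrite l2norm2E// -EFinM; apply: le_trans.
  by apply: lee_nneseries => [k _ _|k _]; rewrite lee_fin ?sqmod_ge0// ipE.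
have lower f : L2 mu f -> ((A * nrm mu f)%:E <= \sum_(0 <= k <oo) (sqmod (cip mu f (G k)))%:E)%E.
  move=> lf; have [+ _] := fr _ ((inL2P f).2 lf); rewrite l2norm2E// -EFinM => /le_trans; apply.
  by apply: lee_nneseries => [k _ _|k _]; rewrite lee_fin ?sqmod_ge0// ipE.
have B0' := ltW B0.
pose gt := candual G.
have [Lgt gtP] : (forall k, L2 mu (gt k)) /\ forall k v, L2 mu v ->
    cseries_to (fun j => cip mu (gt k) (G j) * cip mu (G j) v) (cip mu (G k) v).
  (* [candual] is a choice through [xget]; it meets its specification because the frame operator is
     surjective. *)
  have dualP k : inL2 (gt k) /\ frame_op_eq G (gt k) (G k).
    apply: (@xgetPex _ _ (fun h => inL2 h /\ frame_op_eq G h (G k))).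
    have [u Lu uP] := frame_operator_surjective LG bessel A0 B0' lower (LG k).
    exists u; split=> [|f /inL2P Lf]; first exact/inL2P.
    rewrite (ipE (LG k) Lf); under eq_fun do under eq_bigr do rewrite (ipE Lu (LG _)) (ipE (LG _) Lf).
    by apply: (proj1 (cseriesP (fun j => cip mu u (G j) * cip mu (G j) f) _)); exact: uP.
  have Lgt k : L2 mu (gt k) by apply/inL2P; have [] := dualP k.
  split=> // k v Lv; apply: (proj2 (cseriesP (fun j => cip mu (gt k) (G j) * cip mu (G j) v) _)).
  have [_ /(_ v ((inL2P v).2 Lv))] := dualP k.
  rewrite (ipE (LG k) Lv).
  by under eq_fun do under eq_bigr do rewrite (ipE (Lgt k) (LG _)) (ipE (LG _) Lv).
pose d := (m + m)%N.
pose F (w : Tm R d) := sqmod (cip mu g (Hz w)).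
pose al k (z : Tm R d) := sqmod (cip mu (Hz z) (gt k)).
pose a k (z : Tm R d) := re (cip mu (Hz z) (gt k) * cip mu (G k) (Hz z)).
have LH (z : 'rV[R]_d) : L2 mu (Hz z) by exact: L2_hm.
have nH (z : 'rV[R]_d) : nrm mu (Hz z) = 1 by exact: nrm_hm.
have nG k : nrm mu (G k) = nrm mu g by exact: nrm_gabor.
have Fk k (z : Tm R d) : F ((z : 'rV[R]_d) - lam k) = sqmod (cip mu (G k) (Hz z)).
  by rewrite /F -(gabor_covariance lam phi Lg).
have alE k z : al k z = sqmod (cip mu (gt k) (Hz z)) by rewrite /al (cipC (Lgt k) (LH z)) sqmodC.
have iF : (\int[muR R d]_w (F w)%:E = (nrm mu g)%:E)%E by rewrite /F moyal// nrmE.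
(* If g were null, all coefficients of the unit vector [Hz 0] would vanish, against the lower frame
   bound. This gives [F] the positive mass on which the counting rests. *)
have ng : 0 < nrm mu g.
  rewrite lt_def nrm_ge0// andbT; apply/eqP => ng0.
  have := lower _ (LH 0); rewrite nH mulr1.
  rewrite eseries0 ?lee_fin ?leNgt ?A0// => k _ _.
  congr _%:E; apply/eqP; rewrite eq_le sqmod_ge0 andbT.
  by rewrite (le_trans (cip_cauchy_schwarz (LH 0) (LG k)))// nG ng0 mulr0.
have CC0 : 0 <= nrm mu g / A ^+ 2 by rewrite divr_ge0 ?exprn_ge0// ltW.
have Fgt0 : (0 < \int[muR R d]_w (F w)%:E)%E by rewrite iF lte_fin.
have Flty : (\int[muR R d]_w (F w)%:E < +oo)%E by rewrite iF ltry.
have mF : measurable_fun setT F by exact: (cmeas_sqmod (cmeas_cip_Hz (L2_cmeas Lg))).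
have FCB (z : Tm R d) : (\sum_(0 <= k <oo) (F ((z : 'rV[R]_d) - lam k))%:E <= B%:E)%E.
  have := bessel _ (LH z); rewrite nH mulr1; apply: le_trans.
  by apply: lee_nneseries => [k _ _|k _]; rewrite lee_fin ?sqmod_ge0// Fk (cipC (LH z) (LG k)) sqmodC.
have mal k : measurable_fun setT (al k).
  rewrite (_ : al k = fun z => sqmod (cip mu (gt k) (Hz z))); last exact/funext/alE.
  exact: (cmeas_sqmod (cmeas_cip_Hz (L2_cmeas (Lgt k)))).
have alCA (z : Tm R d) : (\sum_(0 <= k <oo) (al k z)%:E <= (A^-1)%:E)%E.
  by have := dual_bessel LG bessel A0 B0' lower Lgt gtP (LH z); rewrite nH mul1r.
have alCC k : (\int[muR R d]_z (al k z)%:E <= (nrm mu g / A ^+ 2)%:E)%E.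
  under eq_integral do rewrite alE.
  rewrite (moyal (Lgt k)) -(nrmE (Lgt k)) lee_fin -(nG k).
  exact: (dual_nrm_le LG bessel A0 lower Lgt gtP k).
have ma k : measurable_fun setT (a k).
  have [h _] : cmeas (fun z : Tm R d => (cip mu (gt k) (Hz z))^* * cip mu (G k) (Hz z)).
    by apply: cmeasM; [apply: cmeas_conj|]; apply: cmeas_cip_Hz; exact: L2_cmeas.
  rewrite (_ : a k = fun z => re ((cip mu (gt k) (Hz z))^* * cip mu (G k) (Hz z)))//.
  by apply/funext => z; rewrite /a (cipC (Lgt k) (LH z)).
have a_sq k (z : Tm R d) : a k z ^+ 2 <= al k z * F ((z : 'rV[R]_d) - lam k).
  rewrite Fk /al -sqmodM /a /sqmod; move: (cip _ _ _ * _) => w.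
  by rewrite lerDl sqr_ge0.
have a_one (z : Tm R d) : series (fun k => a k z) @ \oo --> (1 : R).
  by rewrite -(nH z); exact: (dual_reconstruction LG bessel A0 B0' lower Lgt gtP (LH z)).
have ia k : \int[muR R d]_z a k z = re (cip mu (G k) (gt k)) by exact: int_re_cip_Hz.
have [|K [n0 [K0 n00 hfin hcard hlim]]] := density_limit O uM mF (fun w => sqmod_ge0 _) Flty Fgt0 _ B0' CC0
  FCB mal (fun k z => sqmod_ge0 _) alCA alCC ma a_sq a_one.
  by rewrite invr_ge0 ltW.
exists (fun k => re (cip mu (G k) (gt k))), (nrm mu g / A), K, n0; split=> //.
- move=> k; rewrite -/G -/gt (ipE (LG k) (Lgt k)).
  by have := dual_pairing_real LG Lgt gtP k; case: (cip _ _ _) => x y /= ->.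
- split=> [|k]; first by rewrite divr_gt0.
  by rewrite -(nG k); exact: (dual_pairing_le LG bessel A0 lower Lgt gtP k).
- by under eq_fun do under eq_fsbigr do rewrite -ia.
Qed.

(** * Limits along free ultrafilters *)

Lemma ultrafilter_bounded_cvg (R : realType) (p : set_system nat) (u : nat -> R) (K : R) :
  UltraFilter p -> (\forall n \near p, 0 <= u n <= K) ->
  exists D : R, u n @[n --> p] --> D.
Proof.
move=> up hu.
have [D [_ clD]] : `[0, K]%classic `&` cluster (u @ p) !=set0.
  apply: (@segment_compact R 0 K).
  by apply: filterS hu => n; rewrite /= in_itv.
(* Either [U] or its complement has its preimage in [p], and a cluster point rules out the
   complement. *)
exists D => U DU; have [//|pn] := in_ultra_setVsetC (u @^-1` U) up.
by have [y [nUy Uy]] := clD (~` U) U pn DU.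
Qed.

(** The complement of an eventual property is finite, hence outside [p]; so limits along [\oo] are
    limits along [p]. *)
Lemma free_ultrafilter_cofinite (p : set_system nat) : free_ultrafilter p ->
  forall P : set nat, (\forall n \near \oo, P n) -> p P.
Proof.
move=> [up fp] P [N _ hN].
have [//|pn] := @in_ultra_setVsetC nat p P up.
case: (fp (~` P)) => //; apply: (@sub_finite_set _ _ `I_N); last exact: finite_II.
by move=> n /= nP; rewrite ltnNge; apply/negP => Nn; apply: nP; exact: hN.
Qed.

Lemma fsbig_realC (R : realType) (S : set nat) (r : nat -> R) : finite_set S ->
  (\sum_(k \in S) (r k)%:C : R[i]) = (\sum_(k \in S) r k)%:C.
Proof.
by move=> fS; rewrite !fsbig_finite// rmorph_sum.
Qed.

Theorem theorem9p4 (R : realType) (m : nat) (g : 'rV[R]_m -> R[i])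
    (lam : nat -> 'rV[R]_(m + m)) (phi : nat -> R)
    (O : 'rV[R]_(m + m)) (M : 'M[R]_(m + m)) :
  inL2 g ->
  is_frame (gabor g lam phi) ->
  M \in unitmx ->
  forall p : set_system nat, free_ultrafilter p ->
    frame_measure g lam phi M O p = ((density lam M O p)^-1)%:C.
Proof.
move=> Lg fr uM p fp; have up := fp.1; have cof := free_ultrafilter_cofinite fp.
have [r [C [K [n0 [rE [C0 rC] [n00 hfin] hcard hlim]]]]] := gabor_density_limit O Lg fr uM.
pose v n := vE M n; pose x n := cardL lam M O n / v n.
pose I n := \sum_(k \in Lam_n lam M O n) r k.
have v0 n : (n0 <= n)%N -> 0 < v n by move=> h; apply: vE_gt0 => //; exact: leq_trans h.
have card_ge0 n : 0 <= cardL lam M O n by apply: fsumr_ge0.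
have Ile n : (n0 <= n)%N -> I n <= C * cardL lam M O n.
  move=> hn; have fL := hfin n hn.
  rewrite /I /cardL (fsbig_finite _ r fL) (fsbig_finite _ (fun=> 1) fL) mulr_sumr.
  by apply: ler_sum => k _; rewrite mulr1.
have [D xD] : exists D : R, x n @[n --> p] --> D.
  apply: (@ultrafilter_bounded_cvg _ _ _ K) => //; apply: cof; exists n0 => // n /= hn.
  have vn := v0 n hn; rewrite /x divr_ge0 ?(ltW vn)//= ler_pdivrMr//; exact: hcard.
have ID : I n / v n @[n --> p] --> (1 : R).
  by move=> U /hlim h; exact: cof.
(* The limit of [I n <= C * cardL lam M O n], divided by the volume, is [1 <= C * D]; the reciprocal
   may then be taken. *)
have D0 : 0 < D.
  have : 1 <= C * D.
    apply: (ler_cvg_to ID (cvgM (cvg_cst C) xD)).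
    apply: cof; exists n0 => // n /= hn.
    by rewrite /x mulrA ler_pM2r ?invr_gt0 ?v0// Ile.
  by move=> h; rewrite -(pmulr_rgt0 _ C0) (lt_le_trans ltr01 h).
have dE : density lam M O p = D.
  apply: cvg_lim => //; apply: cvg_trans xD; apply: near_eq_cvg; apply: cof; exists n0 => // n /= hn.
  rewrite /x /v; congr (_ / _).
  rewrite /vol iint_eE; last 2 first.
  - exact: (measurable_eindic (measurable_MQ uM O n)).
  - by move=> z; rewrite lee_fin indicE.
  by rewrite (measure_indic (measurable_MQ uM O n)) (measure_E O uM (leq_trans n00 hn)).
have lD : I n / cardL lam M O n @[n --> p] --> D^-1.
  have h : (I n / v n) * (x n)^-1 @[n --> p] --> 1 * D^-1.
    by apply: cvgM => //; apply: cvgV => //; rewrite gt_eqF.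
  rewrite mul1r in h; apply: cvg_trans h; apply: near_eq_cvg; apply: cof; exists n0 => // n /= hn.
  by rewrite /x invf_div mulrA divfK ?gt_eqF ?v0.
rewrite dE /frame_measure; apply: (@cvg_lim (R[i] : numClosedFieldType)) => //.
(* The limit in [frame_measure] lives in R[i]; real convergence carries over since positive complex
   radii are real. *)
have h : ((I n / cardL lam M O n)%:C : (R[i] : numClosedFieldType)) @[n --> p] -->
    ((D^-1)%:C : (R[i] : numClosedFieldType)).
  apply/cvgrPdist_lt => e /gt0_CC[-> e0].
  move/cvgrPdist_lt: lD => /(_ _ e0); apply: filterS => n hn.
  apply: le_lt_trans (normc_le _) _; rewrite ltcR re_add re_opp im_add im_opp /=.
  by rewrite subr0 normr0 addr0.
apply: cvg_trans h; apply: near_eq_cvg; apply: cof; exists n0 => // n /= hn.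
have -> : \sum_(k \in Lam_n lam M O n) ip (gabor g lam phi k) (candual (gabor g lam phi) k) = (I n)%:C.
  by rewrite -(fsbig_realC _ (hfin n hn)); apply: eq_fsbigr => k _; rewrite rE.
by rewrite -rmorphM mulrC.
Qed.
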